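(* Let $\mathcal{L}$ be a lattice in $\mathbb{R}^d$, $d\ge 1$, and let $\mathbf{p}=\{p_i,i\in\mathcal{L}\}$ be a strictly stationary Gaussian random field with values in $\mathbb{R}^d$ such that $p_0\sim\mathcal{N}_d(\mu,\Sigma)$ for some $\mu\in\mathbb{R}^d$ and some positive definite matrix $\Sigma\in\mathbb{R}^{d\times d}$. Assume, moreover, that $$\sum_{i\in\mathcal{L}}\|\mathrm{Cov}(p_0,p_i)\|<\infty.$$ Then the corresponding perturbed lattice $\Xi=\sum_{i\in\mathcal{L}}\delta_{i+p_i+U}$ is class-I hyperuniform.
   Context: A lattice $\mathcal{L}\subset\mathbb{R}^d$ is the set of all integer linear combinations of a basis $(a_1,\dots,a_d)$ of $\mathbb{R}^d$; its fundamental domain is $\mathcal{D}=\{\sum_{j=1}^d t_ja_j:\ (t_1,\dots,t_d)\in[0,1)^d\}$. $\lambda^d$ is Lebesgue measure, $B_r$ is the closed Euclidean ball of radius $r$ centered at $0$, and $\|\cdot\|$ is a matrix norm. For random vectors $X,Y$, $\mathrm{Cov}(X,Y)=\mathbb{E}[(X-\mathbb{E}X)(Y-\mathbb{E}Y)^\top]$. A random field $\{p_i,i\in\mathcal{L}\}$ of $\mathbb{R}^d$-valued random vectors is strictly stationary if $\{p_i,i\in\Lambda\}$ and $\{p_{i+j},i\in\Lambda\}$ have the same distribution for all $\Lambda\subset\mathcal{L}$ and $j\in\mathcal{L}$; it is Gaussian if all its finite-dimensional distributions are jointly Gaussian. The corresponding perturbed lattice is the stationary random counting measure $\Xi=\sum_{i\in\mathcal{L}}\delta_{i+p_i+U}$,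 where $U$ is uniformly distributed on $\mathcal{D}$ and independent of $\mathbf{p}$. A stationary point process $\mu$ on $\mathbb{R}^d$ is class-I hyperuniform if $\mathrm{Var}(\mu(B_r))/\lambda^d(B_r)=O(r^{-1})$ as $r\to\infty$, i.e. $\mathrm{Var}(\mu(B_r))=O(r^{d-1})$. *)

(* Defs.v *)
From HB Require Import structures.
From mathcomp Require Import all_boot all_order all_algebra.
From mathcomp Require Import all_classical all_reals all_analysis.

Set Implicit Arguments.
Unset Strict Implicit.
Unset Printing Implicit Defensive.

Import Order.TTheory GRing.Theory Num.Theory.
Import numFieldNormedType.Exports.

Local Open Scope classical_set_scope.
Local Open Scope ring_scope.

Definition measure_matrix_display : measure_display -> measure_display.
Proof. exact. Qed.

(* Matrices carry the product sigma-algebra, generated by the entries (the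
   library does the same for tuples); over R this is the Borel sigma-algebra. *)
Section measurable_matrix.
Context {d : measure_display} {T : measurableType d} (m n : nat).

Definition matrix_sigma_algebra : set (set 'M[T]_(m, n)) :=
  <<s \bigcup_(k in [set: 'I_m * 'I_n])
        preimage_set_system setT (fun M : 'M[T]_(m, n) => M k.1 k.2)
          measurable >>.

Let matrix_set0 : matrix_sigma_algebra set0.
Proof. exact: sigma_algebra0. Qed.

Let matrix_setC A : matrix_sigma_algebra A -> matrix_sigma_algebra (~` A).
Proof. exact: sigma_algebraC. Qed.

Let matrix_bigcup (F : _^nat) : (forall i, matrix_sigma_algebra (F i)) ->
  matrix_sigma_algebra (\bigcup_i (F i)).
Proof. exact: sigma_algebra_bigcup. Qed.

HB.instance Definition _ := @isMeasurable.Build (measure_matrix_display d)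
  'M[T]_(m, n) matrix_sigma_algebra matrix_set0 matrix_setC matrix_bigcup.

End measurable_matrix.

Lemma measurable_entry d (T : measurableType d) m n (i : 'I_m) (j : 'I_n) :
  measurable_fun setT (fun M : 'M[T]_(m, n) => M i j).
Proof.
by move=> _ A mA; apply: sub_sigma_algebra; exists (i, j) => //; exists A.
Qed.

Lemma measurable_fun_entriesP d d' (T : measurableType d)
    (T' : measurableType d') m n (f : T' -> 'M[T]_(m, n)) :
  (forall i j, measurable_fun setT (fun w => f w i j)) -> measurable_fun setT f.
Proof.
move=> mf; apply: (@measurability _ _ _ _ _ _ (\bigcup_(k in [set: 'I_m * 'I_n])
        preimage_set_system setT (fun M : 'M[T]_(m, n) => M k.1 k.2)
          measurable)) => //.
move=> _ [_ [[i j] _ [A mA <-]] <-]; rewrite setTI setTI.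
by have := mf i j measurableT A mA; rewrite setTI.
Qed.

Section lebesgue_cV.
Context {R : realType}.

Definition cons_cV n (xv : R * 'cV[R]_n) : 'cV[R]_n.+1 :=
  col_mx (xv.1)%:M xv.2.

Lemma measurable_cons_cV n : measurable_fun setT (@cons_cV n).
Proof.
apply: measurable_fun_entriesP => i j; rewrite /cons_cV.
have [k ->|k ->] := @split_ordP 1 n i.
  rewrite (_ : (fun _ => _) = fst); first exact: measurable_fst.
  by apply/funext => w; rewrite (@col_mxEu R 1 n 1) !ord1 mxE eqxx mulr1n.
rewrite (_ : (fun _ => _) = (fun v : 'cV[R]_n => v k j) \o snd); last first.
  by apply/funext => w /=; rewrite (@col_mxEd R 1 n 1).
by apply: measurableT_comp; [exact: measurable_entry|exact: measurable_snd].
Qed.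

Definition uncons_cV n (v : 'cV[R]_n.+1) : R * 'cV[R]_n :=
  (v ord0 ord0, dsubmx (v : 'cV_(1 + n))).

Lemma cons_cVK n : cancel (@cons_cV n) (@uncons_cV n).
Proof.
case=> x v; rewrite /uncons_cV /cons_cV/= col_mxKd.
have -> : ord0 = lshift n ord0 :> 'I_(1 + n) by exact/val_inj.
by rewrite (@col_mxEu R 1 n 1) mxE eqxx mulr1n.
Qed.

Lemma measurable_uncons_cV n : measurable_fun setT (@uncons_cV n).
Proof.
apply/measurable_fun_pairP; split; first exact: measurable_entry.
apply: measurable_fun_entriesP => i j.
rewrite (_ : (fun _ => _) = fun v : 'cV[R]_n.+1 => v (rshift 1 i) j).
  exact: measurable_entry.
by apply/funext => v /=; rewrite mxE.
Qed.

Section push_cons_cV.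
Variables (n : nat) (m : {sigma_finite_measure set 'cV[R]_n -> \bar R}).

Local Notation lm := (@lebesgue_measure R \x m)%E.

Definition push_cons_cV : set 'cV[R]_n.+1 -> \bar R :=
  pushforward lm (@cons_cV n).

Let mu0 : push_cons_cV set0 = 0%E.
Proof. by rewrite /push_cons_cV /pushforward preimage_set0 measure0. Qed.

Let mu_ge0 A : (0 <= push_cons_cV A)%E.
Proof. exact: (measure_ge0 lm). Qed.

Let mu_sigma_additive : semi_sigma_additive push_cons_cV.
Proof.
apply: measure_semi_sigma_additive; exact: measurable_cons_cV.
Qed.

HB.instance Definition _ := isMeasure.Build _ _ _ push_cons_cV
  mu0 mu_ge0 mu_sigma_additive.

Let mu_sigma_finite : sigma_finite setT push_cons_cV.
Proof.
have /sigma_finiteP[F [TF ndF Foo]] := sigma_finiteT (@lebesgue_measure R).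
have /sigma_finiteP[G [TG ndG Goo]] := sigma_finiteT m.
exists (fun k => @uncons_cV n @^-1` (F k `*` G k)).
  rewrite -preimage_bigcup -[LHS](preimage_setT (@uncons_cV n)).
  congr (_ @^-1` _); rewrite -setXTT TF TG predeqE => -[x y]; split.
    move=> [/= [k _ Fkx] [l _ Gly]]; exists (maxn k l) => //; split.
    - by move: x Fkx; exact/subsetPset/ndF/leq_maxl.
    - by move: y Gly; exact/subsetPset/ndG/leq_maxr.
  by move=> [k _ []/= ? ?]; split; exists k.
move=> k; have [? ?] := Foo k; have [? ?] := Goo k; split.
  rewrite -[X in measurable X]setTI; apply: measurable_uncons_cV => //.
  exact: measurableX.
rewrite /push_cons_cV /pushforward -comp_preimage.
rewrite (_ : _ \o _ = id); last by rewrite funeqE => x /=; rewrite cons_cVK.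
by rewrite preimage_id product_measure1E// lte_mul_pinfty// ge0_fin_numE.
Qed.

HB.instance Definition _ := Measure_isSigmaFinite.Build _ _ _ push_cons_cV
  mu_sigma_finite.

End push_cons_cV.

(* Lebesgue measure on R^n, as the n-fold product of the one on R: Dirac mass
   on the one-point space R^0, then
   lebesgue_cV n.+1 = image of lebesgue_measure \x lebesgue_cV n
   by (x, v) |-> (x; v). *)
Fixpoint lebesgue_cV n : {sigma_finite_measure set 'cV[R]_n -> \bar R} :=
  match n with
  | 0 => \d_(0 : 'cV[R]_0)
  | n'.+1 => push_cons_cV (lebesgue_cV n')
  end.

End lebesgue_cV.

Section lattices.
Context {R : realType} {d : nat}.
Implicit Types a : d.-tuple 'cV[R]_d.

Definition lattice a : set 'cV[R]_d :=
  [set \sum_(j < d) (z j)%:~R *: tnth a j | z in [set: 'I_d -> int]].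

Definition fundamental_domain a : set 'cV[R]_d :=
  [set \sum_(j < d) t j *: tnth a j | t in
    [set t : 'I_d -> R | forall j, 0 <= t j < 1]].

Definition closed_eball (r : R) : set 'cV[R]_d :=
  [set x | Num.sqrt (\sum_(k < d) x k ord0 ^+ 2) <= r].

(* Submultiplicativity is not required. *)
Definition is_matrix_norm (N : 'M[R]_d -> R) :=
  [/\ forall A, N A = 0 -> A = 0,
      forall c A, N (c *: A) = `|c| * N A &
      forall A B, N (A + B) <= N A + N B].

Definition positive_definite (S : 'M[R]_d) :=
  S^T = S /\ forall v : 'cV[R]_d, v != 0 -> 0 < (v^T *m S *m v) ord0 ord0.

End lattices.

Section gaussian.
Context {R : realType} {dT : measure_display} {T : measurableType dT}.
Variable P : probability T R.

(* X ~ N(m, v); library's normal_prob m s takes the standard deviation s and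
   is not a point mass when s = 0. *)
Definition normal_law (X : T -> R) (m v : R) :=
  forall A : set R, measurable A ->
    P (X @^-1` A) = if v == 0 then (\d_m A)%E else normal_prob m (Num.sqrt v) A.

(* X ~ N_d(mu, Sigma): u^T X ~ N(u^T mu, u^T Sigma u) for every vector u. *)
Definition multinormal_law d (X : T -> 'cV[R]_d) (mu : 'cV[R]_d)
    (Sigma : 'M[R]_d) :=
  forall u : 'cV[R]_d,
    normal_law (fun w => (u^T *m X w) ord0 ord0) ((u^T *m mu) ord0 ord0)
      ((u^T *m Sigma *m u) ord0 ord0).

(* The concatenation of X_0, ..., X_(n-1), a random vector of R^(nd), is
   Gaussian: all its linear functionals are normal, possibly degenerate. *)
Definition jointly_gaussian d n (X : 'I_n -> T -> 'cV[R]_d) :=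
  forall u : 'I_n -> 'cV[R]_d, exists m v : R, 0 <= v /\
    normal_law (fun w => \sum_(k < n) ((u k)^T *m X k w) ord0 ord0) m v.

(* Cov(X, Y) = E[(X - E X)(Y - E Y)^T], entrywise. *)
Definition covmx d (X Y : T -> 'cV[R]_d) : 'M[R]_d :=
  \matrix_(k, l)
    fine (covariance P (fun w => X w k ord0) (fun w => Y w l ord0)).

End gaussian.

(* Random fields on a subset L of R^d are total families p : 'cV_d -> T -> E
   whose values at indices outside L are irrelevant. *)
Section random_fields.
Context {R : realType} {dT : measure_display} {T : measurableType dT}.
Variable P : probability T R.
Context {d : nat}.
Implicit Types (L : set 'cV[R]_d) (p : 'cV[R]_d -> T -> 'cV[R]_d)
  (U : T -> 'cV[R]_d).

(* The product sigma-algebra of E^S, as a sigma-algebra of sets of total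
   families that only depend on the coordinates in S. *)
Definition cylinder_sigma_algebra (S : set 'cV[R]_d) :
    set (set ('cV[R]_d -> 'cV[R]_d)) :=
  <<s \bigcup_(i in S) preimage_set_system setT
        (fun x : 'cV[R]_d -> 'cV[R]_d => x i) measurable >>.

Definition strictly_stationary L p :=
  forall (S : set 'cV[R]_d) (j : 'cV[R]_d), S `<=` L -> L j ->
  forall C, cylinder_sigma_algebra S C ->
    P [set w | C (fun i => p i w)] = P [set w | C (fun i => p (i + j) w)].

Definition gaussian_field L p :=
  forall n (i : 'I_n -> 'cV[R]_d), (forall k, L (i k)) ->
    jointly_gaussian P (fun k => p (i k)).

Definition uniformly_distributed (D : set 'cV[R]_d) U :=
  forall A : set 'cV[R]_d, measurable A ->
    P (U @^-1` A) = (lebesgue_cV d (A `&` D) / lebesgue_cV d D)%E.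

(* Independence of the random vector U and of the whole field. *)
Definition independent_of_field L p U :=
  forall A C, measurable A -> cylinder_sigma_algebra L C ->
    P (U @^-1` A `&` [set w | C (fun i => p i w)]) =
    (P (U @^-1` A) * P [set w | C (fun i => p i w)])%E.

Definition perturbed_lattice L p U (w : T) (B : set 'cV[R]_d) : \bar R :=
  \esum_(i in L) (\d_(i + p i w + U w)%R B)%E.

(* Var(Xi(B_r)) / lambda^d(B_r) = O(1/r). Almost sure local finiteness, part of
   the notion of point process, makes the use of fine harmless. *)
Definition class_I_hyperuniform (Xi : T -> set 'cV[R]_d -> \bar R) :=
  {ae P, forall w, forall r : R, (Xi w (closed_eball r) < +oo)%E} /\
  exists C : R, \forall r \near +oo,
    ('V_P[fun w => fine (Xi w (closed_eball r))]
       / lebesgue_cV d (closed_eball r) <= (C / r)%:E)%E.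

End random_fields.

(* Main.v *)
(* Let B be the ball of radius r, V the covolume of the lattice and g the
   covariogram of B, i.e. g x = |B /\ (B - x)|; its Fourier transform is the
   square of that of 1_B, hence nonnegative. Stationarity of p, the uniform
   shift U and the tiling of space by the fundamental domain give
     E [Xi(B)] = |B| / V,   E [Xi(B)^2] = V^-1 sum_l E [g (l + p_l - p_0)].
   If p_l - p_0 were distributed as Y = sqrt 2 (p_0 - mu), the sum would be the
   expectation at Y of the periodization of g, whose Fejer sums are
   combinations of cosines with nonnegative coefficients: the zero frequency
   contributes |B|^2 / V, i.e. the square of the mean, and the others O(r^(d-1))
   by the decay of the Fourier transform of 1_B, their sum being tamed by the
   Gaussian characteristic function of Y.
   The characteristic functions of p_l - p_0 and Y differ at u by at most
   eps_l (1 - E cos(u.Y)) with eps_l = O(N (Cov(p_0, p_l))), and g itself is a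
   limit of nonnegative combinations of cosines, so that replacing p_l - p_0 by
   Y costs eps_l (g 0 - E [g Y]) = O(eps_l r^(d-1)), which is summable in l. *)

Require Import Defs.
From HB Require Import structures.
From mathcomp Require Import all_boot all_order all_algebra.
From mathcomp Require Import all_classical all_reals all_analysis.
From mathcomp Require Import measurable_realfun ring lra zify.

Set Implicit Arguments.
Unset Strict Implicit.
Unset Printing Implicit Defensive.

Import Order.TTheory GRing.Theory Num.Theory.
Import numFieldNormedType.Exports.

Local Open Scope classical_set_scope.
Local Open Scope ring_scope.

(** * Lebesgue measure on column vectors *)

(** The variance must come out one order below the volume, so every error has to save a factor r.
    This is why characteristic functions are compared in relative form: an error eps_l alone would
    be paid with g 0, of order r^d, whereas the factor 1 - E cos(u.Y) turns this into g 0 - E [g Y],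
    and g has a Lipschitz constant of order r^(d-1). Y has the law that p_l - p_0 would have if p_l
    and p_0 were independent. Positive definiteness of Sigma enters twice: it bounds u^T Cov(p_0,
    p_l) u by a multiple of u^T Sigma u, which makes the error relative, and it gives Gaussian decay
    along the dual lattice. Neither Fourier inversion nor convergence of Fourier series is invoked:
    Fejer sums are finite and converge uniformly because g is Lipschitz with bounded support, and g
    itself is reached by periodizing over dilated lattices until a single term is left. The decay of
    the transform of 1_B comes without Bessel functions, from a differential system and an energy.
    Complex numbers are avoided by carrying a phase c in cos(u.X + c). *)

Section lebesgue_line.
Context {R : realType}.
Local Notation mu := (@lebesgue_measure R).

(** Lebesgue measure is the only measure with the right values on half-open intervals, so it
    suffices to compute the image measure there; [lebesgue_measureM] is proved in the same way. *)
Lemma lebesgue_measureD (c : R) (A : set R) : measurable A ->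
  pushforward mu ((fun x => x + c) : _ -> measurableTypeR R) A = mu A.
Proof.
have mc : measurable_fun setT ((fun x : R => x + c) : _ -> measurableTypeR R).
  exact: measurable_funD.
move=> mA; apply/esym/lebesgue_measure_unique => //= _ [[a b]] _ <-.
rewrite /pushforward.
have -> : (fun x => x + c) @^-1` [set` `]a, b]] = [set` `]a - c, b - c]].
  by apply/seteqP; split => x /=; rewrite !in_itv/= ltrBlDr lerBrDr.
rewrite /= !lebesgue_measure_itv/= !lte_fin ltrD2r; case: ifPn => // _.
by rewrite -!EFinB; congr EFin; lra.
Qed.

Lemma ge0_integral_lineD (c : R) (f : R -> \bar R) :
  measurable_fun setT f -> (forall x, 0 <= f x)%E ->
  (\int[mu]_x f (x + c)%R = \int[mu]_x f x)%E.
Proof.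
move=> mf f0.
have mc : measurable_fun setT ((fun x : R => x + c) : _ -> measurableTypeR R).
  exact: measurable_funD.
rewrite [RHS](@eq_measure_integral _ _ _ setT
  (pushforward mu ((fun x => x + c) : _ -> measurableTypeR R))); last first.
- by move=> A mA _; exact/esym/lebesgue_measureD.
- by rewrite ge0_integral_pushforward.
Qed.

Lemma lebesgue_measureM (c : R) (A : set R) : 0 < c -> measurable A ->
  (c%:E * pushforward mu (( *%R c) : _ -> measurableTypeR R) A)%E = mu A.
Proof.
move=> c0.
have mc : measurable_fun setT (( *%R c) : _ -> measurableTypeR R).
  exact: measurable_funM.
pose m := mscale (NngNum (ltW c0)) (pushforward mu (( *%R c) : _ -> measurableTypeR R)).
move=> mA; apply/esym; rewrite (_ : (_ * _)%E = m mc A)//.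
apply: lebesgue_measure_unique => //= _ [[a b]] _ <-.
rewrite /m/= /mscale/= /pushforward.
have -> : *%R c @^-1` [set` `]a, b]] = [set` `]a / c, b / c]].
  by apply/seteqP; split => x /=; rewrite !in_itv/= ltr_pdivrMr// ler_pdivlMr// mulrC.
rewrite /= !lebesgue_measure_itv/= !lte_fin ltr_pM2r ?invr_gt0//.
case: ifPn => _; last by rewrite mule0.
by rewrite -!EFinB -EFinM -mulrBl mulrC divfK// gt_eqF.
Qed.

Lemma ge0_integral_lineN (f : R -> \bar R) :
  measurable_fun setT f -> (forall x, 0 <= f x)%E ->
  (\int[mu]_x f (- x)%R = \int[mu]_x f x)%E.
Proof.
move=> mf f0.
have mc : measurable_fun setT (-%R : _ -> measurableTypeR R).
  exact: measurable_funN.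
rewrite [RHS](@eq_measure_integral _ _ _ setT
  (pushforward mu (-%R : _ -> measurableTypeR R))); last first.
- by move=> A mA _; exact/esym/lebesgue_measureN.
- by rewrite ge0_integral_pushforward.
Qed.

Lemma ge0_integral_lineM (c : R) (f : R -> \bar R) : c != 0 ->
  measurable_fun setT f -> (forall x, 0 <= f x)%E ->
  (`|c|%:E * \int[mu]_x f (c * x)%R = \int[mu]_x f x)%E.
Proof.
wlog c0 : c f / 0 < c.
  move=> H c0 mf f0; have [c_gt0|cN|cE] := ltgtP 0 c; [exact: H| |].
  - rewrite -normrN -[RHS]ge0_integral_lineN//.
    rewrite -(H (- c) (fun x => f (- x))) ?oppr_gt0 ?oppr_eq0//.
      by under [X in _ = (_ * X)%E]eq_integral do rewrite mulNr opprK.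
    by apply: measurableT_comp => //; exact: measurable_funN.
  - by move: c0; rewrite -cE eqxx.
move=> _ mf f0.
have mc : measurable_fun setT (( *%R c) : _ -> measurableTypeR R).
  exact: measurable_funM.
rewrite [RHS](@eq_measure_integral _ _ _ setT
  (mscale (NngNum (ltW c0)) (pushforward mu (( *%R c) : _ -> measurableTypeR R)))); last first.
- by move=> A mA _; exact/esym/(lebesgue_measureM c0 mA).
- by rewrite ge0_integral_mscale//= ge0_integral_pushforward//= gtr0_norm.
Qed.

End lebesgue_line.

Section cV_measurability.
Context {R : realType}.

Lemma measurable_cV_comp d (T : measurableType d) n (f : T -> 'cV[R]_n) i :
  measurable_fun setT f -> measurable_fun setT (fun w => f w i ord0).
Proof.
by move=> mf; apply: (measurableT_comp (measurable_entry _ _) mf).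
Qed.

Lemma measurable_cV_entriesP d (T : measurableType d) n (f : T -> 'cV[R]_n) :
  (forall i, measurable_fun setT (fun w => f w i ord0)) -> measurable_fun setT f.
Proof.
by move=> mf; apply: measurable_fun_entriesP => i j; rewrite ord1; exact: mf.
Qed.

Lemma measurable_cVD d (T : measurableType d) n (f g : T -> 'cV[R]_n) :
  measurable_fun setT f -> measurable_fun setT g ->
  measurable_fun setT (fun w => f w + g w).
Proof.
move=> mf mg; apply: measurable_cV_entriesP => i.
under eq_fun do rewrite mxE.
by apply: measurable_funD; exact: measurable_cV_comp.
Qed.

Lemma measurable_cVZ d (T : measurableType d) n (c : R) (f : T -> 'cV[R]_n) :
  measurable_fun setT f -> measurable_fun setT (fun w => c *: f w).
Proof.
move=> mf; apply: measurable_cV_entriesP => i.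
under eq_fun do rewrite mxE.
by apply: measurable_funM => //; exact: measurable_cV_comp.
Qed.

Lemma measurable_cVN d (T : measurableType d) n (f : T -> 'cV[R]_n) :
  measurable_fun setT f -> measurable_fun setT (fun w => - f w).
Proof.
move=> mf; under eq_fun do rewrite -scaleN1r; exact: measurable_cVZ.
Qed.

Lemma measurable_cVB d (T : measurableType d) n (f g : T -> 'cV[R]_n) :
  measurable_fun setT f -> measurable_fun setT g ->
  measurable_fun setT (fun w => f w - g w).
Proof. by move=> mf mg; apply: measurable_cVD => //; exact: measurable_cVN. Qed.

End cV_measurability.

Section lebesgue_space.
Context {R : realType}.
Implicit Types n : nat.

(** [lebesgue_cV n.+1] is by definition the image of a product measure, so this is Tonelli's
    theorem. Translations and dilations are then treated by induction on the dimension, one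
    coordinate at a time. *)
Lemma ge0_integral_cons n (f : 'cV[R]_n.+1 -> \bar R) :
  measurable_fun setT f -> (forall x, 0 <= f x)%E ->
  (\int[lebesgue_cV n.+1]_x f x =
   \int[@lebesgue_measure R]_x \int[lebesgue_cV n]_v f (cons_cV (x, v)))%E.
Proof.
move=> mf f0.
rewrite [LHS](_ : _ = (\int[pushforward (@lebesgue_measure R \x lebesgue_cV n) (@cons_cV R n)]_x f x)%E)//.
rewrite ge0_integral_pushforward//; last exact: measurable_cons_cV.
rewrite preimage_setT fubini_tonelli1//; last by move=> ? /=; exact: f0.
by apply: measurableT_comp => //; exact: measurable_cons_cV.
Qed.

Lemma measurable_cons_partial n (f : 'cV[R]_n.+1 -> \bar R) :
  measurable_fun setT f -> (forall x, 0 <= f x)%E ->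
  measurable_fun setT (fun x => \int[lebesgue_cV n]_v f (cons_cV (x, v)))%E.
Proof.
move=> mf f0.
have mg : measurable_fun setT (f \o @cons_cV R n).
  by apply: measurableT_comp => //; exact: measurable_cons_cV.
refine (@measurable_fun_fubini_tonelli_F _ _ _ _ _ (lebesgue_cV n) _ mg _) => z.
exact: f0.
Qed.

Lemma uncons_cVK n : cancel (@uncons_cV R n) (@cons_cV R n).
Proof.
move=> v; rewrite /uncons_cV /cons_cV/=.
rewrite (_ : (v ord0 ord0)%:M = usubmx (v : 'cV_(1 + n))) ?vsubmxK//.
apply/matrixP => i j; rewrite !ord1 !mxE eqxx mulr1n; congr (v _ _); exact/val_inj.
Qed.

Lemma cons_cVD n x (v : 'cV[R]_n) y w :
  cons_cV (x, v) + cons_cV (y, w) = cons_cV (x + y, v + w).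
Proof. by rewrite /cons_cV/= (@add_col_mx R 1 n 1) -raddfD. Qed.

Lemma cons_cVZ n c x (v : 'cV[R]_n) :
  c *: cons_cV (x, v) = cons_cV (c * x, c *: v).
Proof. by rewrite /cons_cV/= (@scale_col_mx R 1 n 1) scale_scalar_mx. Qed.

Lemma measurable_cons_cVr n x : measurable_fun setT (fun v : 'cV[R]_n => cons_cV (x, v)).
Proof.
exact: (measurableT_comp (@measurable_cons_cV R n) (pair1_measurable x)).
Qed.

Lemma ge0_integral_cVD n (c : 'cV[R]_n) (f : 'cV[R]_n -> \bar R) :
  measurable_fun setT f -> (forall x, 0 <= f x)%E ->
  (\int[lebesgue_cV n]_x f (x + c)%R = \int[lebesgue_cV n]_x f x)%E.
Proof.
elim: n c f => [|n IH] c f mf f0.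
  by apply: eq_integral => x _; congr f; apply/matrixP => -[].
have mfc : measurable_fun setT (fun x : 'cV[R]_n.+1 => f (x + c)).
  by apply: measurableT_comp => //; apply: measurable_cVD.
rewrite !ge0_integral_cons//.
rewrite -(ge0_integral_lineD (uncons_cV c).1 (measurable_cons_partial mf f0)); last first.
  by move=> x; apply: integral_ge0.
apply: eq_integral => x _ /=.
rewrite -(IH (uncons_cV c).2 (fun v => f (cons_cV (x + (uncons_cV c).1, v))))//; last first.
  refine (measurableT_comp mf (measurable_cons_cVr _)).
by apply: eq_integral => v _; rewrite -cons_cVD -surjective_pairing uncons_cVK.
Qed.

Lemma ge0_integral_cVZ n (c : R) (f : 'cV[R]_n -> \bar R) : c != 0 ->
  measurable_fun setT f -> (forall x, 0 <= f x)%E ->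
  ((`|c| ^+ n)%:E * \int[lebesgue_cV n]_x f (c *: x)%R = \int[lebesgue_cV n]_x f x)%E.
Proof.
move=> c0; elim: n f => [|n IH] f mf f0.
  rewrite expr0 mul1e; apply: eq_integral => x _; congr f; apply/matrixP => -[]//.
have mfc : measurable_fun setT (fun x : 'cV[R]_n.+1 => f (c *: x)).
  by apply: measurableT_comp => //; apply: measurable_cVZ.
rewrite !ge0_integral_cons//.
have mp : measurable_fun setT (fun x => \int[lebesgue_cV n]_v f (cons_cV (x, v)))%E.
  exact: measurable_cons_partial.
rewrite -[RHS](ge0_integral_lineM c0 mp); last by move=> x; apply: integral_ge0.
rewrite exprS EFinM -muleA; congr (_ * _)%E.
rewrite -ge0_integralZl//; last 2 first.
- by refine (measurable_cons_partial mfc _) => z; exact: f0.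
- by move=> x _; apply: integral_ge0.
apply: eq_integral => x _ /=.
rewrite -[RHS](IH (fun v => f (cons_cV (c * x, v))))//; last first.
  refine (measurableT_comp mf (measurable_cons_cVr _)).
by congr (_ * _)%E; apply: eq_integral => v _; rewrite -cons_cVZ.
Qed.

End lebesgue_space.

(** * Euclidean norm and balls *)

Section euclid.
Context {R : realType} {n : nat}.
Implicit Types (x y u : 'cV[R]_n) (r : R).

Definition dot u x : R := \sum_k u k ord0 * x k ord0.
(** The same expression as in [closed_eball], so that membership in a ball is convertible to
    [enorm x <= r]. *)
Definition enorm x : R := Num.sqrt (\sum_k x k ord0 ^+ 2).

Lemma dotE u x : dot u x = (u^T *m x) ord0 ord0.
Proof. by rewrite mxE; apply: eq_bigr => k _; rewrite !mxE. Qed.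

Lemma dotC u x : dot u x = dot x u.
Proof. by apply: eq_bigr => k _; rewrite mulrC. Qed.

Lemma dotDr u x y : dot u (x + y) = dot u x + dot u y.
Proof. by rewrite /dot -big_split; apply: eq_bigr => k _; rewrite mxE mulrDr. Qed.

Lemma dotZr u c x : dot u (c *: x) = c * dot u x.
Proof. by rewrite /dot mulr_sumr; apply: eq_bigr => k _; rewrite mxE mulrCA. Qed.

Lemma dotNr u x : dot u (- x) = - dot u x.
Proof. by rewrite -scaleN1r dotZr mulN1r. Qed.

Lemma dotBr u x y : dot u (x - y) = dot u x - dot u y.
Proof. by rewrite dotDr dotNr. Qed.

Lemma dotDl u v x : dot (u + v) x = dot u x + dot v x.
Proof. by rewrite !(dotC _ x) dotDr. Qed.

Lemma dotZl u c x : dot (c *: u) x = c * dot u x.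
Proof. by rewrite !(dotC _ x) dotZr. Qed.

Lemma dot0r u : dot u 0 = 0.
Proof. by rewrite -(scale0r u) dotZr mul0r. Qed.

Lemma dot_ge0 x : 0 <= dot x x.
Proof. by apply: sumr_ge0 => k _; rewrite -expr2 sqr_ge0. Qed.

Lemma enorm_sq x : enorm x ^+ 2 = dot x x.
Proof.
rewrite sqr_sqrtr; last by apply: sumr_ge0 => k _; rewrite sqr_ge0.
by apply: eq_bigr => k _; rewrite expr2.
Qed.

Lemma enorm_ge0 x : 0 <= enorm x.
Proof. exact: sqrtr_ge0. Qed.

Lemma dot_sq_le u x : dot u x ^+ 2 <= dot u u * dot x x.
Proof.
have [u0|u0] := eqVneq (dot u u) 0.
  have uk k : u k ord0 = 0.
    move/eqP: u0; rewrite psumr_eq0; last by move=> i _; rewrite -expr2 sqr_ge0.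
    by move/allP/(_ k (mem_index_enum _)) => /=; rewrite mulf_eq0 orbb => /eqP.
  by rewrite u0 mul0r /dot big1 ?expr0n// => k _; rewrite uk mul0r.
have up : 0 < dot u u by rewrite lt_def u0 dot_ge0.
(* Cauchy-Schwarz: the component of [x] orthogonal to [u] has a nonnegative squared length. *)
have := dot_ge0 (x - (dot u x / dot u u) *: u).
rewrite -(pmulr_rge0 _ up) !(dotBr, dotDl, dotC (- _), dotNr) .
rewrite !(dotZr, dotC (_ *: _)) (dotC x u) => H.
rewrite -subr_ge0; apply: le_trans H _; rewrite le_eqVlt; apply/orP; left; apply/eqP.
by field.
Qed.

Lemma dot_le_enorm u x : `|dot u x| <= enorm u * enorm x.
Proof.
rewrite -(ler_pXn2r (ltn0Sn 1)) ?nnegrE ?mulr_ge0 ?enorm_ge0//.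
by rewrite exprMn !enorm_sq real_normK ?num_real// dot_sq_le.
Qed.

Lemma enormD x y : enorm (x + y) <= enorm x + enorm y.
Proof.
rewrite -(ler_pXn2r (ltn0Sn 1)) ?nnegrE ?addr_ge0 ?enorm_ge0//.
rewrite sqrrD !enorm_sq dotDr !dotDl (dotC y x).
have := le_trans (ler_norm _) (dot_le_enorm x y); lra.
Qed.

Lemma enormZ c x : enorm (c *: x) = `|c| * enorm x.
Proof.
apply/eqP; rewrite -(@eqrXn2 _ 2) ?mulr_ge0 ?enorm_ge0// exprMn !enorm_sq.
by rewrite real_normK ?num_real// dotZr dotZl mulrA -expr2.
Qed.

Lemma enormN x : enorm (- x) = enorm x.
Proof. by rewrite -scaleN1r enormZ normrN1 mul1r. Qed.

Lemma enorm0 : enorm (0 : 'cV[R]_n) = 0.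
Proof. by rewrite -(scale0r 0) enormZ normr0 mul0r. Qed.

Lemma enormB x y : enorm (x - y) <= enorm x + enorm y.
Proof. by rewrite (le_trans (enormD _ _))// enormN. Qed.

Lemma entry_le_enorm x i : `|x i ord0| <= enorm x.
Proof.
rewrite -(ler_pXn2r (ltn0Sn 1)) ?nnegrE ?enorm_ge0// real_normK ?num_real// enorm_sq.
rewrite /dot (bigD1 i)//= -expr2 lerDl sumr_ge0// => k _; rewrite -expr2 sqr_ge0//.
Qed.

Lemma enorm_le_sum x : enorm x <= \sum_k `|x k ord0|.
Proof.
rewrite -(ler_pXn2r (ltn0Sn 1)) ?nnegrE ?enorm_ge0 ?sumr_ge0//.
rewrite enorm_sq expr2 mulr_suml ler_sum// => k _.
rewrite -[leLHS]ger0_norm; last by rewrite -expr2 sqr_ge0.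
by rewrite normrM ler_wpM2l// (bigD1 k)//= lerDl sumr_ge0.
Qed.

Lemma closed_eballP r x : closed_eball r x <-> enorm x <= r.
Proof. by []. Qed.

Lemma closed_eballE r x : (x \in (closed_eball r : set 'cV[R]_n)) = (enorm x <= r).
Proof. by apply/idP/idP; rewrite inE. Qed.

Lemma measurable_dot d (T : measurableType d) u (f : T -> 'cV[R]_n) :
  measurable_fun setT f -> measurable_fun setT (fun w => dot u (f w)).
Proof.
move=> mf; apply: measurable_sum => k; apply: measurable_funM => //.
exact: measurable_cV_comp.
Qed.

Lemma measurable_enorm d (T : measurableType d) (f : T -> 'cV[R]_n) :
  measurable_fun setT f -> measurable_fun setT (fun w => enorm (f w)).
Proof.
move=> mf; rewrite /enorm.
have ms : measurable_fun setT (fun w => \sum_k f w k ord0 ^+ 2).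
  apply: measurable_sum => k; apply: measurable_funX.
  exact: measurable_cV_comp.
exact: (measurableT_comp (continuous_measurable_fun (@sqrt_continuous R)) ms).
Qed.

Lemma measurable_closed_eball r : measurable (closed_eball r : set 'cV[R]_n).
Proof.
have := @measurable_enorm _ _ id (@measurable_id _ _ _) measurableT _
  (measurable_itv `]-oo, r]).
by rewrite setTI => H; rewrite (_ : closed_eball r = (fun w => enorm w) @^-1` `]-oo, r]%classic).
Qed.

End euclid.
#[global] Hint Resolve measurable_closed_eball : core.

Section lebesgue_integrals.
Context {R : realType} {n : nat}.
Local Notation lam := (@lebesgue_cV R n).
Implicit Types (f : 'cV[R]_n -> R).

Lemma integral_cVD (c : 'cV[R]_n) (f : 'cV[R]_n -> \bar R) :
  measurable_fun setT f ->
  (\int[lam]_x f (x + c)%R = \int[lam]_x f x)%E.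
Proof.
move=> mf; rewrite integralE [RHS]integralE.
congr (_ - _)%E.
- rewrite -(ge0_integral_cVD c (measurable_funepos mf))//.
  by apply: eq_integral => x _; rewrite ?(funeposE, funenegE).
- rewrite -(ge0_integral_cVD c (measurable_funeneg mf))//.
  by apply: eq_integral => x _; rewrite ?(funeposE, funenegE).
Qed.

Lemma Rintegral_cVD (c : 'cV[R]_n) f : measurable_fun setT f ->
  \int[lam]_x f (x + c) = \int[lam]_x f x.
Proof.
by move=> mf; congr fine; rewrite -[RHS](integral_cVD c)//; exact/measurable_EFinP.
Qed.

Lemma ge0_integral_cVN (f : 'cV[R]_n -> \bar R) :
  measurable_fun setT f -> (forall x, 0 <= f x)%E ->
  (\int[lam]_x f (- x)%R = \int[lam]_x f x)%E.
Proof.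
move=> mf f0; rewrite -[RHS](@ge0_integral_cVZ _ n (-1))// ?oppr_eq0 ?oner_eq0//.
rewrite normrN1 expr1n mul1e; apply: eq_integral => x _; by rewrite scaleN1r.
Qed.

Lemma Rintegral_cVN f : measurable_fun setT f ->
  \int[lam]_x f (- x) = \int[lam]_x f x.
Proof.
move=> mf; congr fine; rewrite integralE [RHS]integralE.
have /measurable_EFinP mf' := mf.
congr (_ - _)%E.
- rewrite -(ge0_integral_cVN (measurable_funepos mf'))//.
  by apply: eq_integral => x _; rewrite ?(funeposE, funenegE).
- rewrite -(ge0_integral_cVN (measurable_funeneg mf'))//.
  by apply: eq_integral => x _; rewrite ?(funeposE, funenegE).
Qed.

Lemma ge0_integral_cVZV (c : R) (f : 'cV[R]_n -> \bar R) : c != 0 ->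
  measurable_fun setT f -> (forall x, 0 <= f x)%E ->
  (\int[lam]_x f (c *: x)%R = (`|c| ^- n)%:E * \int[lam]_x f x)%E.
Proof.
move=> c0 mf f0; rewrite -[in RHS](ge0_integral_cVZ c0 mf f0) muleA -EFinM mulVf ?mul1e//.
by rewrite expf_neq0// normr_eq0.
Qed.

Lemma integral_cVZ (c : R) (f : 'cV[R]_n -> \bar R) : c != 0 ->
  lam.-integrable setT f ->
  (\int[lam]_x f (c *: x)%R = (`|c| ^- n)%:E * \int[lam]_x f x)%E.
Proof.
move=> c0 fi; have mf := measurable_int lam fi.
rewrite integralE [in RHS]integralE muleBr//; last first.
  exact: integrable_add_def.
congr (_ - _)%E.
- rewrite -(ge0_integral_cVZV c0 (measurable_funepos mf))//.
  by apply: eq_integral => x _; rewrite ?(funeposE, funenegE).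
- rewrite -(ge0_integral_cVZV c0 (measurable_funeneg mf))//.
  by apply: eq_integral => x _; rewrite ?(funeposE, funenegE).
Qed.

Lemma Rintegral_cVZ (c : R) f : c != 0 -> lam.-integrable setT (EFin \o f) ->
  \int[lam]_x f (c *: x) = `|c| ^- n * \int[lam]_x f x.
Proof.
move=> c0 fi; rewrite /Rintegral (integral_cVZ c0 fi) fineM//.
exact: integrable_fin_num.
Qed.

End lebesgue_integrals.

(** * Volumes of balls, shells and spheres *)

Section ball_volume.
Context {R : realType}.

Lemma cons_cV0 n (x : R) (v : 'cV[R]_n) : cons_cV (x, v) ord0 ord0 = x.
Proof. by have [] := cons_cVK (x, v). Qed.

Lemma cons_cVS n (x : R) (v : 'cV[R]_n) i : cons_cV (x, v) (lift ord0 i) ord0 = v i ord0.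
Proof.
rewrite /cons_cV/= (_ : lift ord0 i = rshift 1 i) ?(@col_mxEd R 1 n 1)//.
exact/val_inj.
Qed.

(** Cubes have an explicit volume: a cube around the ball shows that its volume is finite, a small
    cube inside the unit ball that it is positive. *)
Definition cube n (r : R) : set 'cV[R]_n := [set x | forall i, `|x i ord0| <= r].

Lemma measurable_cube n r : measurable (@cube n r).
Proof.
rewrite (_ : cube r = \bigcap_(i in [set: 'I_n]) ((fun x => `|x i ord0|) @^-1` `]-oo, r])).
  apply: fin_bigcap_measurable => [|i _]; first exact: finite_finset.
  have := measurableT_comp (@normr_measurable R setT) (@measurable_entry _ R n 1 i ord0).
  by move/(_ measurableT _ (measurable_itv `]-oo, r])); rewrite setTI.
apply/seteqP; split => x /= H i => [_|]; have := H i; first by rewrite /= in_itv.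
by move=> /(_ I); rewrite /= in_itv.
Qed.

Lemma lebesgue_cV_cube n r : 0 <= r -> lebesgue_cV n (cube r) = ((r *+ 2) ^+ n)%:E.
Proof.
move=> r0; elim: n => [|n IH].
  by rewrite expr0 /= diracE mem_set// => -[].
rewrite /= /push_cons_cV /pushforward.
have -> : @cons_cV R n @^-1` cube r = `[- r, r] `*` cube r.
  apply/seteqP; split => -[x v] /=.
    move=> H; split; first by have := H ord0; rewrite cons_cV0 in_itv/= ler_norml.
    by move=> i; have := H (lift ord0 i); rewrite cons_cVS.
  move=> [+ H] i; rewrite in_itv/= -ler_norml => H0.
  by have [j ->|->] := unliftP ord0 i; rewrite ?cons_cVS ?cons_cV0.
rewrite product_measure1E//; last exact: measurable_cube.
rewrite [X in (_ * X)%E]IH [X in (X * _)%E](lebesgue_measure_itv `[- r, r])/= lte_fin.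
case: ifPn => [_|]; first by rewrite -EFinB -EFinM opprK exprS -mulr2n.
rewrite -leNgt => rr; have -> : r = 0 by lra.
by rewrite mul0e mul0rn exprS mul0r.
Qed.

Context {n : nat}.
Local Notation lam := (@lebesgue_cV R n).
Local Notation B := (@closed_eball R n).

Lemma le_lam A A' : measurable A -> measurable A' -> A `<=` A' -> (lam A <= lam A')%E.
Proof. by move=> mA mA'; apply: le_measure; rewrite inE. Qed.

Lemma lam_ball_fin r : lam (B r) \is a fin_num.
Proof.
rewrite ge0_fin_numE//; have [r0|r0] := leP 0 r.
  apply: (@le_lt_trans _ _ (lam (cube r))).
    apply: le_lam; [exact: measurable_closed_eball|exact: measurable_cube|].
    by move=> x /closed_eballP Bx i; exact: le_trans (entry_le_enorm x i) Bx.
  by rewrite lebesgue_cV_cube ?ltry.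
rewrite (_ : B r = set0) ?measure0//; apply/seteqP; split => x //= xr.
by have := le_lt_trans xr r0; rewrite ltNge sqrtr_ge0.
Qed.

Definition vol (r : R) : R := fine (lam (B r)).

Lemma volE r : lam (B r) = (vol r)%:E.
Proof. by rewrite /vol fineK// lam_ball_fin. Qed.

Lemma vol_ge0 r : 0 <= vol r.
Proof. exact: fine_ge0. Qed.

Lemma le_vol r s : r <= s -> vol r <= vol s.
Proof.
move=> rs; rewrite -lee_fin -!volE; apply: le_lam; rewrite ?inE; [exact: measurable_closed_eball..|].
by move=> x xr; exact: le_trans xr rs.
Qed.

Lemma volZ r : 0 < r -> vol r = r ^+ n * vol 1.
Proof.
move=> r0; apply: EFin_inj; rewrite EFinM -!volE.
have vE s : lam (B s) = (\int[lam]_x (\1_(B s) x)%:E)%E.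
  by rewrite integral_indic ?setIT//; exact: measurable_closed_eball.
have mB : measurable_fun setT (fun x => (\1_(B r) x : R)%:E).
  by apply/measurable_EFinP; apply: measurable_indic; exact: measurable_closed_eball.
rewrite !vE -(ge0_integral_cVZ (lt0r_neq0 r0) mB) ?gtr0_norm//.
congr (_ * _)%E; apply: eq_integral => x _; rewrite !indicE; congr (_%:R%:E).
congr nat_of_bool; rewrite !closed_eballE enormZ gtr0_norm// -ler_pdivlMl// mulVf//.
by rewrite gt_eqF.
Qed.

Lemma vol1_gt0 : 0 < vol 1.
Proof.
(* The Euclidean norm is at most the sum of the n entries, hence at most n / (n + 1); n + 1 also
   covers dimension 0. *)
pose r : R := n.+1%:R^-1.
have r0 : 0 < r by rewrite invr_gt0.
rewrite (@lt_le_trans _ _ ((r *+ 2) ^+ n))//; first by rewrite exprn_gt0// mulrn_wgt0.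
rewrite -lee_fin -volE -(lebesgue_cV_cube n (ltW r0)); apply: le_lam; [exact: measurable_cube|exact: measurable_closed_eball|].
move=> x xr; rewrite /= closed_eballP (le_trans (enorm_le_sum _))//.
rewrite (@le_trans _ _ (\sum_(k < n) r))//; first by apply: ler_sum => k _; exact: xr.
rewrite sumr_const card_ord -mulr_natl ler_pdivrMr// mul1r ler_nat//.
Qed.

Lemma vol_gt0 r : 0 < r -> 0 < vol r.
Proof. by move=> r0; rewrite volZ// mulr_gt0 ?exprn_gt0 ?vol1_gt0. Qed.

(** A shell of thickness s costs one power of r less than the ball. By homogeneity this is the
    factorization of (r + s)^n - r^n, each of whose n terms is at most (2 r)^(n-1) as s <= r. The
    surface order r^(d-1) of the final bound has this as one of its sources. *)
Lemma vol_diff_le r s : 0 < r -> 0 <= s <= r ->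
  vol (r + s) - vol r <= n%:R * (2 * r) ^+ n.-1 * s * vol 1.
Proof.
move=> r0 /andP[s0 sr]; rewrite (@volZ (r + s)) ?ltr_wpDr// (volZ r0) -mulrBl ler_wpM2r ?vol_ge0//.
rewrite subrXX [r + s - r]addrC addKr mulrC ler_wpM2r//.
apply: (@le_trans _ _ (\sum_(i < n) (2 * r) ^+ n.-1)).
  apply: ler_sum => i _.
  rewrite -[X in (2 * r) ^+ X](@subnK i); last by rewrite -ltnS (leq_trans (ltn_ord i))// leqSpred.
  rewrite exprD.
  have ? : 0 <= 2 * r by lra.
  by apply: ler_pM; rewrite ?exprn_ge0 ?addr_ge0 ?(ltW r0)//; apply: lerXn2r; rewrite ?nnegrE//; lra.
by rewrite sumr_const card_ord -[leLHS]mulr_natl lexx.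
Qed.

Lemma measurable_sphere r : measurable [set x : 'cV[R]_n | enorm x = r].
Proof.
have := @measurable_enorm R n _ _ id (@measurable_id _ _ _) measurableT _
  (measurable_set1 r).
by rewrite setTI.
Qed.

(** The sphere lies in the shell between the radii 1 - e and 1, of volume at most K e for every
    small e. It is the exceptional null set in [ball_divergence]. *)
Lemma lam_sphere1 : lam [set x | enorm x = 1] = 0%E.
Proof.
pose S := [set x : 'cV[R]_n | enorm x = 1].
have SB : S `<=` B 1 by move=> x /= xE; rewrite closed_eballP xE.
have Sfin : lam S \is a fin_num.
  rewrite ge0_fin_numE// (@le_lt_trans _ _ (lam (B 1)))//; last by rewrite volE ltry.
  by apply: le_lam; [exact: (measurable_sphere 1)|exact: measurable_closed_eball|].
rewrite -/S -(fineK Sfin); congr EFin.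
set s := fine _; have s0 : 0 <= s by exact: fine_ge0.
pose K := n%:R * 2 ^+ n.-1 * vol 1.
have K0 : 0 <= K by rewrite !mulr_ge0 ?vol_ge0// exprn_ge0.
have sK e : 0 < e <= 2^-1 -> s <= K * e.
  move=> /andP[e0 e1].
  have sv : s <= vol (1 - e + e) - vol (1 - e).
    have mS : measurable S := measurable_sphere 1.
    have mB : measurable (B (1 - e)) := measurable_closed_eball _.
    have SBe : S `&` B (1 - e) = set0.
      by apply/seteqP; split => // x [/= xE /closed_eballP]; rewrite xE => ?; lra.
    rewrite subrK lerBrDr -lee_fin EFinD fineK// -!volE.
    rewrite (_ : (_ + _)%E = lam (S `|` B (1 - e))); last by rewrite measureU.
    apply: le_lam; [exact: measurableU|exact: measurable_closed_eball|].
    by move=> x [/SB//|] /closed_eballP ?; apply/closed_eballP; lra.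
  apply: le_trans sv _; apply: le_trans (vol_diff_le _ _) _; [lra|lra|].
  rewrite /K mulrAC ler_wpM2r ?(ltW e0)// ler_wpM2r ?vol_ge0// ler_wpM2l//.
  by apply: lerXn2r; rewrite ?nnegrE; lra.
apply/eqP; rewrite eq_le s0 andbT leNgt; apply/negP => sp.
(* With this e the bound K e drops below s; the minimum with 1/2 keeps e <= 1 - e, as [vol_diff_le]
   requires. *)
pose e := Num.min 2^-1 (s / (2 * (K + 1))).
have e0 : 0 < e by rewrite lt_min invr_gt0 ltr0n/= divr_gt0//; lra.
have := sK e; rewrite e0 ge_min lexx => /(_ isT).
have : K * e <= K * (s / (2 * (K + 1))) by rewrite ler_wpM2l// ge_min lexx orbT.
have : K * (s / (2 * (K + 1))) < s by rewrite mulrA ltr_pdivrMr; nra.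
lra.
Qed.

Lemma bsupp_integrable (f : 'cV[R]_n -> R) C rho : measurable_fun setT f ->
  (forall x, `|f x| <= C * \1_(B rho) x) -> lam.-integrable setT (EFin \o f).
Proof.
have mB : measurable_fun setT (fun x => (\1_(B rho) x : R)).
  by apply: measurable_indic; exact: measurable_closed_eball.
move=> mf fC; apply/integrableP; split; first exact/measurable_EFinP.
apply: (@le_lt_trans _ _ (\int[lam]_x (`|C|%:E * (\1_(B rho) x)%:E))%E).
  apply: ge0_le_integral => //=.
  - by apply/measurable_EFinP; exact: (measurableT_comp (@normr_measurable R setT) mf).
  - by apply: measurable_funeM; apply/measurable_EFinP; exact: mB.
  - by move=> x _; rewrite -EFinM lee_fin (le_trans (fC x))// ler_wpM2r// ler_norm//.
rewrite ge0_integralZl//; last by apply/measurable_EFinP; exact: mB.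
rewrite integral_indic//; last exact: measurable_closed_eball.
by rewrite setIT [X in (_ * X)%E]volE -EFinM ltry.
Qed.

End ball_volume.

(** * Fourier decay of the ball *)

Section real_integrable.
Context d (T : measurableType d) (R : realType) (mu : {measure set T -> \bar R}).
Variables (D : set T) (mD : measurable D).
Implicit Types f g : T -> R.

Lemma RintegrableB f g : mu.-integrable D (EFin \o f) ->
  mu.-integrable D (EFin \o g) -> mu.-integrable D (EFin \o (fun x => f x - g x)).
Proof.
by move=> fi gi; apply: eq_integrable (integrableB mD fi gi).
Qed.

Lemma RintegrableD f g : mu.-integrable D (EFin \o f) ->
  mu.-integrable D (EFin \o g) -> mu.-integrable D (EFin \o (fun x => f x + g x)).
Proof.
by move=> fi gi; apply: eq_integrable (integrableD mD fi gi).
Qed.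

Lemma RintegrableZl (k : R) f : mu.-integrable D (EFin \o f) ->
  mu.-integrable D (EFin \o (fun x => k * f x)).
Proof.
by move=> fi; apply: eq_integrable (integrableZl mD k fi).
Qed.

End real_integrable.

Section translation_derivative.
Context d (T : measurableType d) (R : realType) (mu : {measure set T -> \bar R}).
Local Open Scope ring_scope.

(** Invariance under [tau k] makes every difference quotient integrate to zero, and dominated
    convergence passes this on to the derivative. It takes the place of a divergence theorem with
    boundary. *)
Lemma Rintegral_translation_derivative (f g G : T -> R) (tau : nat -> T -> T)
    (h : nat -> R) :
  (forall k, h k != 0) ->
  mu.-integrable setT (EFin \o f) ->
  (forall k, mu.-integrable setT (EFin \o (f \o tau k))) ->
  (forall k, \int[mu]_x f (tau k x) = \int[mu]_x f x) ->
  measurable_fun setT g ->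
  {ae mu, forall x, (f (tau k x) - f x) / h k @[k --> \oo] --> g x} ->
  mu.-integrable setT (EFin \o G) ->
  (forall k x, `|(f (tau k x) - f x) / h k| <= G x) ->
  mu.-integrable setT (EFin \o g) /\ \int[mu]_x g x = 0.
Proof.
move=> h0 fi fti fE mg cvg Gi fG.
pose u k x := (f (tau k x) - f x) / h k.
have ui k : mu.-integrable setT (EFin \o u k).
  have := RintegrableZl measurableT (h k)^-1 (RintegrableB measurableT (fti k) fi).
  by apply: eq_integrable => // x _; rewrite /= mulrC.
have uE k : (\int[mu]_x (u k x)%:E = 0)%E.
  rewrite -[LHS]fineK; last by apply: (integrable_fin_num _ (ui k)).
  congr EFin; transitivity (\int[mu]_x ((h k)^-1 * (f (tau k x) - f x))).
    by apply: eq_Rintegral => x _; rewrite mulrC.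
  rewrite RintegralZl//; last exact: (RintegrableB measurableT (fti k) fi).
  by rewrite (RintegralB measurableT (fti k) fi) [X in X - _](fE k) subrr mulr0.
have c1 : {ae mu, forall x, setT x -> (EFin \o u k) x @[k --> \oo] --> (EFin \o g) x}.
  by apply: filterS cvg => x ux _; apply: cvg_EFin => //; exact: nearW.
have c2 : {ae mu, forall x k, setT x -> (`|(EFin \o u k) x| <= (EFin \o G) x)%E}.
  by apply/aeW => x k _; rewrite lee_fin; exact: fG.
have mg' : measurable_fun setT (EFin \o g) by exact/measurable_EFinP.
have [gi _ ] := dominated_convergence measurableT
  (fun k => measurable_int mu (ui k)) mg' c1 Gi c2.
move=> H; split => //.
have E : (\int[mu]_x (EFin \o g) x = 0)%E.
  apply/esym/(@cvg_unique _ _ _ _ _ _ _ H) => //.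
  by rewrite (_ : (fun _ => _) = cst 0%E); [exact: cvg_cst|apply/funext => k; exact: uE].
by rewrite /Rintegral E.
Qed.

End translation_derivative.

Section lipschitz_trigo.
Context {R : realType}.
Implicit Types x y : R.

Lemma lipschitz_derive (f df : R -> R) (K : R) x y :
  (forall z, is_derive z (1:R) f (df z)) -> (forall z, `|df z| <= K) ->
  `|f x - f y| <= K * `|x - y|.
Proof.
move=> fd dK; wlog xy : x y / y <= x.
  by move=> H; have [/H//|/ltW/H] := leP y x; rewrite distrC (distrC y).
have cf : {within `[y, x], continuous f}.
  by apply: derivable_within_continuous => z _; exact: ex_derive.
have [c _ ->] := @MVT_segment R f df y x xy (fun z _ => fd z) cf.
by rewrite normrM ler_wpM2r.
Qed.

Lemma lipschitz_sin x y : `|sin x - sin y| <= `|x - y|.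
Proof. by rewrite -[leRHS]mul1r; apply: (lipschitz_derive (df := cos)) => z; exact: cos_max. Qed.

Lemma lipschitz_cos x y : `|cos x - cos y| <= `|x - y|.
Proof.
rewrite -[leRHS]mul1r; apply: (lipschitz_derive (df := fun x => - sin x)) => z.
by rewrite normrN sin_max.
Qed.

End lipschitz_trigo.

(** * Divergence identities on the unit ball *)

Section ball_divergence.
Context {R : realType} {n : nat}.
Local Notation lam := (@lebesgue_cV R n).
Local Notation B := (@closed_eball R n).
Implicit Types (v x y : 'cV[R]_n) (q : 'cV[R]_n -> R).

Lemma ball_integrable q (K : R) r : measurable_fun setT q ->
  (forall y, enorm y <= r -> `|q y| <= K) -> lam.-integrable (B r) (EFin \o q).
Proof.
move=> mq qK; apply/integrable_mkcond; first exact: measurable_closed_eball.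
have mB : measurable_fun setT (fun x => (\1_(B r) x : R)).
  by apply: measurable_indic; exact: measurable_closed_eball.
have := @bsupp_integrable R n (fun x => q x * \1_(B r) x) K r.
rewrite restrict_EFin patch_indic; apply.
  exact: measurable_funM.
move=> x; rewrite normrM (@ger0_norm _ (\1_ _ x))// indicE.
have [|] := boolP (x \in B r); rewrite ?mulr0// !mulr1 closed_eballE; exact: qK.
Qed.

Lemma Rintegral_ball q r : \int[lam]_(x in B r) q x = \int[lam]_x (q x * \1_(B r) x).
Proof. by rewrite Rintegral_mkcond patch_indic. Qed.

Lemma measurable_dotsq : measurable_fun setT (fun x : 'cV[R]_n => dot x x).
Proof.
by apply: measurable_sum => k; apply: measurable_funM; exact: measurable_entry.
Qed.

Lemma integrable_cVD c (g : 'cV[R]_n -> \bar R) :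
  lam.-integrable setT g -> lam.-integrable setT (fun x => g (x + c)).
Proof.
move=> /integrableP[mg goo]; apply/integrableP; split.
  by apply: measurableT_comp => //; exact: measurable_cVD.
have ma : measurable_fun setT (fun x => `|g x|)%E by exact: measurableT_comp.
by rewrite (integral_cVD c ma).
Qed.

(* Since (1 - |y|^2)^+ q is supported in the unit ball, its derivative along v
   has zero integral. *)
Lemma ball_divergence v q q' (K : R) :
  measurable_fun setT q -> measurable_fun setT q' ->
  (forall x, `|q x| <= K * (1 + enorm x)) ->
  (forall x t, `|q (x + t *: v) - q x| <= K * (1 + enorm x) * `|t|) ->
  (forall x, is_derive (0:R) (1:R) (fun t => q (x + t *: v)) (q' x)) ->
  \int[lam]_(x in B 1) ((1 - dot x x) * q' x - 2 * dot v x * q x) = 0.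
Proof.
move=> mq mq' qK qL qd.
pose rho x : R := Num.max (1 - dot x x) 0.
pose f x := rho x * q x.
pose h k : R := k.+1%:R^-1.
pose g x := ((1 - dot x x) * q' x - 2 * dot v x * q x) * \1_(B 1) x.
have h0 k : 0 < h k by rewrite invr_gt0.
have h1 k : h k <= 1 by rewrite invf_le1// ler1n.
have K0 : 0 <= K.
  have := le_trans (normr_ge0 _) (qK 0); rewrite enorm0 addr0 mulr1; exact.
have rho_ge0 x : 0 <= rho x by rewrite le_max lexx orbT.
have rho_le1 x : rho x <= 1 by rewrite ge_max; have := dot_ge0 x; lra.
have rho_in x : enorm x <= 1 -> rho x = 1 - dot x x.
  by move=> x1; rewrite /rho max_l// -enorm_sq; have := enorm_ge0 x; nra.
have rho_out x : 1 <= enorm x -> rho x = 0.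
  by move=> x1; rewrite /rho max_r// -enorm_sq; have := enorm_ge0 x; nra.
have mrho : measurable_fun setT rho.
  apply: measurable_maxr => //; apply: measurable_funB => //; exact: measurable_dotsq.
have mf : measurable_fun setT f by exact: measurable_funM.
have fb x : `|f x| <= (K * 2) * \1_(B 1) x.
  rewrite /f normrM ger0_norm// indicE; have [|] := boolP (x \in B 1).
    rewrite closed_eballE => x1; rewrite mulr1.
    have := ler_pM (rho_ge0 x) (normr_ge0 (q x)) (rho_le1 x) (qK x).
    rewrite mul1r => /le_trans; apply; rewrite ler_wpM2l//; lra.
  by rewrite closed_eballE -ltNge => /ltW/rho_out ->; rewrite mul0r mulr0.
have fi : lam.-integrable setT (EFin \o f) by exact: bsupp_integrable fb.
have mft c : measurable_fun setT (fun x => f (x + c)).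
  by apply: measurableT_comp => //; exact: measurable_cVD.
rewrite Rintegral_ball.
have rhoL x c : `|rho (x + c) - rho x| <= (2 * enorm x + enorm c) * enorm c.
  have E : `|dot (x + c) (x + c) - dot x x| <= (2 * enorm x + enorm c) * enorm c.
    rewrite dotDr !dotDl (dotC c x).
    have -> : dot x x + dot x c + (dot x c + dot c c) - dot x x = 2 * dot x c + dot c c by ring.
    rewrite [leRHS](_ : _ = 2 * (enorm x * enorm c) + enorm c ^+ 2); last by ring.
    rewrite (le_trans (ler_normD _ _))// enorm_sq (ger0_norm (dot_ge0 c)) lerD2r.
    by rewrite normrM ger0_norm// ler_wpM2l// dot_le_enorm.
  apply: le_trans E; rewrite /rho; set a := dot _ _; set b := dot _ _.
  by case: (leP (1 - a) 0) => ?; case: (leP (1 - b) 0) => ?; rewrite ler_norml; case: (ger0P (a - b)) => ?; apply/andP; split; lra.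
pose C := (4 + 3 * enorm v) * (enorm v) * K * (3 + 2 * enorm v) + K * (3 + enorm v).
have v0 := enorm_ge0 v.
(* As [h k <= 1], both [x] and [x + h k *: v] are outside the unit ball when
   [enorm x > 1 + enorm v]. Elsewhere the two summands of [C] bound the two terms of the product
   rule. *)
have fL k x : `|(f (x + h k *: v) - f x) / h k| <= C * \1_(B (1 + enorm v)) x.
  rewrite indicE; have [|] := boolP (x \in B (1 + enorm v)); rewrite closed_eballE; last first.
    rewrite -ltNge => xv; rewrite /f (rho_out x) ?mul0r ?rho_out ?mul0r ?subrr ?mul0r ?normr0 ?mulr0//; last lra.
    have := enormB (x + h k *: v) (h k *: v); rewrite addrK enormZ gtr0_norm//.
    have : h k * enorm v <= 1 * enorm v by rewrite ler_wpM2r.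
    lra.
  move=> xv; rewrite mulr1 normrM normfV (gtr0_norm (h0 k)) ler_pdivrMr//.
  have -> : f (x + h k *: v) - f x =
    (rho (x + h k *: v) - rho x) * q (x + h k *: v) + rho x * (q (x + h k *: v) - q x).
    by rewrite /f; ring.
  apply: le_trans (ler_normD _ _) _; rewrite !normrM (ger0_norm (rho_ge0 x)).
  have hv : enorm (h k *: v) <= enorm v by rewrite enormZ gtr0_norm// ler_piMl.
  have A1 : `|rho (x + h k *: v) - rho x| <= (4 + 3 * enorm v) * (h k * enorm v).
    apply: le_trans (rhoL _ _) _; rewrite [in leRHS](_ : h k * enorm v = enorm (h k *: v)).
      by rewrite ler_wpM2r ?enorm_ge0//; lra.
    by rewrite enormZ gtr0_norm.
  have A2 : `|q (x + h k *: v)| <= K * (3 + 2 * enorm v).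
    apply: le_trans (qK _) _; rewrite ler_wpM2l//; have := enormD x (h k *: v); lra.
  have A3 : rho x * `|q (x + h k *: v) - q x| <= K * (3 + enorm v) * h k.
    rewrite -[leRHS]mul1r; apply: ler_pM => //; apply: le_trans (qL _ _) _.
    by rewrite (gtr0_norm (h0 k)) ler_wpM2r ?(ltW (h0 k))// ler_wpM2l//; lra.
  have A12 := ler_pM (normr_ge0 _) (normr_ge0 _) A1 A2.
  apply: le_trans (lerD A12 A3) _; rewrite /C le_eqVlt; apply/orP; left; apply/eqP; ring.
have [gi gE] : lam.-integrable setT (EFin \o g) /\ \int[lam]_x g x = 0; last exact: gE.
apply: (@Rintegral_translation_derivative _ _ _ lam f g _ (fun k x => x + h k *: v) h) fL => //.
- by move=> k; rewrite gt_eqF.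
- by move=> k; exact: (integrable_cVD (h k *: v) fi).
- by move=> k; apply: Rintegral_cVD.
- apply: measurable_funM; last by apply: measurable_indic; exact: measurable_closed_eball.
  apply: measurable_funB; apply: measurable_funM => //.
    by apply: measurable_funB => //; exact: measurable_dotsq.
  by apply: measurable_funM => //; apply: measurable_dot; exact: measurable_id.
(* The positive part in [rho] has its corner on the unit sphere only; inside and outside, the
   quotient converges. *)
- exists [set x | enorm x = 1]; split; [exact: measurable_sphere|exact: lam_sphere1|].
  move=> x /= nx; apply: contrapT => x1; apply: nx.
  have hv0 : h k * enorm v @[k --> \oo] --> (0 : R).
    by rewrite -(mul0r (enorm v)); apply: cvgM; [exact: cvg_harmonic|exact: cvg_cst].
  have hE k : enorm (h k *: v) = h k * enorm v by rewrite enormZ gtr0_norm.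
  have [x1' | x1' | //] := ltgtP (enorm x) 1.
    have dq : (q (x + h k *: v) - q x) / h k @[k --> \oo] --> q' x.
      have [dq Dq] := qd x; move: dq; rewrite /derivable => dq.
      have {dq} : (fun t : R => t^-1 *: (q (x + (t *: (1:R) + 0) *: v) - q (x + (0:R) *: v))) @ 0^' --> q' x.
        by rewrite -Dq.
      move/cvgr_dnbhsP => /(_ h); have : (forall k, h k != 0) /\ h k @[k --> \oo] --> (0:R).
        by split=> [k|]; [rewrite gt_eqF|exact: cvg_harmonic].
      move=> /[swap] /[apply]; apply: cvg_trans; apply: near_eq_cvg; apply: nearW => k.
      by rewrite addr0 scale0r addr0 scaler1 -[LHS]mulrC.
    have qc : q (x + h k *: v) @[k --> \oo] --> q x.
      rewrite (_ : (fun k => _) = fun k => q x + h k * ((q (x + h k *: v) - q x) / h k)); last first.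
        by apply/funext => k; field; rewrite gt_eqF.
      rewrite -[X in _ --> X]addr0 -(mul0r (q' x)).
      by apply: cvgD; [exact: cvg_cst|apply: cvgM => //; exact: cvg_harmonic].
    (* Inside the ball the increment of [rho] is exactly -2 h (v.x) - h^2 |v|^2, which gives the
       first factor after division by h. *)
    have L : (- 2 * dot v x - h k * dot v v) * q (x + h k *: v) +
      (1 - dot x x) * ((q (x + h k *: v) - q x) / h k) @[k --> \oo] --> g x.
      rewrite /g indicE closed_eballE ltW// mulr1.
      rewrite [X in _ --> X](_ : _ = (- 2 * dot v x - 0 * dot v v) * q x + (1 - dot x x) * q' x); last by ring.
      apply: cvgD; [apply: cvgM => //|apply: cvgM => //; exact: cvg_cst].
      by apply: cvgB; [exact: cvg_cst|apply: cvgM; [exact: cvg_harmonic|exact: cvg_cst]].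
    apply: cvg_trans L; apply: near_eq_cvg; near=> k.
    have xk : enorm (x + h k *: v) <= 1.
      apply: le_trans (enormD _ _) _; rewrite hE -lerBrDl ltW//.
      by near: k; apply: (cvgr_lt _ hv0); rewrite subr_gt0.
    rewrite /f (rho_in _ xk) (rho_in _ (ltW x1')) dotDr !dotDl !dotZr !(dotC (_ *: _)) !dotZr (dotC x v).
    by field; rewrite gt_eqF.
  have -> : g x = 0 by rewrite /g indicE closed_eballE leNgt x1' mulr0.
  apply: cvg_near_cst; near=> k.
  rewrite /f (rho_out x) ?(ltW x1')// rho_out ?mul0r ?subrr ?mul0r//.
  have := enormB (x + h k *: v) (h k *: v); rewrite addrK hE.
  have : h k * enorm v < enorm x - 1.
    by near: k; apply: (cvgr_lt _ hv0); rewrite subr_gt0.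
  lra.
apply: (@bsupp_integrable _ _ _ `|C| (1 + enorm v)).
  by apply: measurable_funM => //; apply: measurable_indic; exact: measurable_closed_eball.
move=> x; rewrite normrM (@ger0_norm _ (\1_ _ x))//.
Unshelve. all: by end_near. Qed.

End ball_divergence.

Section ball_fourier.
Context {R : realType} {n : nat}.
Local Notation lam := (@lebesgue_cV R n).
Local Notation B := (@closed_eball R n).
Implicit Types (e u x y : 'cV[R]_n).

Lemma measurable_cos_dot u : measurable_fun setT (fun y : 'cV[R]_n => cos (dot u y)).
Proof.
apply: (measurableT_comp (continuous_measurable_fun (@continuous_cos R))).
by apply: measurable_dot; exact: measurable_id.
Qed.

Lemma measurable_sin_dot u : measurable_fun setT (fun y : 'cV[R]_n => sin (dot u y)).
Proof.
apply: (measurableT_comp (continuous_measurable_fun (@continuous_sin R))).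
by apply: measurable_dot; exact: measurable_id.
Qed.

Variable e : 'cV[R]_n.
Hypothesis e1 : dot e e = 1.

(* Fourier transforms, along the unit vector e, of the indicator of the unit
   ball and of 1 - |y|^2 on that ball. They solve the first order system
   bphi' = - t bpsi / 2, t bpsi' = 2 bphi - (n + 2) bpsi. *)
Definition bphi (t : R) : R := \int[lam]_(y in B 1) cos (t * dot e y).
Definition bpsi (t : R) : R := \int[lam]_(y in B 1) ((1 - dot y y) * cos (t * dot e y)).
Let bphi1 (t : R) : R := \int[lam]_(y in B 1) (- dot e y * sin (t * dot e y)).
Let bpsi1 (t : R) : R := \int[lam]_(y in B 1) ((1 - dot y y) * (- dot e y * sin (t * dot e y))).

Let mcos t : measurable_fun setT (fun y : 'cV[R]_n => cos (t * dot e y)).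
Proof. by under eq_fun do rewrite -dotZl; exact: measurable_cos_dot. Qed.

Let msin t : measurable_fun setT (fun y : 'cV[R]_n => sin (t * dot e y)).
Proof. by under eq_fun do rewrite -dotZl; exact: measurable_sin_dot. Qed.

Let mdot u : measurable_fun setT (fun y : 'cV[R]_n => dot u y).
Proof. by apply: measurable_dot; exact: measurable_id. Qed.

Let m1sq : measurable_fun setT (fun y : 'cV[R]_n => 1 - dot y y).
Proof. by apply: measurable_funB => //; exact: measurable_dotsq. Qed.

Let enorm_e : enorm e = 1.
Proof.
apply/eqP; rewrite -(@eqrXn2 _ 2) ?enorm_ge0// enorm_sq e1 expr1n//.
Qed.

Let dot_e_le1 y : enorm y <= 1 -> `|dot e y| <= 1.
Proof. by move=> y1; rewrite (le_trans (dot_le_enorm _ _))// enorm_e mul1r. Qed.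

Let sq_le1 y : enorm y <= 1 -> 0 <= 1 - dot y y <= 1.
Proof. by move=> y1; rewrite -enorm_sq; have := enorm_ge0 y; nra. Qed.

Let ballI (f : 'cV[R]_n -> R) : measurable_fun setT f ->
  (forall y, enorm y <= 1 -> `|f y| <= 1) -> lam.-integrable (B 1) (EFin \o f).
Proof. exact: ball_integrable. Qed.

Let norm_le1M (a b : R) : `|a| <= 1 -> `|b| <= 1 -> `|a * b| <= 1.
Proof. by move=> a1 b1; rewrite normrM mulr_ile1. Qed.

Let sq_norm y : enorm y <= 1 -> `|1 - dot y y| <= 1.
Proof. by move=> /sq_le1 /andP[h1 h2]; rewrite ger0_norm. Qed.

Let vol_bound (f : 'cV[R]_n -> R) : measurable_fun setT f ->
  (forall y, enorm y <= 1 -> `|f y| <= 1) -> `|\int[lam]_(y in B 1) f y| <= @vol R n 1.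
Proof.
move=> mf f1; have fi := ballI mf f1.
have mB := @measurable_closed_eball R n 1.
apply: le_trans (le_normr_Rintegral mB fi) _.
have ci : lam.-integrable (B 1) (EFin \o (fun=> 1 : R)).
  by apply: ballI => // y _; rewrite normr1.
apply: (@le_trans _ _ (\int[lam]_(y in B 1) 1)).
  apply: le_Rintegral => //; first exact: (integrable_norm fi).
by rewrite Rintegral_cst// mul1r.
Qed.

Lemma bphi_le t : `|bphi t| <= @vol R n 1.
Proof. by apply: vol_bound => // y _; exact: cos_max. Qed.

Lemma bpsi_le t : `|bpsi t| <= @vol R n 1.
Proof.
apply: vol_bound => [|y y1]; first exact: measurable_funM.
by apply: norm_le1M (cos_max _); exact: sq_norm.
Qed.

Let d_cos (c t : R) : is_derive t (1:R) (fun t => cos (t * c)) (- c * sin (t * c)).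
Proof. by apply: is_derive_eq; rewrite /GRing.scale/=; ring. Qed.

(** Differentiation under the integral sign: on the unit ball |e.y| <= 1, so the constant 1
    dominates the derivative. *)
Let is_derive_under (w : 'cV[R]_n -> R) (t : R) : measurable_fun setT w ->
  (forall y, enorm y <= 1 -> `|w y| <= 1) ->
  is_derive t (1:R) (fun t => \int[lam]_(y in B 1) (w y * cos (t * dot e y)))
    (\int[lam]_(y in B 1) (w y * (- dot e y * sin (t * dot e y)))).
Proof.
move=> mw w1.
pose f (t : R) y := w y * cos (t * dot e y).
have dd s y : is_derive s (1:R) (f ^~ y) (w y * (- dot e y * sin (s * dot e y))).
  by have := d_cos (dot e y) s => H; apply: is_derive_eq; rewrite /GRing.scale/=; ring.
have E s y : partial1of2 f s y = w y * (- dot e y * sin (s * dot e y)).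
  by rewrite partial1of2E (@derive_val _ _ _ _ _ _ _ (dd s y)).
have It : `]t - 1, t + 1[%classic t by rewrite /= in_itv/=; apply/andP; split; lra.
have fint s : `]t - 1, t + 1[%classic s -> lam.-integrable (B 1) (EFin \o f s).
  move=> _; apply: ballI; first exact: measurable_funM.
  by move=> y y1; apply: norm_le1M (cos_max _); exact: w1.
have fder s y : `]t - 1, t + 1[%classic s -> B 1 y -> derivable (f ^~ y) s 1.
  by move=> _ _; exact: ex_derive.
have Gi : lam.-integrable (B 1) (EFin \o (fun=> 1 : R)).
  by apply: ballI => // y _; rewrite normr1.
have Gub s y : `]t - 1, t + 1[%classic s -> B 1 y -> `|partial1of2 f s y| <= 1.
  move=> _ /closed_eballP y1; rewrite E; apply: norm_le1M; first exact: w1.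
  by apply: norm_le1M (sin_max _); rewrite normrN; exact: dot_e_le1.
have mB := @measurable_closed_eball R n 1.
apply: DeriveDef.
  exact: (derivable_under_integral mB It fint fder (fun=> ler01) Gi Gub).
rewrite -derive1E (differentiation_under_integral mB It fint fder (fun=> ler01) Gi Gub).
by apply: eq_Rintegral => y _; rewrite E.
Qed.

Let is_derive_bphi1 t : is_derive t (1:R) bphi (bphi1 t).
Proof.
have := @is_derive_under (fun=> 1) t (measurable_cst _).
have -> : (fun t => \int[lam]_(y in B 1) (1 * cos (t * dot e y))) = bphi.
  by apply/funext => s; apply: eq_Rintegral => y _; rewrite mul1r.
have -> : \int[lam]_(y in B 1) (1 * (- dot e y * sin (t * dot e y))) = bphi1 t.
  by apply: eq_Rintegral => y _; rewrite mul1r.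
by apply => y _; rewrite normr1.
Qed.

Let is_derive_bpsi1 t : is_derive t (1:R) bpsi (bpsi1 t).
Proof. exact: is_derive_under. Qed.

Let integrable_dsin t : lam.-integrable (B 1) (EFin \o (fun y => - dot e y * sin (t * dot e y))).
Proof.
apply: ballI; first by apply: measurable_funM => //; apply: measurable_funN.
by move=> y y1; apply: norm_le1M (sin_max _); rewrite normrN; exact: dot_e_le1.
Qed.

Let integrable_psi t : lam.-integrable (B 1) (EFin \o (fun y => (1 - dot y y) * cos (t * dot e y))).
Proof.
apply: ballI; first exact: measurable_funM.
by move=> y y1; apply: norm_le1M (cos_max _); exact: sq_norm.
Qed.

Let integrable_psi1 t : lam.-integrable (B 1)
  (EFin \o (fun y => (1 - dot y y) * (- dot e y * sin (t * dot e y)))).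
Proof.
apply: ballI.
  by apply: measurable_funM => //; apply: measurable_funM => //; apply: measurable_funN.
move=> y y1; apply: norm_le1M; first exact: sq_norm.
by apply: norm_le1M (sin_max _); rewrite normrN; exact: dot_e_le1.
Qed.

Let integrable_phi t : lam.-integrable (B 1) (EFin \o (fun y => cos (t * dot e y))).
Proof. by apply: ballI => // y _; exact: cos_max. Qed.

(** [ball_divergence] along [e] with q = sin(t e.y) reads t [bpsi] + 2 [bphi]' = 0. *)
Lemma bphi_ode t : is_derive t (1:R) bphi (- (t / 2) * bpsi t).
Proof.
suff -> : - (t / 2) * bpsi t = bphi1 t by exact: is_derive_bphi1.
have mB := @measurable_closed_eball R n 1.
have t0 := normr_ge0 t.
have : \int[lam]_(x in B 1) ((1 - dot x x) * (t * cos (t * dot e x)) -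
    2 * dot e x * sin (t * dot e x)) = 0.
apply: (@ball_divergence R n e (fun y => sin (t * dot e y))
  (fun y => t * cos (t * dot e y)) (1 + `|t|)) => //.
- exact: measurable_funM.
- move=> x; apply: le_trans (sin_max _) _; have := enorm_ge0 x; nra.
- move=> x s; apply: le_trans (lipschitz_sin _ _) _.
  rewrite dotDr dotZr e1 mulr1 mulrDr [_ + t * s]addrC addrK normrM ler_wpM2r//.
  have := enorm_ge0 x; nra.
- move=> x.
  have H : is_derive (0:R) (1:R) (fun s : R => t * (dot e x + s)) t.
    by apply: is_derive_eq; rewrite /GRing.scale/=; ring.
  rewrite (_ : (fun s : R => _) = sin \o (fun s : R => t * (dot e x + s))); last first.
    by apply/funext => s /=; rewrite dotDr dotZr e1 mulr1.
  by apply: is_derive_eq; rewrite /GRing.scale/= addr0; ring.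
rewrite (_ : \int[lam]_(x in B 1) _ = t * bpsi t + 2 * bphi1 t); first lra.
rewrite -RintegralZl// -RintegralZl// -RintegralD//; last 2 first.
- exact: RintegrableZl.
- exact: RintegrableZl.
by apply: eq_Rintegral => x _; ring.
Qed.

(** Divergence identity for the radial field y cos(t e.y): [ball_divergence] is applied along each
    coordinate j to y_j cos(t e.y), and the n identities are added. *)
Lemma bpsi_ode t : t != 0 ->
  is_derive t (1:R) bpsi ((2 * bphi t - n.+2%:R * bpsi t) / t).
Proof.
move=> t0.
suff -> : (2 * bphi t - n.+2%:R * bpsi t) / t = bpsi1 t by exact: is_derive_bpsi1.
have mB := @measurable_closed_eball R n 1.
pose F (j : 'I_n) y : R := (1 - dot y y) * (cos (t * dot e y) - t * (y j ord0 * e j ord0) * sin (t * dot e y))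
  - 2 * y j ord0 * (y j ord0 * cos (t * dot e y)).
have my j : measurable_fun setT (fun y : 'cV[R]_n => y j ord0) by exact: measurable_entry.
have dotd (j : 'I_n) y : dot (delta_mx j ord0) y = y j ord0.
  rewrite /dot (bigD1 j)//= mxE !eqxx mul1r big1 ?addr0// => k kj.
  by rewrite mxE (negbTE kj) mul0r.
have ne : forall j, `|e j ord0| <= 1.
  by move=> j; rewrite -enorm_e entry_le_enorm.
have FE j : \int[lam]_(y in B 1) F j y = 0.
  have t1 := normr_ge0 t.
  transitivity (\int[lam]_(x in B 1) ((1 - dot x x) *
      (cos (t * dot e x) - t * (x j ord0 * e j ord0) * sin (t * dot e x)) -
      2 * dot (delta_mx j ord0) x * (x j ord0 * cos (t * dot e x)))).
    by apply: eq_Rintegral => x _; rewrite dotd.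
  apply: (@ball_divergence R n (delta_mx j ord0) (fun y => y j ord0 * cos (t * dot e y))
    (fun y => cos (t * dot e y) - t * (y j ord0 * e j ord0) * sin (t * dot e y)) (2 + `|t|)) => //.
  - exact: measurable_funM.
  - apply: measurable_funB => //; apply: measurable_funM => //; apply: measurable_funM => //.
    exact: measurable_funM.
  - move=> x; rewrite normrM.
    have := ler_pM (normr_ge0 _) (normr_ge0 _) (entry_le_enorm x j) (cos_max (t * dot e x)).
    by have := enorm_ge0 x; nra.
  - move=> x s.
    have -> : (x + s *: delta_mx j ord0) j ord0 = x j ord0 + s by rewrite !mxE !eqxx mulr1.
    have -> : (x j ord0 + s) * cos (t * dot e (x + s *: delta_mx j ord0)) - x j ord0 * cos (t * dot e x) =
      x j ord0 * (cos (t * dot e (x + s *: delta_mx j ord0)) - cos (t * dot e x)) +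
      s * cos (t * dot e (x + s *: delta_mx j ord0)) by ring.
    apply: le_trans (ler_normD _ _) _; rewrite !normrM.
    have H1 : `|cos (t * dot e (x + s *: delta_mx j ord0)) - cos (t * dot e x)| <= `|t| * `|s|.
      apply: le_trans (lipschitz_cos _ _) _.
      rewrite dotDr dotZr [dot e (delta_mx _ _)]dotC dotd mulrDr [_ + t * (s * _)]addrC addrK !normrM.
      by rewrite ler_wpM2l// ler_piMr.
    have H2 := ler_pM (normr_ge0 _) (normr_ge0 _) (entry_le_enorm x j) H1.
    have H3 : `|s| * `|cos (t * dot e (x + s *: delta_mx j ord0))| <= `|s| * 1.
      by rewrite ler_wpM2l// cos_max.
    apply: le_trans (lerD H2 H3) _; rewrite -subr_ge0.
    rewrite [X in 0 <= X](_ : _ = `|s| * (1 + `|t| + 2 * enorm x)); last by ring.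
    by apply: mulr_ge0 => //; have := enorm_ge0 x; lra.
  - move=> x.
    have H : is_derive (0:R) (1:R) (fun s : R => t * (dot e x + s * e j ord0)) (t * e j ord0).
      by apply: is_derive_eq; rewrite /GRing.scale/=; ring.
    have H2 : is_derive (0:R) (1:R) (fun s : R => x j ord0 + s * 1) 1.
      by apply: is_derive_eq; rewrite /GRing.scale/=; ring.
    rewrite (_ : (fun s : R => _) = (fun s : R => (x j ord0 + s * 1) * cos (t * (dot e x + s * e j ord0)))); last first.
      by apply/funext => s /=; rewrite dotDr dotZr [dot e (delta_mx _ _)]dotC dotd !mxE !eqxx mulr1.
    by apply: is_derive_eq; rewrite /GRing.scale/= !mul0r !addr0; ring.
have Fi j : lam.-integrable (B 1) (EFin \o F j).
  apply: (@ball_integrable R n _ (1 + `|t| + 2)).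
    apply: measurable_funB; apply: measurable_funM => //.
    - by apply: measurable_funB => //; apply: measurable_funM => //; apply: measurable_funM => //; apply: measurable_funM.
    - by apply: measurable_funM.
    - by apply: measurable_funM.
  move=> y y1.
  have yj : `|y j ord0| <= 1 by exact: le_trans (entry_le_enorm _ _) y1.
  have a1 := norm_le1M (sq_norm y1) (cos_max (t * dot e y)).
  have a2 := norm_le1M (sq_norm y1) (norm_le1M (norm_le1M yj (ne j)) (sin_max (t * dot e y))).
  have a3 := norm_le1M yj (norm_le1M yj (cos_max (t * dot e y))).
  have -> : F j y = (1 - dot y y) * cos (t * dot e y) -
     t * ((1 - dot y y) * (y j ord0 * e j ord0 * sin (t * dot e y))) - 2 * (y j ord0 * (y j ord0 * cos (t * dot e y))).
    by rewrite /F; ring.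
  apply: le_trans (ler_normB _ _) _; apply: lerD; last by rewrite normrM ger0_norm// ler_piMr.
  by apply: le_trans (ler_normB _ _) _; apply: lerD => //; rewrite normrM ler_piMr.
have S0 : \int[lam]_(y in B 1) (\sum_j F j y) = 0.
  rewrite /Rintegral; under eq_integral do rewrite -sumEFin.
  rewrite integral_sum//= big1// => j _.
  by rewrite -[LHS]fineK ?(integrable_fin_num _ (Fi j))//; congr EFin; exact: FE.
(* Writing |y|^2 = 1 - (1 - |y|^2) in the summed identity produces 2 [bphi] and raises the
   coefficient of [bpsi] from n to n + 2. *)
have E : n.+2%:R * bpsi t + t * bpsi1 t = 2 * bphi t.
  apply/eqP; rewrite -subr_eq0; apply/eqP; rewrite -S0.
  rewrite -!RintegralZl// -RintegralD//; [|exact: RintegrableZl..].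
  rewrite -RintegralB//; [|apply: RintegrableD => //; exact: RintegrableZl|exact: RintegrableZl].
  apply: eq_Rintegral => y _; rewrite /F big_split/= sumrN -mulr_sumr.
  have -> : \sum_(j < n) (cos (t * dot e y) - t * (y j ord0 * e j ord0) * sin (t * dot e y)) =
     n%:R * cos (t * dot e y) - t * dot e y * sin (t * dot e y).
    rewrite big_split/= sumrN sumr_const card_ord mulr_natl; congr (_ - _).
    move: (sin _) => c; rewrite /dot mulr_sumr mulr_suml; apply: eq_bigr => j _; ring.
  have -> : \sum_(j < n) 2 * y j ord0 * (y j ord0 * cos (t * dot e y)) = 2 * dot y y * cos (t * dot e y).
    move: (cos _) => c; rewrite /dot mulr_sumr mulr_suml; apply: eq_bigr => j _; ring.
  rewrite -[n.+2]addn2 natrD; ring.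
by rewrite -E; field.
Qed.

End ball_fourier.

(** * Decay of the transform of the ball by an energy estimate *)

Section ball_fourier_decay.
Context {R : realType} {n : nat}.
Local Notation lam := (@lebesgue_cV R n).
Local Notation B := (@closed_eball R n).
Implicit Types (e u : 'cV[R]_n).

(** The system for ([bphi], [bpsi]) is a damped oscillation: the energy Q is free of cross terms in
    its derivative but is dissipated by [bpsi] only. Correcting it by a multiple of the product
    [bphi] [bpsi] spreads the damping over both components. *)
Lemma bphi_decay e (t : R) : dot e e = 1 -> 2 * n.+1%:R <= t ->
  bphi e t ^+ 2 <= 4 * (2 * n.+1%:R) ^+ n.+1 * (1 + n.+1%:R ^+ 2 + n.+1%:R) * @vol R n 1 ^+ 2 / t ^+ n.+1.
Proof.
move=> e1 t0.
(* Along the system, (x^(n+1) Q)' = (n+1) x^n (p^2 - x^2 s^2 / 4) and (x^(n+1) p s)' = 2 x^n (p^2 -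
   x^2 s^2 / 4) - x^n p s. Subtracting (n+1)/2 times the second removes the oscillating
   difference. *)
pose al : R := n.+1%:R / 2.
have al0 : 0 < al by rewrite divr_gt0.
(* Beyond x0 = 4 al one has E' <= 2 al E / x^2 and 1 + x0 / x <= 2, so the gain 4 al E / x^2 in G'
   is exactly offset by the loss x0 E / x^2. *)
pose x0 : R := 2 * n.+1%:R.
have x0E : x0 = 4 * al by rewrite /x0 /al; field.
have x00 : 0 < x0 by rewrite x0E mulr_gt0.
pose p := bphi e; pose s := bpsi e.
pose Q x : R := p x ^+ 2 + x ^+ 2 * s x ^+ 2 / 4.
(* Q decays like x^-(n+1) up to the cross term of E, chosen such that
   E' = al x^n p s is one order smaller than E / x; hence G decreases. *)
pose E x : R := x ^+ n.+1 * (Q x - al * (p x * s x)).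
pose G x : R := E x * (1 + x0 * x^-1).
pose dG x : R := al * x ^+ n * (p x * s x) * (1 + x0 / x) - E x * x0 / x ^+ 2.
have dp x : is_derive x (1:R) p (- (x / 2) * s x) by exact: bphi_ode.
have GD x : x != 0 -> is_derive x (1:R) G (dG x).
  move=> xn0.
  have ds : is_derive x (1:R) s ((2 * p x - n.+2%:R * s x) / x) by exact: bpsi_ode.
  have di : is_derive x (1:R) (fun y : R => y^-1) (- x ^- 2).
    apply: DeriveDef; first exact: (derivableV xn0 (@derivable_id _ _ _ _)).
    by rewrite (deriveV xn0 (@derivable_id _ _ _ _)) derive_id /GRing.scale/= mulr1.
  have dX : is_derive x (1:R) (fun y : R => y ^+ n.+1) (n.+1%:R * x ^+ n).
    apply: DeriveDef; first exact: exprn_derivable.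
    by rewrite exp_derive /GRing.scale/= mulr1.
  rewrite /G /E /Q.
  apply: is_derive_eq; rewrite /GRing.scale/= /dG /E /Q.
  have -> : n.+2%:R = 2 * al + 1 :> R by rewrite /al -[n.+2]addn1 natrD; field.
  have -> : n.+1%:R = 2 * al :> R by rewrite /al; field.
  rewrite exprS.
  by field.
have Q0 x : 0 <= Q x.
  by rewrite addr_ge0 ?sqr_ge0// mulr_ge0// mulr_ge0 ?sqr_ge0.
have psQ x : 0 < x -> `|p x * s x| <= Q x / x.
  move=> xp; rewrite ler_pdivlMr// -[X in _ * X](gtr0_norm xp) -normrM /Q.
  rewrite ler_norml; apply/andP; split.
    have := sqr_ge0 (p x + x * s x / 2); nra.
  have := sqr_ge0 (p x - x * s x / 2); nra.
have EQ x : x0 <= x -> x ^+ n.+1 * Q x / 2 <= E x.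
  move=> xx0; have xp : 0 < x by exact: lt_le_trans xx0.
  rewrite /E -mulrA ler_wpM2l ?exprn_ge0 ?(ltW xp)//.
  suff : al * (p x * s x) <= Q x / 2 by lra.
  apply: (@le_trans _ _ (al * (Q x / x))).
    by rewrite ler_wpM2l ?(ltW al0)// (le_trans (ler_norm _))// psQ.
  rewrite [leLHS](_ : _ = Q x * (al / x)); last by ring.
  by rewrite ler_wpM2l// ler_pdivrMr//; lra.
have E0 x : x0 <= x -> 0 <= E x.
  move=> xx0; have xp : 0 < x by exact: lt_le_trans xx0.
  by apply: le_trans (EQ _ xx0); rewrite divr_ge0// mulr_ge0 ?exprn_ge0 ?(ltW xp).
have dG0 x : x0 <= x -> dG x <= 0.
  move=> xx0; have xp : 0 < x by exact: lt_le_trans xx0.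
  have H1 : al * x ^+ n * (p x * s x) <= 2 * al * E x / x ^+ 2.
    apply: (@le_trans _ _ (al * x ^+ n * (Q x / x))).
      rewrite ler_wpM2l ?mulr_ge0 ?exprn_ge0 ?(ltW xp) ?(ltW al0)//.
      by rewrite (le_trans (ler_norm _))// psQ.
    rewrite ler_pdivlMr ?exprn_gt0//.
    have -> : al * x ^+ n * (Q x / x) * x ^+ 2 = 2 * al * (x ^+ n.+1 * Q x / 2).
      by rewrite [x ^+ n.+1]exprS; field; rewrite gt_eqF.
    by rewrite ler_wpM2l ?mulr_ge0 ?(ltW al0)// EQ.
  have r1 : x0 / x <= 1 by rewrite ler_pdivrMr// mul1r.
  have r0 : 0 <= x0 / x by rewrite divr_ge0// ltW.
  have H2 : al * x ^+ n * (p x * s x) * (1 + x0 / x) <= 2 * al * E x / x ^+ 2 * 2.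
    apply: (@le_trans _ _ (2 * al * E x / x ^+ 2 * (1 + x0 / x))).
      by rewrite ler_wpM2r//; lra.
    rewrite ler_wpM2l//; last lra.
    by apply: divr_ge0 (sqr_ge0 _); apply: mulr_ge0 (E0 _ xx0); lra.
  rewrite /dG subr_le0; apply: le_trans H2 _; rewrite x0E le_eqVlt; apply/orP; left; apply/eqP.
  by field; rewrite gt_eqF.
have Gmono : G t <= G x0.
  have cG : {within `[x0, t], continuous G}.
    apply: derivable_within_continuous => z; rewrite in_itv/= => /andP[z0 _].
    have zp : 0 < z by exact: lt_le_trans z0.
    exact: (@ex_derive _ _ _ _ _ _ _ (GD z (lt0r_neq0 zp))).
  have [|c] := @MVT_segment R G dG x0 t t0 _ cG.
    move=> z; rewrite in_itv/= => /andP[z0 _].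
    by apply: GD; rewrite gt_eqF// (lt_trans x00).
  rewrite in_itv/= => /andP[c0 _] GE; rewrite -subr_le0 GE.
  by rewrite mulr_le0_ge0 ?dG0// subr_ge0.
have tp : 0 < t by exact: lt_le_trans t0.
have G0E : G x0 = 2 * E x0 by rewrite /G divff ?gt_eqF// mulrC.
have EG : E t <= G t.
  rewrite /G ler_peMr ?E0// lerDl mulr_ge0 ?invr_ge0 ?(ltW tp) ?(ltW x00)//.
have pl x : `|p x| <= @vol R n 1 by exact: bphi_le.
have sl x : `|s x| <= @vol R n 1 by exact: bpsi_le.
have v0 := @vol_ge0 R n 1.
have p2 x : p x ^+ 2 <= @vol R n 1 ^+ 2.
  by rewrite -[p x ^+ 2]real_normK ?num_real//; apply: lerXn2r; rewrite ?nnegrE.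
have s2 x : s x ^+ 2 <= @vol R n 1 ^+ 2.
  by rewrite -[s x ^+ 2]real_normK ?num_real//; apply: lerXn2r; rewrite ?nnegrE.
have Ex0 : E x0 <= x0 ^+ n.+1 * ((1 + n.+1%:R ^+ 2 + n.+1%:R) * @vol R n 1 ^+ 2).
  rewrite /E ler_wpM2l ?exprn_ge0 ?(ltW x00)//.
  have H1 : Q x0 <= (1 + n.+1%:R ^+ 2) * @vol R n 1 ^+ 2.
    rewrite /Q mulrDl mul1r lerD//.
    rewrite /x0 (_ : _ / 4 = n.+1%:R ^+ 2 * s (2 * n.+1%:R) ^+ 2); last by field.
    by rewrite ler_wpM2l// sqr_ge0.
  have H2 : - (al * (p x0 * s x0)) <= n.+1%:R * @vol R n 1 ^+ 2.
    rewrite (le_trans (ler_norm _))// normrN normrM (gtr0_norm al0).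
    apply: ler_pM => //; first exact: ltW.
      by rewrite /al ler_pdivrMr// ler_peMr// ler1n.
    by rewrite normrM expr2 ler_pM.
  lra.
(* The constant 4: t^(n+1) p(t)^2 <= t^(n+1) Q(t) <= 2 E(t) <= 2 G(t) <= 2 G(x0) = 4 E(x0). *)
have H := EQ _ t0.
have pQ : p t ^+ 2 <= Q t by rewrite /Q lerDl mulr_ge0// mulr_ge0 ?sqr_ge0.
rewrite ler_pdivlMr ?exprn_gt0// -/x0.
have tn : 0 < t ^+ n.+1 by rewrite exprn_gt0.
have H3 : t ^+ n.+1 * p t ^+ 2 <= t ^+ n.+1 * Q t by rewrite ler_wpM2l ?(ltW tn).
rewrite -/p mulrC; lra.
Qed.

(** Dilation to the unit ball and rotation-free reduction to one variable: the transform of the ball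
    of radius r at u is r^n [bphi] (r |u|) along e = u / |u|. *)
Lemma ball_fourier_decay : exists C : R, 0 <= C /\ forall r u, 0 < r ->
  2 * n.+1%:R <= r * enorm u ->
  (\int[lam]_(y in B r) cos (dot u y)) ^+ 2 <= C * r ^+ (2 * n) / (r * enorm u) ^+ n.+1.
Proof.
exists (4 * (2 * n.+1%:R) ^+ n.+1 * (1 + n.+1%:R ^+ 2 + n.+1%:R) * @vol R n 1 ^+ 2); split.
  apply: mulr_ge0 (sqr_ge0 _); apply: mulr_ge0; last by rewrite !addr_ge0// sqr_ge0.
  by rewrite mulr_ge0// exprn_ge0// mulr_ge0.
move=> r u r0 ru.
have u0 : 0 < enorm u.
  by rewrite -(pmulr_rgt0 _ r0); apply: lt_le_trans ru; rewrite mulr_gt0.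
pose e := (enorm u)^-1 *: u.
have e1 : dot e e = 1.
  by rewrite /e dotZr dotZl -enorm_sq; field; rewrite gt_eqF.
have uE : u = enorm u *: e by rewrite scalerA divff ?gt_eqF// scale1r.
have mB := @measurable_closed_eball R n r.
have -> : \int[lam]_(y in B r) cos (dot u y) = r ^+ n * bphi e (r * enorm u).
  rewrite Rintegral_ball /bphi Rintegral_ball.
  have fi : lam.-integrable setT (EFin \o (fun y => cos (dot u y) * \1_(B r) y)).
    apply: (@bsupp_integrable R n _ 1 r).
      by apply: measurable_funM; [exact: measurable_cos_dot|apply: measurable_indic].
    by move=> x; rewrite mul1r normrM (@ger0_norm _ (\1_ _ x))// ler_piMl// cos_max.
  have := Rintegral_cVZ (lt0r_neq0 r0) fi; rewrite (gtr0_norm r0) => H.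
  have -> : \int[lam]_x (cos (dot u x) * \1_(B r) x) = r ^+ n * \int[lam]_x (cos (dot u (r *: x)) * \1_(B r) (r *: x)).
    by rewrite H mulrA divff ?mul1r// expf_neq0// gt_eqF.
  congr (_ * _); apply: eq_Rintegral => x _; congr (_ * _).
    by rewrite dotZr [in LHS]uE dotZl mulrA.
  rewrite !indicE; congr (_%:R); congr nat_of_bool.
  by rewrite !closed_eballE enormZ gtr0_norm// -ler_pdivlMl// mulVf// gt_eqF.
rewrite exprMn -exprM mulnC [leLHS]mulrC [leRHS]mulrAC ler_wpM2r ?exprn_ge0 ?(ltW r0)//.
exact: bphi_decay.
Qed.

End ball_fourier_decay.

(** * Lattices and Fejer kernels *)

Section countable_esum.
Context {R : realType} {I : countType}.

(** A sum over a countable type is enumerated as a series, with 0 at the integers that encode no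
    element; Tonelli for series then applies to [\esum]. *)
Let g (f : I -> \bar R) (n : nat) : \bar R := if pickle_inv n is Some i then f i else 0%E.

Lemma esum_countE (f : I -> \bar R) : (forall i, 0 <= f i)%E ->
  (\esum_(i in [set: I]) f i = \sum_(n <oo) g f n)%E.
Proof.
move=> f0; have g0 n : (0 <= g f n)%E by rewrite /g; case: pickle_inv.
rewrite nneseries_esumT//.
have := @esum_image R _ _ [set: I] pickle (g f).
have pI : set_inj [set: I] pickle by move=> x y _ _ /(pcan_inj pickleK).
move=> /(_ pI) H; rewrite (eq_esum (b := fun i => g f (pickle i))); last first.
  by move=> i _; rewrite /g pickleK_inv.
rewrite -H esum_mkcond; apply: eq_esum => n _; case: ifPn => // /negP nn.
rewrite /g; case E : (pickle_inv n) => [i|//]; exfalso; apply: nn; rewrite inE.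
exists i => //; have := @pickle_invK I n; rewrite E/=; by [].
Qed.

Context d (T : measurableType d) (mu : {measure set T -> \bar R}) (D : set T).
Hypothesis mD : measurable D.
Variable f : I -> T -> \bar R.
Hypothesis mf : forall i, measurable_fun D (f i).
Hypothesis f0 : forall i x, (0 <= f i x)%E.

Let mg n : measurable_fun D (fun x => g (f ^~ x) n).
Proof. by rewrite /g; case: pickle_inv. Qed.

Let g0 n x : (0 <= g (f ^~ x) n)%E.
Proof. by rewrite /g; case: pickle_inv. Qed.

Lemma measurable_esum_count : measurable_fun D (fun x => \esum_(i in [set: I]) f i x)%E.
Proof.
under eq_fun do rewrite esum_countE//.
exact: (ge0_emeasurable_sum (P := xpredT)).
Qed.

Lemma integral_esum_count :
  (\int[mu]_(x in D) (\esum_(i in [set: I]) f i x) =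
   \esum_(i in [set: I]) (\int[mu]_(x in D) f i x))%E.
Proof.
rewrite [RHS]esum_countE; last by move=> i; exact: integral_ge0.
under eq_integral do rewrite esum_countE//.
rewrite integral_nneseries//.
apply: eq_eseriesr => n _; rewrite /g; case: pickle_inv => //.
exact: integral0.
Qed.

End countable_esum.

Section lattice_tiling.
Context {R : realType} {d : nat}.
Variable a : d.-tuple 'cV[R]_d.
Hypothesis ba : basis_of fullv a.
Local Notation lam := (@lebesgue_cV R d).
Local Notation Z := {ffun 'I_d -> int}.
Local Notation D := (fundamental_domain a).
Implicit Types (z k : Z) (x y s : 'cV[R]_d).

Definition lpoint z : 'cV[R]_d := \sum_j (z j)%:~R *: tnth a j.
(** The dual basis. Coordinates in the basis [a] become scalar products, which makes them measurable
    and lets [freq] combine them into frequencies. *)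
Definition dual_vec (j : 'I_d) : 'cV[R]_d := \col_k coord a j (delta_mx k ord0).
Definition tcoord j x : R := dot (dual_vec j) x.

Lemma cV_delta x : x = \sum_k x k ord0 *: delta_mx k ord0.
Proof.
rewrite {1}[x]matrix_sum_delta; apply: eq_bigr => k _.
by rewrite big_ord1.
Qed.

Lemma tcoordE j x : tcoord j x = coord a j x.
Proof.
rewrite /tcoord /dot {2}[x]cV_delta linear_sum; apply: eq_bigr => k _.
by rewrite linearZ mxE mulrC.
Qed.

Lemma tcoord_sum x : x = \sum_j tcoord j x *: tnth a j.
Proof.
rewrite {1}(coord_basis ba (memvf x)); apply: eq_bigr => j _.
by rewrite tcoordE (tnth_nth 0).
Qed.

Lemma tcoordK (t : 'I_d -> R) j : tcoord j (\sum_i t i *: tnth a i) = t j.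
Proof.
rewrite tcoordE (_ : \sum_i _ = \sum_(i < d) t i *: a`_i); last first.
  by apply: eq_bigr => i _; rewrite (tnth_nth 0).
by rewrite coord_sum_free// (basis_free ba).
Qed.

Lemma tcoord_lpoint z j : tcoord j (lpoint z) = (z j)%:~R.
Proof. exact: tcoordK. Qed.

Lemma tcoordD j x y : tcoord j (x + y) = tcoord j x + tcoord j y.
Proof. exact: dotDr. Qed.

Lemma tcoordN j x : tcoord j (- x) = - tcoord j x.
Proof. exact: dotNr. Qed.

Lemma lpointD z w : lpoint (z + w) = lpoint z + lpoint w.
Proof.
rewrite /lpoint -big_split; apply: eq_bigr => j _/=.
by rewrite ffunE intrD scalerDl.
Qed.

Lemma lpointN z : lpoint (- z) = - lpoint z.
Proof.
rewrite /lpoint -sumrN; apply: eq_bigr => j _/=.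
by rewrite ffunE mulrNz scaleNr.
Qed.

Lemma lpoint0 : lpoint 0 = 0.
Proof. by rewrite /lpoint big1// => j _; rewrite ffunE scale0r. Qed.

Lemma lpoint_inj : injective lpoint.
Proof.
move=> z w zw; apply/ffunP => j; apply: (@intr_inj R).
by rewrite -!tcoord_lpoint zw.
Qed.

Lemma lattice_bij : set_bij [set: Z] (lattice a) lpoint.
Proof.
split.
- by move=> z _; exists (fun j => z j).
- by move=> z w _ _; exact: lpoint_inj.
- move=> x [z _ <-]; exists [ffun j => z j] => //.
  by apply: eq_bigr => j _; rewrite ffunE.
Qed.

Lemma lattice_lpoint z : lattice a (lpoint z).
Proof. by have [H _ _] := lattice_bij; exact: H. Qed.

Lemma esum_lattice (f : 'cV[R]_d -> \bar R) :
  (\esum_(i in lattice a) f i = \esum_(z in [set: Z]) f (lpoint z))%E.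
Proof. exact: reindex_esum lattice_bij. Qed.

Lemma fdomainP x : D x <-> forall j, 0 <= tcoord j x < 1.
Proof.
split=> [[t t01 <-] j|H]; first by rewrite tcoordK; exact: t01.
by exists (tcoord ^~ x) => //; rewrite -tcoord_sum.
Qed.

Lemma measurable_tcoord j : measurable_fun setT (tcoord j).
Proof. by apply: measurable_dot; exact: measurable_id. Qed.

Lemma measurable_fdomain : measurable D.
Proof.
rewrite (_ : D = \bigcap_(j in [set: 'I_d]) (tcoord j @^-1` `[0, 1[)).
  apply: fin_bigcap_measurable => [|j _]; first exact: finite_finset.
  by have := measurable_tcoord j measurableT (measurable_itv `[0, 1[); rewrite setTI.
apply/seteqP; split => x.
  by move=> /fdomainP H j _ /=; rewrite in_itv/= H.
by move=> H; apply/fdomainP => j; have := H j I; rewrite /= in_itv.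
Qed.

Definition lfloor x : Z := [ffun j => Num.floor (tcoord j x)].

Lemma fdomain_shift x z : D (x + lpoint z) <-> z = - lfloor x.
Proof.
rewrite fdomainP; split=> [H|->].
  apply/ffunP => j; rewrite !ffunE; apply/eqP; rewrite -eqr_oppLR; apply/eqP/esym.
  apply: floor_def; have := H j; rewrite tcoordD tcoord_lpoint intrD mulrNz; lra.
move=> j; rewrite tcoordD lpointN tcoordN tcoord_lpoint ffunE.
have := floor_itv (tcoord j x); rewrite intrD; lra.
Qed.

(** Exactly one lattice translate of [x] falls into the fundamental domain, the one given by the
    integer parts of its coordinates. *)
Lemma esum_tiling (c : \bar R) x : (0 <= c)%E ->
  (\esum_(z in [set: Z]) (c * (\1_D (x + lpoint z)%R)%:E) = c)%E.
Proof.
move=> c0; rewrite (esumID [set - lfloor x]); last by move=> z _; rewrite mule_ge0// lee_fin.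
rewrite setTI setTI esum_set1; last by rewrite mule_ge0// lee_fin.
rewrite indicE mem_set; last by apply/fdomain_shift.
rewrite mule1 esum1 ?adde0// => z /= nz; rewrite indicE memNset ?mule0// => /fdomain_shift.
exact: nz.
Qed.

Lemma reindex_lattice_opp (f : Z -> \bar R) :
  (\esum_(z in [set: Z]) f (- z)%R = \esum_(z in [set: Z]) f z)%E.
Proof.
symmetry; apply: reindex_esum; split => //.
Qed.

Lemma reindex_latticeD (w : Z) (f : Z -> \bar R) :
  (\esum_(z in [set: Z]) f (z + w)%R = \esum_(z in [set: Z]) f z)%E.
Proof.
symmetry; apply: reindex_esum; split => //.
- by move=> z z' _ _; exact: addIr.
- by move=> z _; exists (z - w) => //; rewrite subrK.
Qed.

Let mshift s (f : 'cV[R]_d -> \bar R) : measurable_fun setT f ->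
  measurable_fun setT (fun x => f (x + s)).
Proof. by move=> mf; apply: measurableT_comp => //; exact: measurable_cVD. Qed.

Let mindicD : measurable_fun setT (fun x => (\1_D x : R)%:E).
Proof. by apply/measurable_EFinP; apply: measurable_indic; exact: measurable_fdomain. Qed.

Lemma integral_fdomain (f : 'cV[R]_d -> \bar R) :
  (\int[lam]_(x in D) f x = \int[lam]_x (f x * (\1_D x)%:E))%E.
Proof. by rewrite integral_mkcond epatch_indic. Qed.

(** The integrand is multiplied by the tiling identity; Tonelli and a translation then move each
    piece back to the fundamental domain. *)
Lemma integral_unfold (f : 'cV[R]_d -> \bar R) : measurable_fun setT f ->
  (forall x, 0 <= f x)%E ->
  (\int[lam]_x f x = \esum_(z in [set: Z]) \int[lam]_(x in D) f (x + lpoint z)%R)%E.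
Proof.
move=> mf f0.
transitivity (\int[lam]_x \esum_(z in [set: Z]) (f x * (\1_D (x + lpoint z)%R)%:E))%E.
  by apply: eq_integral => x _; rewrite esum_tiling.
rewrite integral_esum_count//; first last.
- by move=> z x; rewrite mule_ge0// lee_fin.
- by move=> z; apply: emeasurable_funM => //; exact: (mshift _ mindicD).
rewrite -reindex_lattice_opp; apply: eq_esum => z _.
rewrite integral_fdomain -[RHS](integral_cVD (lpoint z)); last first.
  by apply: emeasurable_funM mindicD; exact: mshift.
by apply: eq_integral => x _; rewrite lpointN addrK.
Qed.

(** The shifted domain is unfolded over the lattice and refolded, since its translates tile space as
    well. *)
Lemma integral_periodic_shift (f : 'cV[R]_d -> \bar R) s : measurable_fun setT f ->
  (forall x, 0 <= f x)%E -> (forall x z, f (x + lpoint z) = f x) ->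
  (\int[lam]_(x in D) f (x + s)%R = \int[lam]_(x in D) f x)%E.
Proof.
move=> mf f0 fper.
transitivity (\int[lam]_x (f x * (\1_D (x - s)%R)%:E))%E.
  rewrite integral_fdomain -[RHS](integral_cVD s); last first.
    by apply: emeasurable_funM => //; exact: (mshift (- s) mindicD).
  by apply: eq_integral => x _; rewrite addrK.
have mfs : measurable_fun setT (fun x => f x * (\1_D (x - s)%R)%:E)%E.
  by apply: emeasurable_funM => //; exact: (mshift _ mindicD).
rewrite integral_unfold//; last by move=> x; rewrite mule_ge0// lee_fin.
rewrite -integral_esum_count//; first last.
- by move=> z x; rewrite mule_ge0// lee_fin.
- by move=> z; apply: measurable_funTS; exact: (mshift (lpoint z) mfs).
- exact: measurable_fdomain.
apply: eq_integral => x _; rewrite -[RHS](esum_tiling (x - s) (f0 x)).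
by apply: eq_esum => z _; rewrite fper addrAC.
Qed.

Definition diam : R := \sum_j enorm (tnth a j).

Lemma enorm_tcoord (c : R) x : (forall j, `|tcoord j x| <= c) -> enorm x <= c * diam.
Proof.
move=> H; rewrite [x]tcoord_sum mulr_sumr.
have : forall (r : seq 'I_d), enorm (\sum_(j <- r) tcoord j x *: tnth a j) <= \sum_(j <- r) c * enorm (tnth a j).
  elim=> [|j r IH]; first by rewrite !big_nil enorm0.
  rewrite !big_cons (le_trans (enormD _ _))// lerD// enormZ ler_wpM2r ?enorm_ge0//.
exact.
Qed.

Lemma diam_ge0 : 0 <= diam.
Proof. by apply: sumr_ge0 => j _; exact: enorm_ge0. Qed.

Lemma fdomain_ball : D `<=` closed_eball diam.
Proof.
move=> x /fdomainP H; apply/closed_eballP; rewrite -[diam]mul1r; apply: enorm_tcoord => j.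
by have /andP[h1 h2] := H j; rewrite ger0_norm// ltW.
Qed.

Definition covol : R := fine (lam D).

Lemma covolE : lam D = covol%:E.
Proof.
rewrite /covol fineK// ge0_fin_numE// (@le_lt_trans _ _ (lam (closed_eball diam)))//.
  by apply: le_lam; [exact: measurable_fdomain|exact: measurable_closed_eball|exact: fdomain_ball].
by rewrite volE ltry.
Qed.

(** If the domain were null, its countably many translates would make the whole space null, against
    the volume of the unit ball. *)
Lemma covol_gt0 : 0 < covol.
Proof.
rewrite lt_def fine_ge0// andbT; apply/negP => /eqP V0.
have lD0 : lam D = 0%E by rewrite covolE V0.
have : (lam (closed_eball 1) <= lam setT)%E.
  by apply: le_lam; [exact: measurable_closed_eball|exact: measurableT|].
suff -> : lam setT = 0%E by rewrite volE lee_fin leNgt vol1_gt0.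
rewrite -[LHS]mul1e -integral_cst//= integral_unfold//.
apply: esum1 => z _; rewrite (integral_cst lam measurable_fdomain).
by rewrite [X in (_ * X)%E]lD0 mule0.
Qed.

End lattice_tiling.

Section finite_sums.
Context d (T : measurableType d) (R : realType) (mu : {measure set T -> \bar R}).

Lemma Rintegral_sum_fin (I : finType) (f : I -> T -> R) (E : set T) :
  measurable E -> (forall i, mu.-integrable E (EFin \o f i)) ->
  \int[mu]_(x in E) (\sum_i f i x) = \sum_i \int[mu]_(x in E) f i x.
Proof.
move=> mE fi; rewrite /Rintegral; under eq_integral do rewrite -sumEFin.
rewrite integral_sum//= -sum_fine//.
by move=> i _; exact: (integrable_fin_num mE (fi i)).
Qed.

Lemma integrable_sum_fin (I : finType) (f : I -> T -> R) (E : set T) :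
  measurable E -> (forall i, mu.-integrable E (EFin \o f i)) ->
  mu.-integrable E (EFin \o (fun x => \sum_i f i x)).
Proof.
move=> mE fi; rewrite /comp; under eq_fun do rewrite -sumEFin.
by apply: (integrable_sum mE) => i _; exact: fi.
Qed.

End finite_sums.

(** * Trigonometric functions of the dual lattice and the Fejer kernel *)

Section lattice_fourier.
Context {R : realType} {d : nat}.
Variable a : d.-tuple 'cV[R]_d.
Hypothesis ba : basis_of fullv a.
Local Notation lam := (@lebesgue_cV R d).
Local Notation Z := {ffun 'I_d -> int}.
Local Notation D := (fundamental_domain a).
Local Notation lp := (lpoint a).
Implicit Types (z k : Z) (x y s : 'cV[R]_d).

(** 2 pi times a point of the dual lattice, so that the corresponding cosine is periodic along the
    lattice. *)
Definition freq k : 'cV[R]_d := (2 * pi) *: \sum_j (k j)%:~R *: dual_vec a j.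

Lemma dot_freq k x : dot (freq k) x = 2 * pi * \sum_j (k j)%:~R * tcoord a j x.
Proof.
rewrite /freq dotZl; congr (_ * _).
have H : forall (r : seq 'I_d), dot (\sum_(j <- r) (k j)%:~R *: dual_vec a j) x = \sum_(j <- r) (k j)%:~R * tcoord a j x.
  elim=> [|j r IH]; first by rewrite !big_nil dotC dot0r.
  by rewrite !big_cons dotDl dotZl IH.
exact: H.
Qed.

Lemma freqD k l x : dot (freq (k + l)) x = dot (freq k) x + dot (freq l) x.
Proof.
rewrite !dot_freq -mulrDr -big_split; congr (_ * _); apply: eq_bigr => j _ /=.
by rewrite ffunE intrD mulrDl.
Qed.

Lemma freqN k x : dot (freq (- k)) x = - dot (freq k) x.
Proof.
rewrite !dot_freq -mulrN -sumrN; congr (_ * _); apply: eq_bigr => j _ /=.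
by rewrite ffunE mulrNz mulNr.
Qed.

Lemma freq0 x : dot (freq 0) x = 0.
Proof. by rewrite dot_freq big1 ?mulr0// => j _; rewrite ffunE mul0r. Qed.

Lemma cosD2pin (x : R) (m : int) : cos (x + 2 * pi * m%:~R) = cos x.
Proof.
have Hn (y : R) (n : nat) : cos (y + 2 * pi * n%:R) = cos y.
  elim: n => [|n IH]; first by rewrite mulr0 addr0.
  rewrite (_ : y + 2 * pi * n.+1%:R = y + 2 * pi * n%:R + pi *+ 2) ?cosD2pi//.
  by rewrite -[n.+1]addn1 natrD; ring.
case: m => n; first exact: Hn.
rewrite NegzE mulrNz mulrN -(Hn (x - _) n.+1); congr cos; rewrite -pmulrn; lra.
Qed.

Lemma freq_lpoint k z : exists m : int, dot (freq k) (lp z) = 2 * pi * m%:~R.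
Proof.
exists (\sum_j (k j) * (z j)); rewrite dot_freq; congr (_ * _).
rewrite raddf_sum; apply: eq_bigr => j _ /=.
by rewrite tcoord_lpoint// intrM.
Qed.

Lemma cos_freq_periodic k (c : R) x z : cos (dot (freq k) (x + lp z) + c) = cos (dot (freq k) x + c).
Proof.
have [m mE] := freq_lpoint k z.
by rewrite dotDr mE addrAC cosD2pin.
Qed.

Lemma measurable_cos_freq k c : measurable_fun setT (fun x : 'cV[R]_d => cos (dot (freq k) x + c)).
Proof.
apply: (measurableT_comp (continuous_measurable_fun (@continuous_cos R))).
by apply: measurable_funD => //; apply: measurable_dot; exact: measurable_id.
Qed.

Lemma fdomain_integrable (f : 'cV[R]_d -> R) (K : R) : measurable_fun setT f ->
  (forall x, `|f x| <= K) -> lam.-integrable D (EFin \o f).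
Proof.
move=> mf fK; apply: (integrableS (E := closed_eball (diam a))).
- exact: measurable_closed_eball.
- exact: measurable_fdomain.
- exact: fdomain_ball.
- exact: (@ball_integrable R d f K).
Qed.

(** A translation by half a period changes the sign of the cosine but not its integral over the
    domain. *)
Lemma integral_cos_freq k c : k != 0 -> \int[lam]_(x in D) cos (dot (freq k) x + c) = 0.
Proof.
move=> k0; have [j kj] : exists j, k j != 0.
  apply/existsP; apply: contraNT k0 => /existsPn H.
  by apply/eqP/ffunP => j; rewrite ffunE; apply/eqP; have := H j; rewrite negbK.
(* Half a period in the direction of a nonzero component [k j]: the phase advances by 2 pi [k j] /
   (2 [k j]) = pi. *)
pose s : 'cV[R]_d := (2 * (k j)%:~R)^-1 *: tnth a j.
have mD := measurable_fdomain ba.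
have kjR : (k j)%:~R != 0 :> R by rewrite intr_eq0.
have sE : dot (freq k) s = pi.
  have sS : s = \sum_i (if i == j then (2 * (k j)%:~R)^-1 else 0) *: tnth a i.
    rewrite (bigD1 j)//= eqxx big1 ?addr0// => i ij.
    by rewrite (negbTE ij) scale0r.
  rewrite dot_freq (bigD1 j)//= big1 ?addr0.
    by rewrite {1}sS tcoordK// eqxx; field.
  by move=> i ij; rewrite sS tcoordK// (negbTE ij) mulr0.
pose f x := cos (dot (freq k) x + c).
have mf : measurable_fun setT f by exact: measurable_cos_freq.
have f1 x : `|f x| <= 1 by exact: cos_max.
(* Adding 1 makes the integrand nonnegative, as [integral_periodic_shift] asks; the constant cancels
   in the end. *)
have m1f : measurable_fun setT (fun x => (1 + f x)%:E).
  by apply/measurable_EFinP; apply: measurable_funD.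
have := @integral_periodic_shift R d a ba (fun x => (1 + f x)%:E) s m1f.
have H0 x : (0 <= (1 + f x)%:E)%E by rewrite lee_fin; have := f1 x; rewrite ler_norml; lra.
have Hp x z : (1 + f (x + lp z))%:E = (1 + f x)%:E by rewrite /f cos_freq_periodic.
move=> /(_ H0 Hp).
have fi := @fdomain_integrable f 1 mf f1.
have ci : lam.-integrable D (EFin \o (fun=> 1 : R)).
  by apply: (@fdomain_integrable _ 1) => // x; rewrite normr1.
have -> : (\int[lam]_(x in D) (1 + f (x + s)%R)%:E = \int[lam]_(x in D) (1 - f x)%:E)%E.
  apply: eq_integral => x _; congr EFin; congr (_ + _).
  by rewrite /f dotDr sE addrAC cosDpi.
move=> H.
have : \int[lam]_(x in D) (1 - f x) = \int[lam]_(x in D) (1 + f x) by rewrite /Rintegral H.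
rewrite RintegralB// RintegralD// -/f; lra.
Qed.

Context (n : nat).
Hypothesis n0 : (0 < n)%N.
Local Notation J := {ffun 'I_d -> 'I_n}.

Definition boxpt (j : J) : Z := [ffun i => Posz (j i)].

(* n^-d |sum_j exp(2 pi i j.t)|^2, j ranging over {0, ..., n-1}^d and t being
   the coordinates of x in the basis a. *)
Definition fejer x : R := (n%:R ^+ d)^-1 *
  \sum_(j : J) \sum_(l : J) cos (dot (freq (boxpt j - boxpt l)) x).

Lemma fejer_ge0 x : 0 <= fejer x.
Proof.
rewrite mulr_ge0 ?invr_ge0 ?exprn_ge0//.
pose th (j : J) := dot (freq (boxpt j)) x.
rewrite [X in 0 <= X](_ : _ = (\sum_(j : J) cos (th j)) ^+ 2 + (\sum_(j : J) sin (th j)) ^+ 2).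
  by rewrite addr_ge0 ?sqr_ge0.
rewrite !expr2 !mulr_suml -big_split; apply: eq_bigr => j _ /=.
rewrite !mulr_sumr -big_split; apply: eq_bigr => l _ /=.
by rewrite freqD freqN cosD cosN sinN mulrN opprK.
Qed.

Lemma measurable_fejer : measurable_fun setT fejer.
Proof.
apply: measurable_funM => //; apply: measurable_sum => j; apply: measurable_sum => l.
exact: measurable_cos_dot.
Qed.

Lemma fejer_periodic x z : fejer (x + lp z) = fejer x.
Proof.
congr (_ * _); apply: eq_bigr => j _; apply: eq_bigr => l _.
by have := cos_freq_periodic (boxpt j - boxpt l) 0 x z; rewrite !addr0.
Qed.

Lemma card_box : (#|J|)%:R = n%:R ^+ d :> R.
Proof. by rewrite card_ffun !card_ord natrX. Qed.

Lemma fejer_le x : `|fejer x| <= n%:R ^+ d.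
Proof.
have nd : 0 < n%:R ^+ d :> R by rewrite exprn_gt0// ltr0n.
rewrite normrM ger0_norm ?invr_ge0 ?(ltW nd)// mulrC ler_pdivrMr//.
apply: le_trans (ler_norm_sum _ _ _) _.
apply: (@le_trans _ _ (\sum_(j : J) n%:R ^+ d)); last first.
  by rewrite sumr_const -[leLHS]mulr_natl card_box.
apply: ler_sum => j _; apply: le_trans (ler_norm_sum _ _ _) _.
by rewrite -card_box -sum1_card natr_sum; apply: ler_sum => l _; exact: cos_max.
Qed.

Let mD := measurable_fdomain ba.

Let int_cos (k : Z) : lam.-integrable D (EFin \o (fun x => cos (dot (freq k) x))).
Proof. by apply: (@fdomain_integrable _ 1); [exact: measurable_cos_dot|move=> x; exact: cos_max]. Qed.

Lemma integral_cos_freq0 (k : Z) : \int[lam]_(x in D) cos (dot (freq k) x) = (k == 0)%:R * covol a.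
Proof.
have [->|k0] := eqVneq k 0; last first.
  rewrite mul0r -(integral_cos_freq 0 k0).
  by apply: eq_Rintegral => x _; rewrite addr0.
transitivity (\int[lam]_(x in D) (1 : R)).
  by apply: eq_Rintegral => x _; rewrite freq0 cos0.
by rewrite Rintegral_cst// !mul1r.
Qed.

Definition unitpt (m : 'I_d) : Z := [ffun i => Posz (i == m)].

Lemma freq_unitpt m x : dot (freq (unitpt m)) x = 2 * pi * tcoord a m x.
Proof.
rewrite dot_freq (bigD1 m)//= ffunE eqxx mul1r big1 ?addr0// => i im.
by rewrite ffunE (negbTE im) mul0r.
Qed.

Lemma sum_box_coord (F : 'I_n -> R) (m : 'I_d) :
  \sum_(l : J) F (l m) = (\sum_i F i) * n%:R ^+ d.-1.
Proof.
pose G (i : 'I_d) (j : 'I_n) : R := if i == m then F j else 1.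
have : \prod_i \sum_j G i j = \sum_(l : J) \prod_i G i (l i) := bigA_distr_bigA _.
rewrite /G.
rewrite (bigD1 m)//= eqxx.
have -> : \prod_(i < d | i != m) \sum_(j < n) (if i == m then F j else 1) = n%:R ^+ d.-1.
  transitivity (\prod_(i in predC1 m) (n%:R : R)).
    by apply: eq_bigr => i /negbTE im; rewrite im sumr_const card_ord.
  by rewrite prodr_const cardC1 card_ord.
move=> ->; apply: eq_bigr => l _.
rewrite (bigD1 m)//= eqxx big1 ?mulr1// => i /negbTE ->//.
Qed.

Lemma boxpt_inj : injective boxpt.
Proof.
move=> j l /ffunP jl; apply/ffunP => i; apply/val_inj.
by have := jl i; rewrite !ffunE => -[].
Qed.

(** Number of ways of writing [k] as a difference of two points of the box; divided by n^d, it is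
    the Fourier coefficient of [fejer] at [k]. *)
Let cnt (k : Z) : R := \sum_(j : J) \sum_(l : J) (boxpt j - boxpt l == k)%:R.

Let cnt0 : cnt 0 = n%:R ^+ d.
Proof.
rewrite -card_box -sum1_card natr_sum; apply: eq_bigr => j _.
rewrite (bigD1 j)//= subrr eqxx big1 ?addr0// => l lj.
by rewrite subr_eq0 (inj_eq boxpt_inj) eq_sym (negbTE lj).
Qed.

(** Each l with l_m + 1 < n yields the pair (l + e_m, l), and there are (n - 1) n^(d-1) such l. *)
Let cnt_unit_ge m : n%:R ^+ d - n%:R ^+ d.-1 <= cnt (unitpt m).
Proof.
rewrite /cnt exchange_big/=.
apply: (@le_trans _ _ (\sum_(l : J) ((l m).+1 < n)%N%:R)).
  rewrite (sum_box_coord (fun i : 'I_n => (i.+1 < n)%N%:R) m).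
  have -> : \sum_(i < n) (i.+1 < n)%N%:R = n%:R - 1 :> R.
    case: n n0 => // k _; rewrite big_ord_recr/= ltnn addr0 -natr1 addrK.
    rewrite (eq_bigr (fun=> 1)); last by move=> i _; rewrite ltnS ltn_ord.
    by rewrite sumr_const card_ord.
  by rewrite mulrBl mul1r -exprS prednK// (leq_ltn_trans _ (ltn_ord m)).
apply: ler_sum => l _; case: ltnP => [lm|_]; last exact: sumr_ge0.
pose j : J := [ffun i => if i == m then Ordinal lm else l i].
rewrite (bigD1 j)//= (_ : boxpt j - boxpt l == unitpt m) ?lerDl ?sumr_ge0//.
apply/eqP/ffunP => i; rewrite !ffunE; case: eqVneq => [->|_]/=; lia.
Qed.

Let cnt_opp k : cnt (- k) = cnt k.
Proof.
rewrite /cnt exchange_big/=; apply: eq_bigr => j _; apply: eq_bigr => l _.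
by rewrite -[in RHS](eqr_opp (_ - _)) opprB.
Qed.

Lemma integral_fejer : \int[lam]_(x in D) fejer x = covol a.
Proof.
rewrite RintegralZl//; last first.
  by apply: integrable_sum_fin => // j; apply: integrable_sum_fin.
rewrite Rintegral_sum_fin//; last by move=> j; apply: integrable_sum_fin.
under eq_bigr => j _ do rewrite Rintegral_sum_fin//.
under eq_bigr => j _ do under eq_bigr => l _ do rewrite integral_cos_freq0.
under eq_bigr => j _ do rewrite -mulr_suml.
rewrite -mulr_suml -/(cnt 0) cnt0 mulrA mulVf ?mul1r//.
by rewrite expf_neq0// pnatr_eq0 -lt0n.
Qed.

(** Concentration of the kernel near the lattice: the integral is the covolume times 1 -
    [cnt (unitpt m)] / n^d, which is at most 1/n. *)
Lemma integral_fejer_coord m :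
  \int[lam]_(x in D) (fejer x * (1 - cos (2 * pi * tcoord a m x))) <= covol a / n%:R.
Proof.
have nd : 0 < n%:R ^+ d :> R by rewrite exprn_gt0// ltr0n.
(* cos A (1 - cos B) as a sum of cosines, so that only the coefficients at 0 and at plus or minus
   [unitpt m] are seen by the integral. *)
pose T k x : R := cos (dot (freq k) x) - 2^-1 * cos (dot (freq (k + unitpt m)) x)
  - 2^-1 * cos (dot (freq (k - unitpt m)) x).
have Ti k : lam.-integrable D (EFin \o T k).
  apply: RintegrableB => //; last exact: RintegrableZl.
  by apply: RintegrableB => //; exact: RintegrableZl.
have TE k : \int[lam]_(x in D) T k x =
    ((k == 0)%:R - 2^-1 * (k == - unitpt m)%:R - 2^-1 * (k == unitpt m)%:R) * covol a.
  rewrite RintegralB//; [|by apply: RintegrableB => //; exact: RintegrableZl|exact: RintegrableZl].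
  rewrite RintegralB//; last exact: RintegrableZl.
  rewrite !RintegralZl// !integral_cos_freq0 subr_eq0 addr_eq0; ring.
rewrite (_ : Rintegral _ _ _ = \int[lam]_(x in D) ((n%:R ^+ d)^-1 *
    \sum_(j : J) \sum_(l : J) T (boxpt j - boxpt l) x)); last first.
  apply: eq_Rintegral => x _; rewrite /fejer -[LHS]mulrA; congr (_ * _).
  rewrite mulr_suml; apply: eq_bigr => j _; rewrite mulr_suml; apply: eq_bigr => l _.
  rewrite /T -freq_unitpt !freqD !freqN.
  move: (dot (freq (boxpt j)) x - dot (freq (boxpt l)) x) (dot (freq (unitpt m)) x) => A B.
  by rewrite cosB cosD; field.
rewrite RintegralZl//; last first.
  by apply: integrable_sum_fin => // j; apply: integrable_sum_fin.
rewrite Rintegral_sum_fin//; last by move=> j; apply: integrable_sum_fin.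
under eq_bigr => j _ do rewrite Rintegral_sum_fin//.
under eq_bigr => j _ do under eq_bigr => l _ do rewrite TE.
under eq_bigr => j _ do rewrite -mulr_suml !sumrB -!mulr_sumr.
rewrite -mulr_suml !sumrB -!mulr_sumr -/(cnt 0) -/(cnt (- unitpt m)) -/(cnt (unitpt m)).
rewrite cnt_opp cnt0 mulrA mulrC ler_wpM2l ?(ltW (covol_gt0 ba))//.
rewrite mulrC ler_pdivrMr//.
have -> : n%:R^-1 * n%:R ^+ d = n%:R ^+ d.-1 :> R.
  rewrite -[in LHS](@prednK d) ?(leq_ltn_trans _ (ltn_ord m))// exprS mulrA mulVf ?mul1r//.
  by rewrite pnatr_eq0 -lt0n.
have := cnt_unit_ge m; lra.
Qed.

End lattice_fourier.

(** * Periodization and its uniform approximation by Fejer sums *)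

Section fejer_approximation.
Context {R : realType} {d : nat}.
Variable a : d.-tuple 'cV[R]_d.
Hypothesis ba : basis_of fullv a.
Local Notation lam := (@lebesgue_cV R d).
Local Notation Z := {ffun 'I_d -> int}.
Local Notation D := (fundamental_domain a).
Local Notation lp := (lpoint a).
Local Notation B := (@closed_eball R d).
Implicit Types (z k : Z) (x y s : 'cV[R]_d).

(** Packing: translates of the fundamental domain attached to the counted points are disjoint and
    lie in a ball of radius [rho + diam a]. It is carried out by averaging over a shift y in the
    domain. *)
Lemma lattice_count rho x :
  (\esum_(z in [set: Z]) (\1_(B rho) (x + lp z) : R)%:E <=
   (@vol R d (rho + diam a) / covol a)%:E)%E.
Proof.
have V0 := covol_gt0 ba; have mD := measurable_fdomain ba.
have mB r : measurable (B r) by exact: measurable_closed_eball.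
have mi r : measurable_fun setT (fun y : 'cV[R]_d => (\1_(B r) (x + y) : R)%:E).
  apply/measurable_EFinP.
  have mI : measurable_fun setT (\1_(B r) : 'cV[R]_d -> R) by apply: measurable_indic; exact: mB.
  apply: (measurableT_comp mI); exact: measurable_cVD.
have H : (\int[lam]_(y in D) (\esum_(z in [set: Z]) (\1_(B rho) (x + lp z) : R)%:E) <=
          (@vol R d (rho + diam a))%:E)%E.
  rewrite integral_esum_count//.
  rewrite (_ : (@vol R d (rho + diam a))%:E =
     (\int[lam]_y (\1_(B (rho + diam a)) (x + y)%R : R)%:E)%E); last first.
    rewrite -volE.
    transitivity (\int[lam]_y (\1_(B (rho + diam a)) (y + x)%R : R)%:E)%E.
      rewrite (integral_cVD x (f := fun y => (\1_(B (rho + diam a)) y : R)%:E)).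
        by rewrite integral_indic ?setIT.
      by apply/measurable_EFinP; apply: measurable_indic.
    by apply: eq_integral => y _; rewrite (addrC y x).
  rewrite (integral_unfold ba)//.
  apply: le_esum => z _; apply: ge0_le_integral => //.
  - apply: measurable_funTS; apply: (measurableT_comp (mi _)); exact: measurable_cVD.
  move=> y /(fdomain_ball ba)/closed_eballP yD; rewrite lee_fin !indicE ler_nat.
  case: (boolP (_ \in B rho)) => //; rewrite !closed_eballE => xz.
  rewrite (le_trans _ (_ : enorm (x + lp z) + enorm y <= _))//; last by rewrite lerD.
  by rewrite addrCA addrC enormD.
have E c : (\int[lam]_(y in D) c = c * (covol a)%:E)%E.
  by rewrite -(covolE ba); exact: integral_cst.
rewrite E in H.
by rewrite EFinM lee_pdivlMr.
Qed.

Variables (g : 'cV[R]_d -> R) (rho Lam Cg : R).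
Hypothesis mg : measurable_fun setT g.
Hypothesis g_ge0 : forall x, 0 <= g x.
Hypothesis g_le : forall x, g x <= Cg.
Hypothesis g_supp : forall x, rho < enorm x -> g x = 0.
Hypothesis g_lip : forall x y, `|g (x + y) - g x| <= Lam * enorm y.
Hypothesis g_even : forall x, g (- x) = g x.

Definition gper x : R := fine (\esum_(z in [set: Z]) (g (x + lp z))%:E)%E.

Let Cg0 : 0 <= Cg.
Proof. exact: le_trans (g_ge0 0) (g_le 0). Qed.

Let g_ind x : `|g x| <= Cg * \1_(B rho) x.
Proof.
rewrite ger0_norm// indicE closed_eballE; case: (leP (enorm x) rho) => xr; first by rewrite mulr1.
by rewrite g_supp// mulr0.
Qed.

Definition count_bound r : R := @vol R d (r + diam a) / covol a.

Let esum_ind r (c : R) x : 0 <= c ->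
  (\esum_(z in [set: Z]) (c * \1_(B r) (x + lp z))%:E <= (c * count_bound r)%:E)%E.
Proof.
move=> c0; rewrite esum_countE; last by move=> z; rewrite lee_fin mulr_ge0.
rewrite (eq_eseriesr (g := fun n => (c%:E * (if pickle_inv n is Some z then (\1_(B r) (x + lp z) : R)%:E else 0))%E)).
  rewrite nneseriesZl; last first.
    by move=> n _; case: pickle_inv => // z; rewrite lee_fin.
  rewrite EFinM; apply: lee_wpmul2l; first by rewrite lee_fin.
  by have := lattice_count r x; rewrite esum_countE// => z; rewrite lee_fin.
by move=> n _; case: pickle_inv => [z|]; rewrite ?mule0 ?EFinM.
Qed.

Lemma gperE x : (\esum_(z in [set: Z]) (g (x + lp z))%:E = (gper x)%:E)%E.
Proof.
rewrite /gper fineK// ge0_fin_numE; last by apply: esum_ge0 => z _; rewrite lee_fin.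
apply: (@le_lt_trans _ _ (Cg * count_bound rho)%:E); last exact: ltry.
apply: le_trans (esum_ind rho x Cg0); apply: le_esum => z _; rewrite lee_fin.
by apply: le_trans (g_ind _); rewrite ler_norm.
Qed.

Lemma gper_ge0 x : 0 <= gper x.
Proof. by rewrite fine_ge0// esum_ge0// => z _; rewrite lee_fin. Qed.

Lemma gper_le x : gper x <= Cg * count_bound rho.
Proof.
rewrite -lee_fin -gperE.
apply: le_trans (esum_ind rho x Cg0); apply: le_esum => z _; rewrite lee_fin.
by apply: le_trans (g_ind _); rewrite ler_norm.
Qed.

Lemma gper_periodic x z : gper (x + lp z) = gper x.
Proof.
rewrite /gper; congr fine; rewrite -[RHS](reindex_latticeD z).
by apply: eq_esum => w _; rewrite lpointD addrA addrAC.
Qed.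

Lemma measurable_gper : measurable_fun setT gper.
Proof.
apply: (measurableT_comp (@fine_measurable _ _ measurableT)).
apply: measurable_esum_count => [z|z x]; last by rewrite lee_fin.
apply/measurable_EFinP; apply: (measurableT_comp mg); exact: measurable_cVD.
Qed.

(** Outside the ball of radius [rho + enorm y] both g(x + z) and g(x + y + z) vanish, so the
    Lipschitz bound is paid only for the lattice points counted there. *)
Let gper_shift x y : gper (x + y) <= gper x + Lam * enorm y * count_bound (rho + enorm y).
Proof.
have Lam0 : 0 <= Lam * enorm y by exact: le_trans (normr_ge0 _) (g_lip 0 y).
rewrite -lee_fin EFinD -!gperE.
apply: (@le_trans _ _ (\esum_(z in [set: Z]) ((g (x + lp z))%:E +
   (Lam * enorm y * \1_(B (rho + enorm y)) (x + lp z))%:E))%E).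
  apply: le_esum => z _; rewrite -EFinD lee_fin addrAC -lerBlDl.
  rewrite indicE closed_eballE; case: (leP (enorm (x + lp z)) (rho + enorm y)) => xz; rewrite ?mulr1.
    exact: le_trans (ler_norm _) (g_lip _ _).
  rewrite (g_supp (x := x + lp z + y)) ?(g_supp (x := x + lp z)) ?subrr ?mulr0//.
    by apply: le_lt_trans xz; rewrite lerDl enorm_ge0.
  have := enormB (x + lp z + y) y; rewrite addrK; lra.
rewrite esumD; [|by move=> z _; rewrite lee_fin|by move=> z _; rewrite lee_fin mulr_ge0].
by apply: leeD => //; exact: esum_ind.
Qed.

Let gper_lip x y : `|gper (x + y) - gper x| <= Lam * enorm y * count_bound (rho + enorm y).
Proof.
rewrite ler_norml; apply/andP; split; last by have := gper_shift x y; lra.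
by have := gper_shift (x + y) (- y); rewrite addrK enormN; lra.
Qed.

(** Either |t| <= e, or e < |t| <= 1/2, where 1 - cos(2 pi t) exceeds its value at e and the second
    summand is at least 1. *)
Let cos_lb (t e : R) : 0 < e <= 2^-1 -> `|t| <= 2^-1 ->
  `|t| <= e + (1 - cos (2 * pi * e))^-1 * (1 - cos (2 * pi * t)).
Proof.
move=> /andP[e0 e1] t1.
have p0 := pi_gt0 R.
have ct : cos (2 * pi * t) = cos (2 * pi * `|t|).
  by case: (ger0P t) => // _; rewrite mulrN cosN.
have ce : cos (2 * pi * e) < 1.
  rewrite -[X in _ < X]cos0 ltr_cos ?mulr_gt0// in_itv/= ?lexx ?pi_ge0//.
  by apply/andP; split; nra.
have [te|te] := leP `|t| e.
  by rewrite (le_trans te)// lerDl; apply: mulr_ge0; rewrite ?invr_ge0 subr_ge0 ?(ltW ce)// cos_le1.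
have cte : cos (2 * pi * `|t|) <= cos (2 * pi * e).
  apply: ltW; rewrite ltr_cos.
  - by rewrite ltr_pM2l// mulr_gt0.
  - by rewrite in_itv/=; apply/andP; split; [rewrite !mulr_ge0// ltW|nra].
  - by rewrite in_itv/=; apply/andP; split; nra.
have H : 1 <= (1 - cos (2 * pi * e))^-1 * (1 - cos (2 * pi * t)).
  by rewrite mulrC ler_pdivlMr ?subr_gt0// mul1r ct lerD2l lerN2.
lra.
Qed.

(* The right-hand side is what the Fejer kernel integrates to e + O(1/n). *)
Let gper_modulus (e : R) : 0 < e -> exists C : R, 0 <= C /\ forall x y,
  `|gper (x + y) - gper x| <= e + C * \sum_m (1 - cos (2 * pi * tcoord a m y)).
Proof.
move=> e0.
have Am0 := diam_ge0 a.
pose c := `|Lam| * diam a * count_bound (rho + diam a).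
have cb0 : 0 <= count_bound (rho + diam a).
  by rewrite divr_ge0 ?vol_ge0// ltW// covol_gt0.
have c0 : 0 <= c by apply: mulr_ge0 => //; apply: mulr_ge0.
(* The d coordinates contribute c d e', to be at most e; [cos_lb] asks for e' <= 1/2. *)
pose e' := Num.min 2^-1 (e / (c * d%:R + 1)).
have cd0 : 0 < c * d%:R + 1 by rewrite ltr_wpDl// mulr_ge0.
have e'0 : 0 < e' by rewrite lt_min invr_gt0 ltr0n/= divr_gt0.
have e'1 : 0 < e' <= 2^-1 by rewrite e'0 ge_min lexx.
have ce : 0 <= (1 - cos (2 * pi * e'))^-1.
  by rewrite invr_ge0 subr_ge0 cos_le1.
exists (c * (1 - cos (2 * pi * e'))^-1); split; first by rewrite mulr_ge0.
move=> x y.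
(* Rounding the coordinates of [y] to nearest integers: by periodicity [y] may be replaced by a
   vector with coordinates in [-1/2, 1/2], where [cos_lb] applies. *)
pose z : Z := [ffun j => - Num.floor (tcoord a j y + 2^-1)].
pose y' := y + lp z.
have t' j : tcoord a j y' = tcoord a j y - (Num.floor (tcoord a j y + 2^-1))%:~R.
  by rewrite tcoordD tcoord_lpoint// ffunE mulrNz.
have t1 j : `|tcoord a j y'| <= 2^-1.
  rewrite t' ler_norml; have := floor_itv (tcoord a j y + 2^-1); rewrite intrD; lra.
have cE j : cos (2 * pi * tcoord a j y') = cos (2 * pi * tcoord a j y).
  by rewrite t' mulrBr -mulrN -mulrNz cosD2pin.
have -> : gper (x + y) = gper (x + y') by rewrite /y' addrA gper_periodic.
have yle : enorm y' <= diam a.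
  by rewrite -[diam a]mul1r; apply: enorm_tcoord => // j; apply: le_trans (t1 j) _; lra.
have yle2 : enorm y' <= (\sum_j `|tcoord a j y'|) * diam a.
  by apply: enorm_tcoord => // j; rewrite (bigD1 j)//= lerDl sumr_ge0.
apply: le_trans (gper_lip _ _) _.
apply: (@le_trans _ _ (c * \sum_j `|tcoord a j y'|)).
  rewrite /c -!mulrA.
  apply: (@le_trans _ _ (`|Lam| * (enorm y' * count_bound (rho + enorm y')))).
    by rewrite ler_wpM2r ?ler_norm// mulr_ge0 ?enorm_ge0// divr_ge0 ?vol_ge0// ltW// covol_gt0.
  rewrite ler_wpM2l//.
  rewrite [leRHS](_ : _ = ((\sum_j `|tcoord a j y'|) * diam a) * count_bound (rho + diam a)); last by rewrite /count_bound; ring.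
  apply: ler_pM => //; first exact: enorm_ge0.
    by rewrite divr_ge0 ?vol_ge0// ltW// covol_gt0.
  by rewrite ler_wpM2r ?invr_ge0 ?(ltW (covol_gt0 ba))// le_vol//; lra.
apply: (@le_trans _ _ (c * \sum_j (e' + (1 - cos (2 * pi * e'))^-1 * (1 - cos (2 * pi * tcoord a j y'))))).
  by rewrite ler_wpM2l//; apply: ler_sum => j _; exact: cos_lb.
rewrite big_split/= sumr_const card_ord -mulr_sumr mulrDr -mulrA lerD//; last first.
  by rewrite (eq_bigr (fun m => 1 - cos (2 * pi * tcoord a m y))) ?mulrA// => j _; rewrite cE.
have : e' <= e / (c * d%:R + 1) by rewrite ge_min lexx orbT.
rewrite ler_pdivlMr// -mulr_natl; lra.
Qed.

Definition ghat (u : 'cV[R]_d) : R := \int[lam]_y (g y * cos (dot u y)).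

(* The convolution of gper with the Fejer kernel, see fejer_conv. *)
Definition fejer_sum n x : R := (covol a * n%:R ^+ d)^-1 *
  \sum_(j : {ffun 'I_d -> 'I_n}) \sum_(l : {ffun 'I_d -> 'I_n})
    ghat (freq a (boxpt j - boxpt l)) * cos (dot (freq a (boxpt j - boxpt l)) x).

Let int_g (f : 'cV[R]_d -> R) : measurable_fun setT f -> (forall x, `|f x| <= 1) ->
  lam.-integrable setT (EFin \o (fun y => g y * f y)).
Proof.
move=> mf f1; apply: (@bsupp_integrable R d _ Cg rho).
  exact: measurable_funM.
move=> y; rewrite normrM; apply: le_trans (g_ind y).
by rewrite ler_piMr.
Qed.

Let ghat_sin u : \int[lam]_y (g y * sin (dot u y)) = 0.
Proof.
have mf : measurable_fun setT (fun y => g y * sin (dot u y)).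
  by apply: measurable_funM => //; exact: measurable_sin_dot.
have := Rintegral_cVN mf.
have int_s : lam.-integrable setT (EFin \o (fun y => g y * sin (dot u y))).
  by apply: int_g; [exact: measurable_sin_dot|move=> x; exact: sin_max].
rewrite (_ : \int[lam]_x (g (- x) * sin (dot u (- x))) = -1 * \int[lam]_y (g y * sin (dot u y))).
  lra.
rewrite -RintegralZl//; apply: eq_Rintegral => x _.
by rewrite g_even dotNr sinN; ring.
Qed.

(** The kernel is periodic, so integrating the periodization over the domain is integrating [g] over
    the whole space. A shift by -x and the addition formula then bring out [ghat]; the sine parts
    vanish because [g] is even. *)
Let fejer_conv n x : (0 < n)%N ->
  \int[lam]_(y in D) (gper (x + y) * fejer a n y) = covol a * fejer_sum n x.
Proof.
move=> n0.
have mf := @measurable_fejer R d a n.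
have V0 := covol_gt0 ba; have mD := measurable_fdomain ba.
have mgx : measurable_fun setT (fun y => g (x + y)).
  by apply: (measurableT_comp mg); exact: measurable_cVD.
have mgf : measurable_fun setT (fun y => g (x + y) * fejer a n y) by exact: measurable_funM.
have E1 : (\int[lam]_(y in D) (gper (x + y)%R * fejer a n y)%:E = \int[lam]_y (g (x + y)%R * fejer a n y)%:E)%E.
  rewrite (integral_unfold ba)//; first last.
  - by move=> y; rewrite lee_fin mulr_ge0// fejer_ge0.
  - exact/measurable_EFinP.
  rewrite -integral_esum_count//; first last.
  - by move=> z y; rewrite lee_fin mulr_ge0// fejer_ge0.
  - move=> z; apply: measurable_funTS; apply/measurable_EFinP.
    by apply: (measurableT_comp mgf); exact: measurable_cVD.
  apply: eq_integral => y _.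
  rewrite mulrC EFinM -gperE !esum_countE.
  - rewrite -nneseriesZl; last by move=> m _; case: pickle_inv => // z; rewrite lee_fin.
    apply: eq_eseriesr => m _; case: pickle_inv => [z|]; last by rewrite mule0.
    by rewrite fejer_periodic// -EFinM mulrC addrA.
  - by move=> z; rewrite lee_fin.
  - by move=> z; rewrite lee_fin mulr_ge0// fejer_ge0.
rewrite /Rintegral E1 -/(Rintegral _ _ _) -(Rintegral_cVD (- x) mgf).
have E2 y : g (x + (y - x)) * fejer a n (y - x) = (n%:R ^+ d)^-1 *
   \sum_(j : {ffun 'I_d -> 'I_n}) \sum_(l : {ffun 'I_d -> 'I_n})
   (cos (dot (freq a (boxpt j - boxpt l)) x) * (g y * cos (dot (freq a (boxpt j - boxpt l)) y)) +
    sin (dot (freq a (boxpt j - boxpt l)) x) * (g y * sin (dot (freq a (boxpt j - boxpt l)) y))).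
  rewrite addrC subrK /fejer mulrCA; congr (_ * _).
  rewrite mulr_sumr; apply: eq_bigr => j _; rewrite mulr_sumr; apply: eq_bigr => l _.
  by rewrite dotBr cosB; ring.
under eq_Rintegral do rewrite E2.
have ic u : lam.-integrable setT (EFin \o (fun y => g y * cos (dot u y))).
  by apply: int_g; [exact: measurable_cos_dot|move=> y; exact: cos_max].
have isn u : lam.-integrable setT (EFin \o (fun y => g y * sin (dot u y))).
  by apply: int_g; [exact: measurable_sin_dot|move=> y; exact: sin_max].
have ics u (p q : R) : lam.-integrable setT (EFin \o (fun y => p * (g y * cos (dot u y)) + q * (g y * sin (dot u y)))).
  by apply: RintegrableD => //; exact: RintegrableZl.
rewrite RintegralZl//; last first.
  by apply: integrable_sum_fin => // j; apply: integrable_sum_fin.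
rewrite Rintegral_sum_fin//; last by move=> j; apply: integrable_sum_fin.
rewrite /fejer_sum invfM !mulrA divff ?gt_eqF// mul1r; congr (_ * _).
apply: eq_bigr => j _; rewrite Rintegral_sum_fin//; apply: eq_bigr => l _.
rewrite RintegralD//; [|exact: RintegrableZl..].
by rewrite !RintegralZl// ghat_sin mulr0 addr0 mulrC.
Qed.

(** Approximate identity: the modulus bound of [gper_modulus] is integrated against the kernel of
    mass [covol a]. Its constant part gives e/2 and its cosine part at most C d / n, which [N] makes
    at most e/2. Uniformity in x allows expectations to be taken. *)
Lemma fejer_sum_cvg (e : R) : 0 < e -> exists N : nat, forall n x, (N <= n)%N ->
  `|fejer_sum n x - gper x| <= e.
Proof.
move=> e0; have V0 := covol_gt0 ba; have mD := measurable_fdomain ba.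
have [C [C0 HC]] := gper_modulus (divr_gt0 e0 (ltr0Sn R 1)).
pose N := (Num.truncn (2 * C * d%:R / e)).+1.
exists N => n x Nn.
have n0 : (0 < n)%N by exact: leq_trans Nn.
have nR : 0 < n%:R :> R by rewrite ltr0n.
have nE : C * d%:R / n%:R <= e / 2.
  have : 2 * C * d%:R / e < n%:R.
    by apply: lt_le_trans (truncnS_gt _) _; rewrite ler_nat.
  rewrite ltr_pdivrMr// ler_pdivrMr//; lra.
have mf := @measurable_fejer R d a n.
have fi (f : 'cV[R]_d -> R) K : measurable_fun setT f -> (forall y, `|f y| <= K) ->
    lam.-integrable D (EFin \o (fun y => f y * fejer a n y)).
  move=> mff fK; apply: (fdomain_integrable ba (K := K * n%:R ^+ d)).
    exact: measurable_funM.
  by move=> y; rewrite normrM ler_pM// fejer_le.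
have mgx : measurable_fun setT (fun y => gper (x + y)).
  by apply: (measurableT_comp measurable_gper); exact: measurable_cVD.
have gK y : `|gper y| <= Cg * count_bound rho by rewrite ger0_norm ?gper_le ?gper_ge0.
have i1 := fi _ _ mgx (fun y => gK (x + y)).
have i2 := fi (fun=> gper x) _ (measurable_cst _) (fun=> gK x).
have E : covol a * (fejer_sum n x - gper x) =
    \int[lam]_(y in D) ((gper (x + y) - gper x) * fejer a n y).
  under eq_Rintegral do rewrite mulrBl.
  rewrite RintegralB// fejer_conv// RintegralZl//; last first.
    have := fi (fun=> 1) 1 (measurable_cst _); under eq_fun do rewrite mul1r.
    by apply => y; rewrite normr1.
  by rewrite integral_fejer//; ring.
have mcos m : measurable_fun setT (fun y : 'cV[R]_d => 1 - cos (2 * pi * tcoord a m y)).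
  apply: measurable_funB => //.
  apply: (measurableT_comp (continuous_measurable_fun (@continuous_cos R))).
  by apply: measurable_funM => //; exact: measurable_tcoord.
have icos m : lam.-integrable D (EFin \o (fun y => fejer a n y * (1 - cos (2 * pi * tcoord a m y)))).
  have := fi _ 2 (mcos m); under eq_fun do rewrite mulrC; apply => y.
  by rewrite ler_norml; have := cos_max (2 * pi * tcoord a m y); rewrite ler_norml; lra.
have i0 : lam.-integrable D (EFin \o fejer a n).
  have := fi (fun=> 1) 1 (measurable_cst _); under eq_fun do rewrite mul1r.
  by apply => y; rewrite normr1.
have H : covol a * `|fejer_sum n x - gper x| <= covol a * e.
  rewrite -[X in X * _ <= _](gtr0_norm V0) -normrM E.
  have i3 : lam.-integrable D (EFin \o (fun y => (gper (x + y) - gper x) * fejer a n y)).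
    by under eq_fun do rewrite mulrBl; exact: RintegrableB.
  apply: le_trans (le_normr_Rintegral mD i3) _.
  apply: (@le_trans _ _ (\int[lam]_(y in D) (e / 2 * fejer a n y +
      C * \sum_m (fejer a n y * (1 - cos (2 * pi * tcoord a m y)))))).
    apply: le_Rintegral => //.
    - exact: (integrable_norm i3).
    - apply: RintegrableD => //; first exact: RintegrableZl.
      by apply: RintegrableZl => //; exact: integrable_sum_fin.
    move=> y _; rewrite normrM (ger0_norm (fejer_ge0 a n y)).
    rewrite -mulr_sumr [leRHS](_ : _ = (e / 2 + C * \sum_m (1 - cos (2 * pi * tcoord a m y))) * fejer a n y); last by ring.
    by rewrite ler_wpM2r ?fejer_ge0//; exact: HC.
  rewrite RintegralD//; first last.
    - by apply: RintegrableZl => //; exact: integrable_sum_fin.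
    - exact: RintegrableZl.
  have -> : \int[lam]_(y in D) (e / 2 * fejer a n y) = e / 2 * \int[lam]_(y in D) fejer a n y by rewrite RintegralZl.
  rewrite RintegralZl//; last exact: integrable_sum_fin.
  rewrite integral_fejer// Rintegral_sum_fin//.
  have S : \sum_m \int[lam]_(y in D) (fejer a n y * (1 - cos (2 * pi * tcoord a m y))) <= d%:R * (covol a / n%:R).
    apply: (@le_trans _ _ (\sum_(m < d) covol a / n%:R)).
      by apply: ler_sum => m _; exact: integral_fejer_coord.
    by rewrite sumr_const card_ord -[leLHS]mulr_natl.
  have := ler_wpM2l C0 S; have := ler_wpM2l (ltW V0) nE; lra.
by rewrite ler_pM2l in H.
Qed.

End fejer_approximation.

(** * The covariogram of the ball *)

Section covariogram.
Context {R : realType} {n : nat}.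
Local Notation lam := (@lebesgue_cV R n).
Local Notation B := (@closed_eball R n).
Implicit Types (x y u : 'cV[R]_n) (r s : R).

Definition covg r x : R := \int[lam]_y (\1_(B r) y * \1_(B r) (y + x)).

Lemma measurable_ind_ball d (T : measurableType d) r (f : T -> 'cV[R]_n) :
  measurable_fun setT f -> measurable_fun setT (fun w => \1_(B r) (f w) : R).
Proof.
move=> mf; have mI : measurable_fun setT (\1_(B r) : 'cV[R]_n -> R).
  by apply: measurable_indic; exact: measurable_closed_eball.
exact: (measurableT_comp mI mf).
Qed.

Lemma Rintegral_ind_ball r : \int[lam]_y \1_(B r) y = @vol R n r.
Proof.
rewrite /Rintegral integral_indic ?setIT//; exact: measurable_closed_eball.
Qed.

Lemma ind_ball_integrable r : lam.-integrable setT (EFin \o (\1_(B r) : 'cV[R]_n -> R)).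
Proof.
apply: (@bsupp_integrable R n _ 1 r).
  by apply: measurable_indic; exact: measurable_closed_eball.
by move=> x; rewrite mul1r ger0_norm.
Qed.

Lemma ind_ballD_integrable r x :
  lam.-integrable setT (EFin \o (fun y => \1_(B r) (y + x) : R)).
Proof. exact: (integrable_cVD x (ind_ball_integrable r)). Qed.

Let mcov r x : measurable_fun setT (fun y => \1_(B r) y * \1_(B r) (y + x) : R).
Proof.
apply: measurable_funM; apply: measurable_ind_ball => //; exact: measurable_cVD.
Qed.

Lemma covg_integrable r x :
  lam.-integrable setT (EFin \o (fun y => \1_(B r) y * \1_(B r) (y + x) : R)).
Proof.
apply: (@bsupp_integrable R n _ 1 r) => // y; rewrite mul1r ger0_norm ?mulr_ge0//.
by rewrite ler_piMr// indicE; case: (_ \in _).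
Qed.

Lemma covgE r x : (\int[lam]_y (\1_(B r) y * \1_(B r) (y + x)%R)%:E)%E = (covg r x)%:E.
Proof. by rewrite /covg /Rintegral fineK//; exact: (integrable_fin_num measurableT (covg_integrable r x)). Qed.

Lemma covg_ge0 r x : 0 <= covg r x.
Proof. by apply: Rintegral_ge0 => y _; rewrite mulr_ge0. Qed.

Lemma covg_le r x : covg r x <= @vol R n r.
Proof.
rewrite -Rintegral_ind_ball; apply: le_Rintegral => //.
- exact: covg_integrable.
- exact: ind_ball_integrable.
by move=> y _; rewrite ler_piMr// indicE; case: (_ \in _).
Qed.

Lemma covg0 r : covg r 0 = @vol R n r.
Proof.
rewrite -Rintegral_ind_ball /covg; apply: eq_Rintegral => y _.
by rewrite addr0 indicE; case: (_ \in _); rewrite ?mulr1 ?mulr0.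
Qed.

Lemma covgN r x : covg r (- x) = covg r x.
Proof.
rewrite /covg -(Rintegral_cVD (- x) (mcov r x)); apply: eq_Rintegral => y _.
by rewrite subrK mulrC.
Qed.

Lemma covg_supp r x : 2 * r < enorm x -> covg r x = 0.
Proof.
move=> rx; rewrite /covg (_ : (fun y => _) = cst 0) ?Rintegral_cst ?mul0r//.
apply/funext => y; rewrite !indicE !closed_eballE /cst.
case: (leP (enorm y) r) => yr; last by rewrite mul0r.
case: (leP (enorm (y + x)) r) => yxr; last by rewrite mulr0.
have := enormB (y + x) y; rewrite addrC addKr; lra.
Qed.

Lemma measurable_covg r : measurable_fun setT (covg r).
Proof.
have mF : measurable_fun setT (fun z : 'cV[R]_n * 'cV[R]_n => (\1_(B r) z.2 * \1_(B r) (z.2 + z.1) : R)%:E).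
  apply/measurable_EFinP; apply: measurable_funM; apply: measurable_ind_ball => //.
  exact: measurable_cVD.
have mG := measurable_fun_fubini_tonelli_F (m2 := lam) _ mF (fun z => _).
apply: (measurableT_comp (@fine_measurable _ _ measurableT)).
by apply: mG => z; rewrite lee_fin mulr_ge0.
Qed.

(** The first summand serves shifts of length at most r, through the volume of a shell; the second
    serves longer ones, where the covariogram is bounded by the volume of the ball. *)
Definition covg_lip : R := n%:R * 2 ^+ n * @vol R n 1 + @vol R n 1.

Lemma covg_lipschitz r x (s : 'cV[R]_n) : (0 < n)%N -> 0 < r ->
  `|covg r (x + s) - covg r x| <= covg_lip * r ^+ n.-1 * enorm s.
Proof.
move=> n0 r0; have v1 : 0 <= @vol R n 1 by exact: vol_ge0.
have rn : 0 <= r ^+ n.-1 by rewrite exprn_ge0// ltW.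
have s0 := enorm_ge0 s.
have [sr|rs] := leP (enorm s) r; last first.
  apply: (@le_trans _ _ (@vol R n r)).
    rewrite ler_norml; have := covg_ge0 r x; have := covg_ge0 r (x + s).
    have := covg_le r x; have := covg_le r (x + s); lra.
  rewrite volZ// -{1}(prednK n0) exprS.
  rewrite [leLHS](_ : _ = @vol R n 1 * r ^+ n.-1 * r); last by ring.
  apply: ler_pM; rewrite ?(ltW r0) ?(ltW rs) ?mulr_ge0//.
  by rewrite ler_wpM2r// /covg_lip lerDr !mulr_ge0// exprn_ge0.
rewrite -RintegralB//; [|exact: covg_integrable..].
have I1 := RintegrableB measurableT (covg_integrable r (x + s)) (covg_integrable r x).
apply: le_trans (le_normr_Rintegral measurableT I1) _.
(* If [y] or [y + s] is in the ball of radius r, then [y] is in the ball of radius r + |s|. Hence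
   [h] dominates the difference of the two indicators, and its integral is twice the volume of a
   shell. *)
pose h y : R := 2 * \1_(B (r + enorm s)) y - \1_(B r) y - \1_(B r) (y + s).
have hi : lam.-integrable setT (EFin \o h).
  apply: RintegrableB => //; last exact: ind_ballD_integrable.
  by apply: RintegrableB => //; [apply: RintegrableZl => //|]; exact: ind_ball_integrable.
have mh : measurable_fun setT h.
  by have /integrableP[/measurable_EFinP] := hi.
apply: (@le_trans _ _ (\int[lam]_y h (y + x))).
  apply: le_Rintegral => //.
  - exact: (integrable_norm I1).
  - exact: (integrable_cVD x hi).
  move=> y _; rewrite -mulrBr normrM ger0_norm// /h -(addrA y x s) !indicE !closed_eballE.
  have t := enormD (y + x) s; rewrite -addrA in t.
  have t' := enormB (y + (x + s)) s; rewrite addrA addrK in t'.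
  rewrite -addrA in t'.
  case: (leP (enorm y) r) => _; case: (leP (enorm (y + x)) r) => y1;
    case: (leP (enorm (y + (x + s))) r) => y2; case: (leP (enorm (y + x)) (r + enorm s)) => y3;
    rewrite /=; rewrite ?subrr ?sub0r ?subr0 ?normrN ?normr0 ?normr1; lra.
rewrite (Rintegral_cVD x mh) /h.
rewrite RintegralB//; last exact: ind_ballD_integrable; last first.
  apply: RintegrableB => //; [apply: RintegrableZl => //|]; exact: ind_ball_integrable.
rewrite RintegralB//; last exact: ind_ball_integrable; last first.
  apply: RintegrableZl => //; exact: ind_ball_integrable.
rewrite RintegralZl//; last exact: ind_ball_integrable.
rewrite (Rintegral_cVD s (f := \1_(B r))); last exact: measurable_ind_ball.
rewrite !Rintegral_ind_ball.
have := @vol_diff_le R n r (enorm s) r0; rewrite s0 sr => /(_ isT).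
rewrite exprMn => H.
apply: (@le_trans _ _ (2 * (n%:R * (2 ^+ n.-1 * r ^+ n.-1) * enorm s * @vol R n 1))); first by lra.
rewrite [leLHS](_ : _ = n%:R * (2 * 2 ^+ n.-1) * @vol R n 1 * (r ^+ n.-1 * enorm s)); last by ring.
rewrite -exprS prednK// -[leRHS]mulrA ler_wpM2r ?mulr_ge0// /covg_lip lerDl//.
Qed.

(** Fubini and the substitution x -> x - y separate the two indicators; in the expansion of cos(u.x
    - u.y) the sine term integrates to zero because the ball is symmetric. *)
Lemma ghat_covg r u : ghat (covg r) u = (\int[lam]_(y in B r) cos (dot u y)) ^+ 2.
Proof.
pose F (z : 'cV[R]_n * 'cV[R]_n) : R := \1_(B r) z.2 * \1_(B r) (z.2 + z.1) * cos (dot u z.1).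
have mF : measurable_fun setT F.
  apply: measurable_funM.
    apply: measurable_funM; apply: measurable_ind_ball => //; exact: measurable_cVD.
  exact: (measurableT_comp (@measurable_cos_dot R n u)).
have mFE : measurable_fun setT (EFin \o F) by exact/measurable_EFinP.
have FB x y : `|F (x, y)| <= \1_(B r) y * \1_(B (2 * r)) x.
  rewrite /F/= normrM ger0_norm ?mulr_ge0//.
  apply: (@le_trans _ _ (\1_(B r) y * \1_(B r) (y + x))).
    by rewrite ler_piMr ?mulr_ge0// cos_max.
  rewrite !indicE !closed_eballE.
  case: (leP (enorm y) r) => yr; last by rewrite !mul0r.
  case: (leP (enorm (y + x)) r) => yxr; last by rewrite mulr0 mul1r.
  case: (leP (enorm x) (2 * r)) => xr //.
  have := enormB (y + x) y; rewrite addrC addKr; lra.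
have iF : (lam \x lam)%E.-integrable setT (EFin \o F).
  apply/integrable12ltyP => //.
  apply: (@le_lt_trans _ _ (\int[lam]_x (\int[lam]_y (\1_(B r) y * \1_(B (2 * r)) x)%:E))%E).
    apply: ge0_le_integral => //.
    - by move=> x _; exact: integral_ge0.
    - apply: (measurable_fun_fubini_tonelli_F (m2 := lam) (fun z => `|(EFin \o F) z|%E)) => //.
      exact: measurableT_comp.
    - apply: (measurable_fun_fubini_tonelli_F (m2 := lam) (fun z => (\1_(B r) z.2 * \1_(B (2 * r)) z.1)%:E)) => //.
      by apply/measurable_EFinP; apply: measurable_funM; exact: measurable_ind_ball.
    - move=> x _; apply: ge0_le_integral => //.
      + by apply: measurableT_comp => //; apply: (measurableT_comp mFE).
      + by apply/measurable_EFinP; apply: measurable_funM => //; exact: measurable_ind_ball.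
      + by move=> y _; rewrite lee_fin FB.
  rewrite (_ : (fun x => _) = (fun x => (@vol R n r)%:E * (\1_(B (2 * r)) x)%:E)%E).
    rewrite ge0_integralZl//.
    - rewrite integral_indic ?setIT//; last exact: measurable_closed_eball.
      by rewrite [X in (_ * X)%E]volE -EFinM ltry.
    - by apply/measurable_EFinP; exact: measurable_ind_ball.
    - by rewrite lee_fin vol_ge0.
  apply/funext => x; under eq_integral do rewrite EFinM.
  rewrite ge0_integralZr//.
  - rewrite integral_indic ?setIT//; last exact: measurable_closed_eball.
    by rewrite [X in (X * _)%E]volE.
  - by apply/measurable_EFinP; exact: measurable_ind_ball.
have ic : lam.-integrable setT (EFin \o (fun y => \1_(B r) y * cos (dot u y))).
  apply: (@bsupp_integrable R n _ 1 r).
    by apply: measurable_funM; [exact: measurable_ind_ball|exact: measurable_cos_dot].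
  by move=> y; rewrite mul1r normrM ger0_norm// ler_piMr// cos_max.
have isn : lam.-integrable setT (EFin \o (fun y => \1_(B r) y * sin (dot u y))).
  apply: (@bsupp_integrable R n _ 1 r).
    by apply: measurable_funM; [exact: measurable_ind_ball|exact: measurable_sin_dot].
  by move=> y; rewrite mul1r normrM ger0_norm// ler_piMr// sin_max.
pose c := \int[lam]_y (\1_(B r) y * cos (dot u y)).
have s0 : \int[lam]_y (\1_(B r) y * sin (dot u y)) = 0.
  have ms : measurable_fun setT (fun y => \1_(B r) y * sin (dot u y)).
    by apply: measurable_funM; [exact: measurable_ind_ball|exact: measurable_sin_dot].
  have := Rintegral_cVN ms.
  rewrite (_ : \int[lam]_x (\1_(B r) (- x) * sin (dot u (- x))) = -1 * \int[lam]_y (\1_(B r) y * sin (dot u y))).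
    lra.
  rewrite -RintegralZl//; apply: eq_Rintegral => x _.
  by rewrite !indicE !closed_eballE enormN dotNr sinN; ring.
rewrite (Rintegral_ball (fun y => cos (dot u y))).
rewrite (_ : \int[lam]_x (cos (dot u x) * \1_(B r) x) = c); last first.
  by apply: eq_Rintegral => x _; rewrite mulrC.
have E1 x : (\int[lam]_y (F (x, y))%:E)%E = (covg r x * cos (dot u x))%:E.
  rewrite /F /=; under eq_integral do rewrite EFinM.
  rewrite integralZr//; last exact: covg_integrable.
  by rewrite covgE.
have E2 y : (\int[lam]_x (F (x, y))%:E)%E = (c * (\1_(B r) y * cos (dot u y)))%:E.
  have mG : measurable_fun setT (fun x => (F (x - y, y))%:E).
    apply/measurable_EFinP; apply: (measurableT_comp mF).
    by apply: measurable_fun_pair => //; exact: measurable_cVB.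
  rewrite -(integral_cVD (- y)); last first.
    by apply/measurable_EFinP; apply: (measurableT_comp mF).
  rewrite (_ : (fun x => _) = (EFin \o (fun x => (\1_(B r) y * cos (dot u y)) * (\1_(B r) x * cos (dot u x)) + (\1_(B r) y * sin (dot u y)) * (\1_(B r) x * sin (dot u x))))).
    have i2 := RintegrableD measurableT (RintegrableZl measurableT (\1_(B r) y * cos (dot u y)) ic)
      (RintegrableZl measurableT (\1_(B r) y * sin (dot u y)) isn).
    rewrite -[LHS]fineK; last exact: (integrable_fin_num measurableT i2).
    rewrite -/(Rintegral _ _ _) RintegralD//; [|exact: RintegrableZl..].
    by rewrite !RintegralZl// s0 mulr0 addr0 mulrC.
  by apply/funext => x; rewrite /F/= (addrC y) subrK dotBr cosB; congr (_%:E); ring.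
have := Fubini iF; rewrite /=.
under eq_integral do rewrite E1.
under [X in _ = X]eq_integral do rewrite E2.
rewrite -/(Rintegral _ _ _) => /(congr1 fine) H.
rewrite /ghat /Rintegral H -/(Rintegral _ _ _) RintegralZl// expr2.
Qed.

Lemma ghat_covg_ge0 r u : 0 <= ghat (covg r) u.
Proof. by rewrite ghat_covg sqr_ge0. Qed.

End covariogram.

(** * Normal laws *)

Section normal_fourier.
Context {R : realType}.
Local Notation leb := (@lebesgue_measure R).

Lemma is_derive_continuous (F f : R -> R) :
  (forall x, is_derive x (1:R) F (f x)) -> continuous F.
Proof.
move=> dF x; apply: differentiable_continuous; apply/derivable1_diffP.
exact: (@ex_derive _ _ _ _ _ _ _ (dF x)).
Qed.

(** The fundamental theorem on [m - k, m + k] leaves boundary values of size C / k. It provides the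
    integration by parts in [ibp]. *)
Lemma Rintegral_derive_eq0 (F f : R -> R) (m C : R) :
  (forall x, is_derive x (1:R) F (f x)) -> continuous f ->
  leb.-integrable setT (EFin \o f) -> (forall x, `|F x| * `|x - m| <= C) ->
  \int[leb]_x f x = 0.
Proof.
move=> dF cf fi FC.
have mf : measurable_fun setT f by exact: continuous_measurable_fun.
pose I (k : nat) : set R := `[m - k.+1%:R, m + k.+1%:R]%classic.
have mI k : measurable (I k) by exact: measurable_itv.
have Ik k : (\int[leb]_x (f x * \1_(I k) x)%:E = (F (m + k.+1%:R) - F (m - k.+1%:R))%:E)%E.
  rewrite EFinB -(@continuous_FTC2 _ f F).
  - rewrite [RHS]integral_mkcond; apply: eq_integral => x _.
    by rewrite patchE indicE /I; case: ifP => xI; rewrite ?mulr1 ?mulr0.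
  - by rewrite ltrD2l gtrN.
  - exact: continuous_subspaceT.
  - split; first by move=> x _; exact: (@ex_derive _ _ _ _ _ _ _ (dF x)).
    + by apply: cvg_at_right_filter; exact: (is_derive_continuous dF).
    + by apply: cvg_at_left_filter; exact: (is_derive_continuous dF).
  - by move=> x _; rewrite derive1E; exact: (@derive_val _ _ _ _ _ _ _ (dF x)).
have F0 k (s : R) : `|s| = 1 -> `|F (m + s * k.+1%:R)| <= C * harmonic k.
  move=> s1; rewrite /= ler_pdivlMr//; have := FC (m + s * k.+1%:R).
  by rewrite addrAC subrr add0r normrM s1 mul1r ger0_norm.
have dF0 : (fun k => F (m + k.+1%:R) - F (m - k.+1%:R)) @ \oo --> (0 : R).
  apply: norm_cvg0; apply: (@squeeze_cvgr _ _ _ _ (fun=> 0) (fun k => (2 * C) * harmonic k)).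
  - near=> k; rewrite normr_ge0/=.
    have h1 := F0 k 1 (normr1 _); have h2 := F0 k (-1) (normrN1 _).
    rewrite mul1r in h1; rewrite mulN1r in h2; apply: le_trans (ler_normB _ _) _.
    by rewrite -[2 * C * _]mulrA mulr_natl mulr2n lerD.
  - exact: cvg_cst.
  - by rewrite -[X in _ --> X](mulr0 (2 * C)); apply: cvgMr; exact: cvg_harmonic.
pose fk k x := (f x * \1_(I k) x)%:E.
have D1 k : measurable_fun setT (fk k).
  by apply/measurable_EFinP; apply: measurable_funM => //; exact: measurable_indic.
have D2 : measurable_fun setT (EFin \o f) by exact/measurable_EFinP.
have D3 : {ae leb, forall x, [set: R] x -> fk ^~ x @ \oo --> (EFin \o f) x}.
  apply: aeW => x _ /=; apply: cvg_near_cst.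
  near=> k; suff xI : I k x by rewrite /fk indicE mem_set// mulr1.
  rewrite /I/= in_itv/=; have : `|x - m| < k.+1%:R.
    near: k; exists (Num.truncn `|x - m|) => //= k kx.
    by apply: lt_le_trans (truncnS_gt _) _; rewrite ler_nat ltnS.
  by rewrite ltr_norml => /andP[]; lra.
have D4 : leb.-integrable setT (EFin \o (fun x => `|f x|)) by exact: (integrable_norm fi).
have D5 : {ae leb, forall x k, [set: R] x -> (`|fk k x| <= (EFin \o (fun x => `|f x|%R)) x)%E}.
  apply: aeW => x k _ /=; rewrite lee_fin normrM ler_piMr// indicE.
  by case: (_ \in _); rewrite ?normr1 ?normr0.
have [_ _ H] := dominated_convergence (mu := leb) measurableT D1 D2 D3 D4 D5.
have E : (\int[leb]_x (f x)%:E)%E = 0%E.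
  apply: (cvg_unique _ H) => //.
  have -> : (fun k => \int[leb]_x fk k x)%E = (fun k => (F (m + k.+1%:R) - F (m - k.+1%:R))%:E).
    by apply/funext => k; exact: Ik.
  by apply: cvg_EFin; [exact: nearW|].
by rewrite /Rintegral E.
Unshelve. all: by end_near.
Qed.

Variables (m s : R).
Hypothesis s0 : 0 < s.
Local Notation rho := (normal_pdf m s).

Let sn0 : s != 0. Proof. by rewrite gt_eqF. Qed.

(** Half the Gaussian exponent: the density is split into two equal exponential factors, one
    absorbing |x - m| and the other keeping integrability. *)
Let q x : R := (x - m) ^+ 2 / (4 * s ^+ 2).

Let rhoE x : rho x = normal_peak s * (expR (- q x) * expR (- q x)).
Proof.
rewrite (normal_pdfE _ sn0) /normal_fun -expRD /q; congr (_ * expR _).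
by field.
Qed.

Let q_ge0 x : 0 <= q x. Proof. by rewrite divr_ge0 ?sqr_ge0// mulr_ge0// sqr_ge0. Qed.

Let absB_le x : `|x - m| * expR (- q x) <= s.
Proof.
have h1 : 1 + q x <= expR (q x) := expR_ge1Dx _.
have h2 : `|x - m| <= s * (1 + q x).
  rewrite -subr_ge0 [X in 0 <= X](_ : _ = s * (`|x - m| / (2 * s) - 1) ^+ 2); first by rewrite mulr_ge0 ?sqr_ge0// ltW.
  rewrite /q -[(x - m) ^+ 2]real_normK ?num_real//; by field.
by rewrite expRN ler_pdivrMr ?expR_gt0// (le_trans h2)// ler_wpM2l// ltW.
Qed.

Let eq_le1 x : expR (- q x) <= 1.
Proof. by rewrite -expR0 ler_expR oppr_le0. Qed.

Let pk0 := normal_peak_ge0 s.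

Lemma normal_pdf_abs_le x : rho x * `|x - m| <= normal_peak s * s.
Proof.
rewrite rhoE -mulrA ler_wpM2l// -mulrA mulrC -mulrA.
have h := absB_le x; have e1 := eq_le1 x.
apply: le_trans h; by rewrite ler_piMl ?mulr_ge0 ?expR_ge0.
Qed.

Let absB_integrable : leb.-integrable setT (EFin \o (fun x => `|x - m| * rho x)).
Proof.
(* [expR (- q x)] has deviation sqrt 2 s; the Gaussian of deviation 2 s dominates it and avoids the
   root. *)
pose s2 : R := 2 * s.
have s20 : s2 != 0 by rewrite mulf_neq0// pnatr_eq0.
have mr : measurable_fun setT rho := measurable_normal_pdf m s.
have i2 : leb.-integrable setT (EFin \o (fun x => s * (normal_peak s * (normal_peak s2)^-1 * normal_pdf m s2 x))).
  by apply: RintegrableZl => //; apply: RintegrableZl => //; exact: integrable_normal_pdf.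
apply: (le_integrable measurableT _ _ i2).
  apply/measurable_EFinP; apply: measurable_funM => //.
  apply: (measurableT_comp (@normr_measurable R setT)); exact: measurable_funB.
move=> x _ /=; rewrite lee_fin ger0_norm ?mulr_ge0 ?normal_pdf_ge0//.
apply: le_trans (ler_norm _).
rewrite (normal_pdfE _ s20) -[_ / _ * _]mulrA mulKf ?gt_eqF ?normal_peak_gt0//.
rewrite rhoE mulrCA [leRHS]mulrCA ler_wpM2l// mulrA.
apply: ler_pM; [by rewrite mulr_ge0 ?expR_ge0|exact: expR_ge0|exact: absB_le|].
rewrite /normal_fun ler_expR /q /s2 exprMn -mulr_natr.
rewrite mulNr lerN2 ler_wpM2l ?sqr_ge0// lef_pV2 ?posrE ?mulrn_wgt0 ?mulr_gt0 ?exprn_gt0//.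
have : 0 < s ^+ 2 by rewrite exprn_gt0.
lra.
Qed.

Let rho_i : leb.-integrable setT (EFin \o rho).
Proof. exact: integrable_normal_pdf. Qed.

Let mrho : measurable_fun setT rho := measurable_normal_pdf m s.

Let mlin t c : measurable_fun setT (fun x : R => t * (x - m) + c).
Proof. by apply: measurable_funD => //; apply: measurable_funM => //; exact: measurable_funB. Qed.

Let mcos t c : measurable_fun setT (fun x : R => cos (t * (x - m) + c)).
Proof. exact: (measurableT_comp (continuous_measurable_fun (@continuous_cos R)) (mlin t c)). Qed.

Let msin t c : measurable_fun setT (fun x : R => sin (t * (x - m) + c)).
Proof. exact: (measurableT_comp (continuous_measurable_fun (@continuous_sin R)) (mlin t c)). Qed.

Let bnd_i (f : R -> R) : measurable_fun setT f -> (forall x, `|f x| <= 1) ->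
  leb.-integrable setT (EFin \o (fun x => f x * rho x)).
Proof.
move=> mf f1; apply: (le_integrable measurableT _ _ rho_i).
  by apply/measurable_EFinP; exact: measurable_funM.
by move=> x _ /=; rewrite lee_fin normrM ler_piMl.
Qed.

Let abs_i (f : R -> R) : measurable_fun setT f -> (forall x, `|f x| <= 1) ->
  leb.-integrable setT (EFin \o (fun x => ((x - m) * f x) * rho x)).
Proof.
move=> mf f1; apply: (le_integrable measurableT _ _ absB_integrable).
  apply/measurable_EFinP; apply: measurable_funM => //.
  by apply: measurable_funM => //; exact: measurable_funB.
move=> x _ /=; rewrite lee_fin !normrM normr_id -mulrA ler_wpM2l//.
by rewrite ler_piMl.
Qed.

Let drho x : is_derive x (1:R) rho (- (x - m) / s ^+ 2 * rho x).
Proof.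
rewrite (normal_pdfE _ sn0) /normal_fun.
apply: is_derive_eq; rewrite /GRing.scale/=; by field.
Qed.

Let ibp t c : t * \int[leb]_x (cos (t * (x - m) + c) * rho x) =
  (s ^+ 2)^-1 * \int[leb]_x (((x - m) * sin (t * (x - m) + c)) * rho x).
Proof.
have i1 := bnd_i (mcos t c) (fun=> cos_max _).
have i2 := abs_i (msin t c) (fun=> sin_max _).
pose f x := t * (cos (t * (x - m) + c) * rho x) - (s ^+ 2)^-1 * (((x - m) * sin (t * (x - m) + c)) * rho x).
have fi : leb.-integrable setT (EFin \o f).
  by apply: RintegrableB => //; exact: RintegrableZl.
have := @Rintegral_derive_eq0 (fun x => sin (t * (x - m) + c) * rho x) f m (normal_peak s * s) _ _ fi _.
rewrite /f RintegralB//; [|exact: RintegrableZl..].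
rewrite !RintegralZl// => H; apply/eqP; rewrite -subr_eq0; apply/eqP; apply: H.
- move=> x; have d := drho x.
  by apply: is_derive_eq; rewrite /GRing.scale/= /f; ring.
- have cr : continuous rho by exact: continuous_normal_pdf.
  have cl : continuous (fun x : R => t * (x - m) + c).
    by move=> x; apply: cvgD (cvg_cst _); apply: cvgMr; apply: cvgB (cvg_cst _); exact: cvg_id.
  move=> x; apply: cvgB; apply: cvgMr.
    apply: cvgM; last exact: cr.
    exact: (continuous_comp (cl x) (@continuous_cos R _)).
  apply: cvgM; last exact: cr.
  apply: cvgM; first by apply: cvgB (cvg_cst _); exact: cvg_id.
  exact: (continuous_comp (cl x) (@continuous_sin R _)).
- move=> x; rewrite normrM (ger0_norm (normal_pdf_ge0 _ _ _)) -mulrA.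
  apply: le_trans (normal_pdf_abs_le x).
  by rewrite ler_piMl ?sin_max// mulr_ge0// normal_pdf_ge0.
Qed.

Let ft c (t : R) : R := \int[leb]_x (cos (t * (x - m) + c) * rho x).

Let dft c t : is_derive t (1:R) (ft c) (- (s ^+ 2 * t) * ft c t).
Proof.
pose f (t : R) x := cos (t * (x - m) + c) * rho x.
have dd u x : is_derive u (1:R) (f ^~ x) (- (((x - m) * sin (u * (x - m) + c)) * rho x)).
  by apply: is_derive_eq; rewrite /GRing.scale/=; ring.
have E u x : partial1of2 f u x = - (((x - m) * sin (u * (x - m) + c)) * rho x).
  by rewrite partial1of2E (@derive_val _ _ _ _ _ _ _ (dd u x)).
have It : `]t - 1, t + 1[%classic t by rewrite /= in_itv/=; apply/andP; split; lra.
have fint u : `]t - 1, t + 1[%classic u -> leb.-integrable setT (EFin \o f u).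
  by move=> _; apply: bnd_i => // x; exact: cos_max.
have fder u x : `]t - 1, t + 1[%classic u -> [set: R] x -> derivable (f ^~ x) u 1.
  by move=> _ _; exact: (@ex_derive _ _ _ _ _ _ _ (dd u x)).
have G0 x : 0 <= `|x - m| * rho x by rewrite mulr_ge0 ?normal_pdf_ge0.
have Gub u x : `]t - 1, t + 1[%classic u -> [set: R] x -> `|partial1of2 f u x| <= `|x - m| * rho x.
  move=> _ _; rewrite E normrN !normrM (ger0_norm (normal_pdf_ge0 _ _ _)).
  by rewrite ler_wpM2r ?normal_pdf_ge0// ler_piMr// sin_max.
apply: DeriveDef.
  exact: (derivable_under_integral measurableT It fint fder G0 absB_integrable Gub).
rewrite -derive1E (differentiation_under_integral measurableT It fint fder G0 absB_integrable Gub).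
transitivity (- 1 * \int[leb]_x (((x - m) * sin (t * (x - m) + c)) * rho x)).
  rewrite -RintegralZl//; last by apply: abs_i => // x; exact: sin_max.
  by apply: eq_Rintegral => x _; rewrite E mulN1r.
have := ibp t c; rewrite -/(ft c t) => H.
rewrite [RHS](_ : _ = - (s ^+ 2 * (t * ft c t))); last by ring.
by rewrite H mulrA divff ?mul1r ?mulN1r// expf_neq0.
Qed.

(** By [dft], which combines differentiation under the integral with [ibp], the transform solves f'
    = - s^2 t f; multiplied by exp(s^2 t^2 / 2) it is constant. The phase c yields cosine and sine
    transforms at once. *)
Lemma normal_pdf_cos c t :
  \int[leb]_x (cos (t * (x - m) + c) * rho x) = cos c * expR (- (s ^+ 2 * t ^+ 2 / 2)).
Proof.
pose h (t : R) := ft c t * expR (s ^+ 2 / 2 * (t * t)).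
have dh u : is_derive u (1:R) h 0.
  have d := dft c u.
  by apply: is_derive_eq; rewrite /GRing.scale/=; field.
have := is_derive_0_is_cst t 0 dh; rewrite /h mulr0 mulr0 expR0 mulr1 => H.
have F0 : ft c 0 = cos c.
  rewrite /ft (_ : (fun x => _) = (fun x => cos c * rho x)); last first.
    by apply/funext => x; rewrite mul0r add0r.
  by rewrite RintegralZl// /Rintegral integral_normal_pdf mulr1.
rewrite -/(ft c t) expRN -F0 -H.
rewrite (_ : s ^+ 2 * t ^+ 2 / 2 = s ^+ 2 / 2 * (t * t)); last by ring.
by rewrite mulfK// gt_eqF// expR_gt0.
Qed.

(** The passage from the measure to its density goes through the Radon-Nikodym derivative, which
    agrees with [normal_pdf] almost everywhere because both have the same integrals over measurable
    sets. *)
Lemma integral_normal_prob (f : R -> R) (K : R) : measurable_fun setT f ->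
  (forall x, `|f x| <= K) ->
  (\int[normal_prob m s]_x (f x)%:E = \int[leb]_x (f x * rho x)%:E)%E.
Proof.
move=> mf fK.
have dom := normal_prob_dominates m s.
have fi : (normal_prob m s).-integrable setT (EFin \o f).
  apply: (@le_integrable _ _ _ _ _ measurableT _ (EFin \o cst K)).
  - exact/measurable_EFinP.
  - by move=> x _ /=; rewrite lee_fin (le_trans (fK x))// ler_norm.
  - exact: finite_measure_integrable_cst.
have iRN := @Radon_Nikodym_integrable _ _ R (charge_of_finite_measure (normal_prob m s)) leb dom.
rewrite -(Radon_Nikodym_change_of_variables dom measurableT fi).
under [RHS]eq_integral do rewrite EFinM.
apply: ae_eq_integral => //.
- by apply: emeasurable_funM; [exact/measurable_EFinP|exact: (measurable_int leb iRN)].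
- by apply: emeasurable_funM; exact/measurable_EFinP.
- apply: ae_eqe_mul2l => /=.
  rewrite (@Radon_NikodymE _ _ R (charge_of_finite_measure (normal_prob m s)) leb dom)/=.
  case: cid => /= h [h1 h2 h3].
  apply: integral_ae_eq => //=.
  - exact/measurable_EFinP.
  by move=> A _ mA; rewrite -h3.
Qed.

End normal_fourier.

Section dominated.
Context {R : realType} d (T : measurableType d) (mu : {measure set T -> \bar R}).

Lemma Rintegral_dominated_cvg (f_ : nat -> T -> R) (f G : T -> R) :
  (forall k, measurable_fun setT (f_ k)) -> measurable_fun setT f ->
  mu.-integrable setT (EFin \o G) ->
  (forall x, f_ ^~ x @ \oo --> f x) -> (forall k x, `|f_ k x| <= G x) ->
  mu.-integrable setT (EFin \o f) /\
  (fun k => \int[mu]_x f_ k x) @ \oo --> \int[mu]_x f x.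
Proof.
move=> mf_ mf Gi ff fG.
have D1 k : measurable_fun setT (EFin \o f_ k) by exact/measurable_EFinP.
have D2 : measurable_fun setT (EFin \o f) by exact/measurable_EFinP.
have D3 : {ae mu, forall x, [set: T] x -> (fun k => (EFin \o f_ k) x) @ \oo --> (EFin \o f) x}.
  by apply: aeW => x _; apply: cvg_EFin; [exact: nearW|exact: ff].
have D5 : {ae mu, forall x k, [set: T] x -> (`|(EFin \o f_ k) x| <= (EFin \o G) x)%E}.
  by apply: aeW => x k _; rewrite /= lee_fin.
have [fi _ H] := dominated_convergence (mu := mu) measurableT D1 D2 D3 Gi D5.
split => //; apply: fine_cvg; rewrite /Rintegral fineK//.
exact: (integrable_fin_num measurableT fi).
Qed.

End dominated.

Section exp_estimates.
Context {R : realType}.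

Lemma onem_expRN_ge (b : R) : 0 <= b -> b / (1 + b) <= 1 - expR (- b).
Proof.
move=> b0; have b1 : 0 < 1 + b by rewrite ltr_wpDr.
rewrite expRN; have h := expR_ge1Dx b.
have : (expR b)^-1 <= (1 + b)^-1 by rewrite lef_pV2// posrE expR_gt0.
have -> : b / (1 + b) = 1 - (1 + b)^-1 by field; rewrite gt_eqF.
by lra.
Qed.

Lemma expRN_lip (a b : R) : a <= b -> `|expR (- a) - expR (- b)| <= (b - a) * expR (- a).
Proof.
move=> ab; rewrite ger0_norm ?subr_ge0 ?ler_expR ?lerN2//.
have -> : expR (- b) = expR (- a) * expR (a - b) by rewrite -expRD; congr expR; ring.
have := expR_ge1Dx (a - b); have := expR_gt0 (- a); nra.
Qed.

(** A relative error e on the exponent costs O(e) times 1 - exp(-b), with no loss as b tends to 0.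
    For b <= 1 the mean value bound e b is compared with b/2; for b > 1 one has 1 - exp(-b) >= 1/2,
    and either e > 1/2 and the difference is at most 1, or a >= b/2 and b exp(-b/2) <= 2. *)
Lemma expRN_compare (a b e : R) : 0 <= a -> 0 <= b -> `|a - b| <= e * b ->
  `|expR (- a) - expR (- b)| <= 4 * e * (1 - expR (- b)).
Proof.
move=> a0 b0 abe; have [bE|bn0] := eqVneq b 0.
  move: abe; rewrite bE mulr0 subr0 normr_le0 => /eqP ->.
  by rewrite oppr0 expR0 subrr normr0 mulr0.
have {}b0 : 0 < b by rewrite lt_neqAle eq_sym bn0.
have e0 : 0 <= e by rewrite -(pmulr_lge0 _ b0); exact: le_trans (normr_ge0 _) abe.
have ea : expR (- a) <= 1 by rewrite -expR0 ler_expR oppr_le0.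
have eb : expR (- b) <= 1 by rewrite -expR0 ler_expR oppr_le0 ltW.
have ea0 := expR_gt0 (- a); have eb0 := expR_gt0 (- b).
have L : `|expR (- a) - expR (- b)| <= `|a - b| * Num.max (expR (- a)) (expR (- b)).
  have [ab|ba] := leP a b.
    apply: le_trans (expRN_lip ab) _; rewrite distrC ger0_norm ?subr_ge0// ler_wpM2l ?subr_ge0//.
    by rewrite le_max lexx.
  rewrite distrC; apply: le_trans (expRN_lip (ltW ba)) _.
  by rewrite ger0_norm ?subr_ge0 ?(ltW ba)// ler_wpM2l ?subr_ge0 ?(ltW ba)// le_max lexx orbT.
have h := onem_expRN_ge (ltW b0).
have m1 : Num.max (expR (- a)) (expR (- b)) <= 1 by rewrite ge_max ea.
have [b1|b1] := leP b 1.
  have h2 : b / 2 <= 1 - expR (- b).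
    by apply: le_trans h; rewrite ler_wpM2l ?(ltW b0)// lef_pV2 ?posrE; lra.
  have h3 : `|a - b| * Num.max (expR (- a)) (expR (- b)) <= e * b.
    by apply: le_trans abe; rewrite ler_piMr.
  have h4 := ler_wpM2l e0 h2; nra.
have h2 : 2^-1 <= 1 - expR (- b).
  apply: le_trans h; rewrite ler_pdivlMr; nra.
have [e1|e1] := leP e 2^-1; last first.
  by apply: (@le_trans _ _ 1); [rewrite ler_norml; lra|nra].
have ab2 : b / 2 <= a by move: abe; rewrite ler_norml => /andP[]; nra.
have mb : Num.max (expR (- a)) (expR (- b)) <= expR (- (b / 2)).
  by rewrite ge_max !ler_expR !lerN2; apply/andP; split; lra.
have b2 : b / 2 * expR (- (b / 2)) <= 1.
  rewrite expRN ler_pdivrMr ?expR_gt0// mul1r; have := expR_ge1Dx (b / 2); lra.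
have h3 : `|a - b| * Num.max (expR (- a)) (expR (- b)) <= (e * b) * expR (- (b / 2)).
  by apply: ler_pM.
have h4 := ler_wpM2l e0 b2; have h5 := ler_wpM2l e0 h2; lra.
Qed.

End exp_estimates.

(** * Moments of a normal variable from its characteristic function *)

Section normal_variables.
Context {R : realType} {dT : measure_display} {T : measurableType dT}.
Variable P : probability T R.

Lemma bounded_integrable (f : T -> R) K : measurable_fun setT f ->
  (forall w, `|f w| <= K) -> P.-integrable setT (EFin \o f).
Proof.
move=> mf fK; apply: (@le_integrable _ _ _ _ _ measurableT _ (EFin \o cst K)).
- exact/measurable_EFinP.
- by move=> x _ /=; rewrite lee_fin (le_trans (fK x))// ler_norm.
- exact: finite_measure_integrable_cst.
Qed.

Lemma Rintegral_P_cst (c : R) : \int[P]_w c = c.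
Proof. by rewrite Rintegral_cst// [X in fine X](_ : _ = 1%E) ?mulr1//; exact: probability_setT. Qed.

Variables (X : T -> R) (m v : R).
Hypothesis mX : measurable_fun setT X.
Hypothesis v0 : 0 <= v.
Hypothesis Xlaw : normal_law P X m v.

Lemma normal_law_cos c t :
  \int[P]_w cos (t * (X w - m) + c) = cos c * expR (- (v * t ^+ 2 / 2)).
Proof.
pose f (x : R) := cos (t * (x - m) + c).
have mf : measurable_fun setT f.
  apply: (measurableT_comp (continuous_measurable_fun (@continuous_cos R))).
  by apply: measurable_funD => //; apply: measurable_funM => //; exact: measurable_funB.
have mfE : measurable_fun setT (EFin \o f) by exact/measurable_EFinP.
have E1 : (\int[P]_w (f (X w))%:E = \int[pushforward P X]_x (f x)%:E)%E.
  rewrite (integral_pushforward mX mfE)// preimage_setT.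
  apply: (@bounded_integrable (f \o X) 1); first exact: (measurableT_comp mf).
  by move=> w; exact: cos_max.
(* A degenerate law is a point mass, without density, and is treated apart. *)
have [vE|vn0] := eqVneq v 0.
  have E2 : (\int[pushforward P X]_x (f x)%:E = \int[\d_m]_x (f x)%:E)%E.
    by apply: eq_measure_integral => A mA _; have := Xlaw mA; rewrite vE eqxx.
  have E3 : (\int[\d_m]_x (f x)%:E = (f m)%:E)%E.
    by rewrite integral_dirac// diracE mem_set// mul1e.
  rewrite /Rintegral E1 E2 E3 /f subrr mulr0 add0r.
  by rewrite vE mul0r mul0r oppr0 expR0 mulr1.
have vgt0 : 0 < Num.sqrt v by rewrite sqrtr_gt0 lt_neqAle eq_sym vn0.
have E2 : (\int[pushforward P (X : T -> measurableTypeR R)]_x (f x)%:E = \int[normal_prob m (Num.sqrt v)]_x (f x)%:E)%E.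
  by apply: (eq_measure_integral (normal_prob m (Num.sqrt v))) => A mA _; have := Xlaw mA; rewrite (negbTE vn0).
have E12 : (\int[P]_w (f (X w))%:E = \int[normal_prob m (Num.sqrt v)]_x (f x)%:E)%E.
  rewrite -E2 (@integral_pushforward _ _ T (measurableTypeR R) R X mX P setT (EFin \o f) mfE)//.
  rewrite preimage_setT; apply: (@bounded_integrable (f \o X) 1); first exact: (measurableT_comp mf).
  by move=> w; exact: cos_max.
rewrite /Rintegral E12 (@integral_normal_prob R m (Num.sqrt v) f 1 mf); last by move=> x; exact: cos_max.
by rewrite -/(Rintegral _ _ _) (@normal_pdf_cos R m _ vgt0) sqr_sqrtr.
Qed.

Let Z w := X w - m.
Let mZ : measurable_fun setT Z. Proof. exact: measurable_funB. Qed.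

Let sin_seq (z : R) : (fun k => k.+1%:R * sin (z / k.+1%:R)) @ \oo --> z.
Proof.
have d : is_derive (0:R) (1:R) (fun t : R => sin (z * t)) z.
  by apply: is_derive_eq; rewrite /GRing.scale/= mulr0 cos0; ring.
have [dq Dq] := d; move: dq; rewrite /derivable => dq.
have {dq} : (fun t : R => t^-1 *: (sin (z * (t *: (1:R) + 0)) - sin (z * (0:R)))) @ 0^' --> z.
  by rewrite -[X in _ --> X]Dq.
move/cvgr_dnbhsP => /(_ harmonic).
have : (forall k, harmonic k != 0 :> R) /\ harmonic k @[k --> \oo] --> (0:R).
  by split=> [k|]; [rewrite /= gt_eqF|exact: cvg_harmonic].
move=> /[swap] /[apply]; apply: cvg_trans; apply: near_eq_cvg; apply: nearW => k.
by rewrite mulr0 sin0 subr0 addr0 /= /GRing.scale/= mulr1 invrK.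
Qed.

Let sin_le (y : R) : `|sin y| <= `|y|.
Proof. by have := lipschitz_sin y 0; rewrite sin0 !subr0. Qed.

(* h k = 2 (k+1)^2 (1 - cos (Z / (k+1))) has an explicit expectation and tends
   to Z^2 from below: moments are obtained without integrating the density. *)
Let h k w : R := (2 * k.+1%:R * sin (Z w / (2 * k.+1%:R))) ^+ 2.

Let mh k : measurable_fun setT (h k).
Proof.
apply: measurable_funX; apply: measurable_funM => //.
apply: (measurableT_comp (continuous_measurable_fun (@continuous_sin R))).
exact: measurable_funM.
Qed.

Let hZ k w : h k w <= Z w ^+ 2.
Proof.
have k0 : 0 < 2 * k.+1%:R :> R by rewrite mulr_gt0.
rewrite /h -(real_normK (num_real (Z w))) -(real_normK (num_real (_ * sin _))).
rewrite ler_pXn2r ?nnegrE// normrM gtr0_norm//.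
apply: le_trans (ler_wpM2l (ltW k0) (sin_le _)) _.
by rewrite normrM normfV (gtr0_norm k0) mulrCA divff ?mulr1// gt_eqF.
Qed.

Let hlim w : h ^~ w @ \oo --> Z w ^+ 2.
Proof.
rewrite (_ : h ^~ w = fun k => (2 * (k.+1%:R * sin (Z w / 2 / k.+1%:R))) ^+ 2); last first.
  apply/funext => k; rewrite /h mulrA; congr ((_ * sin _) ^+ 2).
  by rewrite invfM mulrA.
have -> : Z w ^+ 2 = (2 * (Z w / 2)) * (2 * (Z w / 2)) by field.
by under eq_fun do rewrite expr2; apply: cvgM; apply: cvgMr; exact: sin_seq.
Qed.

Let hE k : \int[P]_w h k w = 2 * k.+1%:R ^+ 2 * (1 - expR (- (v / (2 * k.+1%:R ^+ 2)))).
Proof.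
have E w : h k w = 2 * k.+1%:R ^+ 2 * (1 - cos (k.+1%:R^-1 * (X w - m) + 0)).
  rewrite addr0 /h exprMn.
  have -> : k.+1%:R^-1 * (X w - m) = (Z w / (2 * k.+1%:R)) *+ 2.
    by rewrite /Z -mulr_natl; field.
  rewrite cos_mulr2n cos2sin2; ring.
have mc : measurable_fun setT (fun w => cos (k.+1%:R^-1 * (X w - m) + 0)).
  apply: (measurableT_comp (continuous_measurable_fun (@continuous_cos R))).
  by apply: measurable_funD => //; apply: measurable_funM.
have ci : P.-integrable setT (EFin \o (fun w => cos (k.+1%:R^-1 * (X w - m) + 0))).
  by apply: (@bounded_integrable _ 1) => // w; exact: cos_max.
have oi : P.-integrable setT (EFin \o (fun w : T => 1 : R)).
  by apply: (@bounded_integrable _ 1) => // w; rewrite normr1.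
under eq_Rintegral do rewrite E.
rewrite RintegralZl//; last exact: RintegrableB.
rewrite RintegralB// Rintegral_P_cst normal_law_cos cos0 mul1r.
by congr (_ * (1 - expR (- _))); field.
Qed.

(** The explicit expectation lies between v / (1 + v / (2 (k+1)^2)) and v, by b / (1 + b) <= 1 -
    exp(-b) <= b. *)
Let h_cvg : (fun k => \int[P]_w h k w) @ \oo --> v.
Proof.
have -> : (fun k => \int[P]_w h k w) =
   (fun k => (2 * k.+1%:R ^+ 2) * (1 - expR (- (v / (2 * k.+1%:R ^+ 2))))).
  by apply/funext => k; exact: hE.
apply: (@squeeze_cvgr _ _ _ _ (fun k => v / (1 + v / 2 * (harmonic k * harmonic k))) (fun=> v)).
- near=> k.
  have k0 : 0 < 2 * k.+1%:R ^+ 2 :> R by rewrite mulr_gt0// exprn_gt0.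
  have k1 : k.+1%:R != 0 :> R by rewrite pnatr_eq0.
  have vk : 0 <= v / (2 * k.+1%:R ^+ 2) by rewrite divr_ge0// ltW.
  apply/andP; split.
    apply: le_trans (ler_wpM2l (ltW k0) (onem_expRN_ge vk)).
    rewrite le_eqVlt; apply/orP; left; apply/eqP; rewrite /=; field.
    have k4 : 1 + k%:R = k.+1%:R :> R by rewrite -natr1 addrC.
    by apply/andP; rewrite k4; split; [exact: k1|rewrite gt_eqF// ltr_wpDr].
  have := expR_ge1Dx (- (v / (2 * k.+1%:R ^+ 2))) => h1.
  by rewrite mulrC -ler_pdivlMr// lerBlDr -lerBlDl.
- rewrite -[X in _ --> X]divr1; apply: cvgM; first exact: cvg_cst.
  apply: cvgV => //; rewrite [X in _ --> X](_ : 1 = 1 + v / 2 * (0 * 0)); last by ring.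
  apply: cvgD; first exact: cvg_cst.
  by apply: cvgM; [exact: cvg_cst|apply: cvgM; exact: cvg_harmonic].
- exact: cvg_cst.
Unshelve. all: by end_near.
Qed.

Let mZ2 : measurable_fun setT (fun w => Z w ^+ 2).
Proof. exact: measurable_funX. Qed.

Let h_integrable k : P.-integrable setT (EFin \o h k).
Proof.
apply: (@bounded_integrable _ ((2 * k.+1%:R) ^+ 2)) => // w.
rewrite /h exprMn normrM ger0_norm ?sqr_ge0// ler_piMr ?sqr_ge0// normrX.
by rewrite exprn_ile1// sin_max.
Qed.

(** Fatou's lemma along [h]. Once the square is known to be integrable, it dominates [h] itself and
    [normal_law_sq] follows. *)
Lemma normal_law_sq_integrable : P.-integrable setT (EFin \o (fun w => (X w - m) ^+ 2)).
Proof.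
apply/integrableP; split; first exact/measurable_EFinP.
apply: (@le_lt_trans _ _ v%:E); last exact: ltry.
have F := @fatou _ _ R P setT measurableT (fun k w => (h k w)%:E).
have vE : limn_einf (fun k => \int[P]_w (h k w)%:E)%E = v%:E.
  have c : (fun k => \int[P]_w (h k w)%:E)%E @ \oo --> v%:E.
    have -> : (fun k => \int[P]_w (h k w)%:E)%E = (fun k => (\int[P]_w h k w)%:E).
      apply/funext => k; rewrite /Rintegral fineK//.
      exact: (integrable_fin_num measurableT (h_integrable k)).
    by apply: cvg_EFin; [exact: nearW|exact: h_cvg].
  by have [-> _] := cvg_limn_einf_sup c.
rewrite -vE; apply: le_trans (F _ _).
- rewrite le_eqVlt; apply/orP; left; apply/eqP; apply: eq_integral => w _.
  rewrite /= ger0_norm ?sqr_ge0//.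
  have c : (h k w)%:E @[k --> \oo] --> (Z w ^+ 2)%:E.
    by apply: cvg_EFin; [exact: nearW|exact: hlim].
  by have [-> _] := cvg_limn_einf_sup c.
- by move=> k; exact/measurable_EFinP.
- by move=> k w _; rewrite lee_fin sqr_ge0.
Qed.

Lemma normal_law_sq : \int[P]_w (X w - m) ^+ 2 = v.
Proof.
have hb k w : `|h k w| <= Z w ^+ 2 by rewrite ger0_norm ?sqr_ge0.
have [_ H] := Rintegral_dominated_cvg mh mZ2 normal_law_sq_integrable hlim hb.
by apply: (cvg_unique _ H) => //; exact: h_cvg.
Qed.

Lemma normal_law_mean : P.-integrable setT (EFin \o (fun w => X w - m)) /\
  \int[P]_w (X w - m) = 0.
Proof.
have oi : P.-integrable setT (EFin \o (fun w => 1 + Z w ^+ 2)).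
  apply: RintegrableD => //; last exact: normal_law_sq_integrable.
  by apply: (@bounded_integrable _ 1) => // w; rewrite normr1.
pose f k w : R := k.+1%:R * sin (Z w / k.+1%:R).
have mf k : measurable_fun setT (f k).
  apply: measurable_funM => //.
  apply: (measurableT_comp (continuous_measurable_fun (@continuous_sin R))).
  exact: measurable_funM.
have fZ k w : `|f k w| <= 1 + Z w ^+ 2.
  have k0 : 0 < k.+1%:R :> R by [].
  apply: (@le_trans _ _ `|Z w|).
    rewrite /f normrM gtr0_norm//.
    apply: le_trans (ler_wpM2l (ltW k0) (sin_le _)) _.
    by rewrite normrM normfV (gtr0_norm k0) mulrCA divff ?mulr1// gt_eqF.
  by rewrite -(real_normK (num_real (Z w))); have := normr_ge0 (Z w); nra.
have fl w : f ^~ w @ \oo --> Z w by exact: sin_seq.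
have [Zi H] := Rintegral_dominated_cvg mf mZ oi fl fZ.
split=> //; apply: (cvg_unique _ H) => //.
have -> : (fun k => \int[P]_w f k w) = (fun=> 0); last exact: cvg_cst.
apply/funext => k.
(* The phase -pi/2 turns the sine into a cosine whose expectation carries the factor cos(-pi/2) =
   0. *)
have E w : f k w = k.+1%:R * cos (k.+1%:R^-1 * (X w - m) + (- (pi / 2))).
  by rewrite /f cosB cos_pihalf sin_pihalf mulr0 add0r mulr1 [_^-1 * _]mulrC.
under eq_Rintegral do rewrite E.
rewrite RintegralZl//; last first.
  apply: (@bounded_integrable _ 1) => [|w]; last exact: cos_max.
  apply: (measurableT_comp (continuous_measurable_fun (@continuous_cos R))).
  by apply: measurable_funD => //; apply: measurable_funM.
by rewrite normal_law_cos cosN cos_pihalf mul0r mulr0.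
Qed.

End normal_variables.

(** * Comparison of expectations of positive definite functions *)

Section comparison.
Context {R : realType} {d : nat} {dT : measure_display} {T : measurableType dT}.
Variable P : probability T R.
Variable a : d.-tuple 'cV[R]_d.
Hypothesis ba : basis_of fullv a.
Local Notation lam := (@lebesgue_cV R d).
Local Notation Z := {ffun 'I_d -> int}.
Local Notation lp := (lpoint a).
Implicit Types (z : Z) (x y u l : 'cV[R]_d) (X Y : T -> 'cV[R]_d).

Lemma Rintegral_P_dist (f h : T -> R) (e : R) :
  P.-integrable setT (EFin \o f) -> P.-integrable setT (EFin \o h) ->
  (forall w, `|f w - h w| <= e) -> `|\int[P]_w f w - \int[P]_w h w| <= e.
Proof.
move=> fi hi fh; rewrite -RintegralB//.
have bi := RintegrableB measurableT fi hi.
apply: le_trans (le_normr_Rintegral measurableT bi) _.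
rewrite -[leRHS](Rintegral_P_cst P); apply: le_Rintegral => //.
- exact: (integrable_norm bi).
- by apply: (@bounded_integrable _ _ _ _ _ `|e|).
Qed.

(** Real part of e^(ic) times the characteristic function: the phase stands for the imaginary part
    and absorbs deterministic shifts of [X]. *)
Definition charE X u (c : R) : R := \int[P]_w cos (dot u (X w) + c).

Lemma measurable_cos_rv X u c : measurable_fun setT X ->
  measurable_fun setT (fun w => cos (dot u (X w) + c)).
Proof.
move=> mX; apply: (measurableT_comp (continuous_measurable_fun (@continuous_cos R))).
by apply: measurable_funD => //; exact: measurable_dot.
Qed.

Lemma cos_rv_integrable X u c : measurable_fun setT X ->
  P.-integrable setT (EFin \o (fun w => cos (dot u (X w) + c))).
Proof.
move=> mX; apply: (@bounded_integrable _ _ _ _ _ 1); first exact: measurable_cos_rv.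
by move=> w; exact: cos_max.
Qed.

Lemma fejer_sum_expectation g n X l : measurable_fun setT X ->
  P.-integrable setT (EFin \o (fun w => fejer_sum a g n (l + X w))) /\
  \int[P]_w fejer_sum a g n (l + X w) = (covol a * n%:R ^+ d)^-1 *
  \sum_(j : {ffun 'I_d -> 'I_n}) \sum_(k : {ffun 'I_d -> 'I_n})
    ghat g (freq a (boxpt j - boxpt k)) *
    charE X (freq a (boxpt j - boxpt k)) (dot (freq a (boxpt j - boxpt k)) l).
Proof.
move=> mX.
have E x w : cos (dot x (l + X w)) = cos (dot x (X w) + dot x l) by rewrite dotDr addrC.
have i1 (j k : {ffun 'I_d -> 'I_n}) : P.-integrable setT (EFin \o (fun w => ghat g (freq a (boxpt j - boxpt k)) *
    cos (dot (freq a (boxpt j - boxpt k)) (l + X w)))).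
  by apply: RintegrableZl => //; under eq_fun do rewrite E; exact: cos_rv_integrable.
have i2 (j : {ffun 'I_d -> 'I_n}) : P.-integrable setT (EFin \o (fun w => \sum_(k : {ffun 'I_d -> 'I_n}) ghat g (freq a (boxpt j - boxpt k)) *
    cos (dot (freq a (boxpt j - boxpt k)) (l + X w)))).
  exact: integrable_sum_fin.
split; first by apply: RintegrableZl => //; exact: integrable_sum_fin.
rewrite RintegralZl//; last exact: integrable_sum_fin.
rewrite Rintegral_sum_fin//; congr (_ * _); apply: eq_bigr => j _.
rewrite Rintegral_sum_fin//; apply: eq_bigr => k _.
under eq_Rintegral do rewrite E.
by rewrite RintegralZl//; exact: cos_rv_integrable.
Qed.

Section fixed_lattice.
Variables (g : 'cV[R]_d -> R) (rho Lam Cg : R).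
Hypothesis mg : measurable_fun setT g.
Hypothesis g_ge0 : forall x, 0 <= g x.
Hypothesis g_le : forall x, g x <= Cg.
Hypothesis g_supp : forall x, rho < enorm x -> g x = 0.
Hypothesis g_lip : forall x y, `|g (x + y) - g x| <= Lam * enorm y.
Hypothesis g_even : forall x, g (- x) = g x.
Hypothesis g_pos : forall u, 0 <= ghat g u.

Lemma gper_rv_integrable X l : measurable_fun setT X ->
  P.-integrable setT (EFin \o (fun w => gper a g (l + X w))).
Proof.
move=> mX; apply: (@bounded_integrable _ _ _ _ _ (Cg * count_bound a rho)).
  by apply: (measurableT_comp (measurable_gper a mg g_ge0)); exact: measurable_cVD.
move=> w; rewrite ger0_norm ?gper_ge0//; exact: (gper_le ba g_ge0 g_le g_supp).
Qed.

(** A Fejer sum has finitely many frequencies with weights [ghat] >= 0, so the hypothesis is applied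
    frequency by frequency, and the right-hand sides add up to the Fejer sum at 0 minus its
    expectation at [Y]. Uniform convergence carries this over to [gper]. *)
Lemma gper_compare (e : R) X Y l : 0 <= e ->
  measurable_fun setT X -> measurable_fun setT Y ->
  (forall u c, `|charE X u c - charE Y u c| <= e * (1 - charE Y u 0)) ->
  `|\int[P]_w gper a g (l + X w) - \int[P]_w gper a g (l + Y w)| <=
  e * (gper a g 0 - \int[P]_w gper a g (Y w)).
Proof.
move=> e0 mX mY XY; apply/ler_addgt0Pr => eps eps0.
(* Two replacements of a Fejer sum by its limit on the left, and two on the right, the latter
   multiplied by e. *)
have del0 : 0 < eps / (2 + 2 * e) by rewrite divr_gt0// ltr_pwDl// mulr_ge0.
have [N HN] := fejer_sum_cvg ba mg g_ge0 g_le g_supp g_lip g_even del0.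
set del := eps / _ in del0 HN.
have {}HN x : `|fejer_sum a g N x - gper a g x| <= del by exact: HN.
have [iSX ESX] := fejer_sum_expectation g N l mX.
have [iSY ESY] := fejer_sum_expectation g N l mY.
have [iS0 ES0] := fejer_sum_expectation g N 0 mY.
have giX := gper_rv_integrable l mX.
have giY := gper_rv_integrable l mY.
have gi0 := gper_rv_integrable 0 mY.
have dX := Rintegral_P_dist iSX giX (fun w => HN _).
have dY := Rintegral_P_dist iSY giY (fun w => HN _).
have d0 := Rintegral_P_dist iS0 gi0 (fun w => HN _).
have d00 := HN 0.
have E0 : \int[P]_w gper a g (0 + Y w) = \int[P]_w gper a g (Y w).
  by under eq_Rintegral do rewrite add0r.
rewrite E0 in d0.
have W0 : 0 <= (covol a * N%:R ^+ d)^-1.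
  by rewrite invr_ge0 mulr_ge0 ?exprn_ge0// ltW// covol_gt0.
have S : `|\int[P]_w fejer_sum a g N (l + X w) - \int[P]_w fejer_sum a g N (l + Y w)| <=
  e * (fejer_sum a g N 0 - \int[P]_w fejer_sum a g N (0 + Y w)).
  rewrite ESX ESY ES0 /fejer_sum -!mulrBr mulrCA normrM (ger0_norm W0) ler_wpM2l//.
  rewrite -!sumrB mulr_sumr; apply: le_trans (ler_norm_sum _ _ _) _; apply: ler_sum => j _.
  rewrite -!sumrB mulr_sumr; apply: le_trans (ler_norm_sum _ _ _) _; apply: ler_sum => k _.
  rewrite -!mulrBr normrM (ger0_norm (g_pos _)) dot0r cos0 mulrCA.
  by rewrite ler_wpM2l.
have delE : del * (2 + 2 * e) = eps.
  by rewrite /del divfK// gt_eqF// ltr_pwDl// mulr_ge0.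
have S2 : e * (fejer_sum a g N 0 - \int[P]_w fejer_sum a g N (0 + Y w)) <=
   e * (gper a g 0 - \int[P]_w gper a g (Y w) + 2 * del).
  by rewrite ler_wpM2l//; move: d0 d00; rewrite !ler_norml => /andP[? ?] /andP[? ?]; lra.
have T1 : `|\int[P]_w gper a g (l + X w) - \int[P]_w gper a g (l + Y w)| <=
  `|\int[P]_w fejer_sum a g N (l + X w) - \int[P]_w fejer_sum a g N (l + Y w)| + 2 * del.
  move: dX dY; set A := \int[P]_w _; set A' := \int[P]_w _.
  set B := \int[P]_w _; set B' := \int[P]_w _ => dX dY.
  have -> : A' - B' = (A - B) - (A - A') + (B - B') by ring.
  have := ler_normD ((A - B) - (A - A')) (B - B'); have := ler_normB (A - B) (A - A'); lra.
lra.
Qed.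

End fixed_lattice.

Variables (g : 'cV[R]_d -> R) (rho Lam Cg : R).
Hypothesis mg : measurable_fun setT g.
Hypothesis g_ge0 : forall x, 0 <= g x.
Hypothesis g_le : forall x, g x <= Cg.
Hypothesis g_supp : forall x, rho < enorm x -> g x = 0.
Hypothesis g_lip : forall x y, `|g (x + y) - g x| <= Lam * enorm y.
Hypothesis g_even : forall x, g (- x) = g x.
Hypothesis g_pos : forall u, 0 <= ghat g u.

Let c k : R := k.+1%:R.
Let c0 k : 0 < c k. Proof. by []. Qed.
(* Gk k is the periodization of g over (k+1) times the lattice, rescaled so as
   to keep the same basis; it tends to g pointwise. *)
Let gk k x := g (c k *: x).
Let Gk k x := gper a (gk k) ((c k)^-1 *: x).

Let gk_ge0 k x : 0 <= gk k x. Proof. exact: g_ge0. Qed.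

Let mgk k : measurable_fun setT (gk k).
Proof. by apply: (measurableT_comp mg); exact: measurable_cVZ. Qed.

Let lpointMn z n : lp (z *+ n) = n%:R *: lp z.
Proof.
elim: n => [|n IH]; first by rewrite mulr0n lpoint0 scale0r.
by rewrite mulrS lpointD IH -natr1 scalerDl scale1r addrC.
Qed.

Let GkE k x : Gk k x = fine (\esum_(z in [set: Z]) (g (x + lp (z *+ k.+1)))%:E)%E.
Proof.
congr fine; apply: eq_esum => z _; congr (_%:E); rewrite /gk scalerDr scalerA divff ?scale1r ?gt_eqF//.
by rewrite lpointMn.
Qed.

Let mulz_inj k : injective (fun z : Z => z *+ k.+1).
Proof.
move=> z w zw; apply/ffunP => j; move/ffunP/(_ j): zw.
by rewrite !ffunMnE => /eqP; rewrite eqr_pMn2r// => /eqP.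
Qed.

(** Fewer nonnegative terms, as the dilated lattice is a sublattice. The bound does not depend on k
    and serves for dominated convergence. *)
Let Gk_le k x : Gk k x <= gper a g x.
Proof.
have L : (\esum_(z in [set: Z]) (g (x + lp (z *+ k.+1)))%:E <=
    \esum_(z in [set: Z]) (g (x + lp z))%:E)%E.
  rewrite -(@esum_image R Z Z setT (fun z : Z => z *+ k.+1) (fun z => (g (x + lp z))%:E)).
    by rewrite esum_mkcond; apply: le_esum => z _; case: ifP => //; rewrite lee_fin.
  by move=> z w _ _; exact: mulz_inj.
rewrite GkE; apply: fine_le => //; last by rewrite (gperE ba g_ge0 g_le g_supp).
rewrite ge0_fin_numE; last by apply: esum_ge0 => z _; rewrite lee_fin.
by apply: le_lt_trans L _; rewrite (gperE ba g_ge0 g_le g_supp) ltry.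
Qed.

Let Gk_ge0 k x : 0 <= Gk k x.
Proof. exact: gper_ge0. Qed.

(** Some coordinate of a nonzero lattice point is a nonzero integer, and coordinates are scalar
    products with the dual basis. *)
Let lp_ge z : z != 0 -> 1 <= (\sum_j enorm (dual_vec a j)) * enorm (lp z).
Proof.
move=> z0; have [j zj] : exists j, z j != 0.
  apply: contrapT => /forallNP H; move/eqP: z0; apply; apply/ffunP => j.
  by rewrite ffunE; have /negP := H j; rewrite negbK => /eqP.
apply: (@le_trans _ _ (enorm (dual_vec a j) * enorm (lp z))); last first.
  by rewrite ler_wpM2r ?enorm_ge0// (bigD1 j)//= lerDl sumr_ge0// => i _; exact: enorm_ge0.
apply: le_trans (dot_le_enorm _ _); rewrite -/(tcoord a j _) (tcoord_lpoint ba).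
by rewrite -intr_norm -[1]/(1%:~R) ler_int -gtz0_ge1 normr_gt0.
Qed.

(** Eventually constant: once the dilated lattice is sparse enough, its nonzero points move [x] out
    of the support of [g]. *)
Let Gk_cvg x : Gk ^~ x @ \oo --> g x.
Proof.
apply: cvg_near_cst; pose K := \sum_j enorm (dual_vec a j).
have K0 : 0 <= K by apply: sumr_ge0 => j _; exact: enorm_ge0.
near=> k.
have kK : K * (rho + enorm x) < c k.
  near: k; exists (Num.truncn (K * (rho + enorm x))) => //= k kx.
  by apply: lt_le_trans (truncnS_gt _) _; rewrite ler_nat ltnS.
have far z : z != 0 -> g (x + lp (z *+ k.+1)) = 0.
  move=> z0; apply: g_supp.
  have h := enormB (x + c k *: lp z) x; rewrite addrC addKr in h.
  rewrite lpointMn; have hz := lp_ge z0; rewrite enormZ gtr0_norm// -/K in h hz.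
  have Kp : 0 < K by rewrite lt_neqAle K0 andbT; apply: contraTneq hz => <-; rewrite mul0r -ltNge ltr01.
  have h2 : K * (rho + enorm x) < K * (c k * enorm (lp z)).
    by apply: lt_le_trans kK _; rewrite mulrCA ler_peMr// ltW.
  rewrite ltr_pM2l// in h2; lra.
rewrite GkE (_ : \esum_(z in [set: Z]) _ = (g x)%:E)%E//.
transitivity (\esum_(z in [set (0%R : Z)]) (g (x + lp (z *+ k.+1)))%:E)%E.
  rewrite [RHS]esum_mkcond; apply: eq_esum => z _.
  case: ifPn => //; rewrite notin_setE/= => /eqP z0.
  by rewrite far.
by rewrite esum_set1 ?mul0rn ?lpoint0 ?addr0// lee_fin.
Unshelve. all: by end_near.
Qed.

(** [gper_compare] for the periodizations over dilated lattices, with an error that does not depend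
    on the dilation; the limit leaves [g] alone. *)
Lemma covariogram_compare (e : R) X Y l : 0 <= e ->
  measurable_fun setT X -> measurable_fun setT Y ->
  (forall u c, `|charE X u c - charE Y u c| <= e * (1 - charE Y u 0)) ->
  `|\int[P]_w g (l + X w) - \int[P]_w g (l + Y w)| <=
  e * (g 0 - \int[P]_w g (Y w)).
Proof.
move=> e0 mX mY XY.
have mGk k : measurable_fun setT (Gk k).
  by apply: (measurableT_comp (measurable_gper a (mgk k) (gk_ge0 k))); exact: measurable_cVZ.
have lim V l' : measurable_fun setT V ->
    (fun k => \int[P]_w Gk k (l' + V w)) @ \oo --> \int[P]_w g (l' + V w).
  move=> mV; have mlV : measurable_fun setT (fun w => l' + V w) by exact: measurable_cVD.
  apply: (@Rintegral_dominated_cvg _ _ _ P _ _ (fun w => gper a g (l' + V w)) _ _ _ _ _).2.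
  - by move=> k; exact: (measurableT_comp (mGk k)).
  - exact: (measurableT_comp mg).
  - exact: (@gper_rv_integrable g rho Cg).
  - by move=> w; exact: Gk_cvg.
  - by move=> k w; rewrite ger0_norm ?Gk_ge0// Gk_le.
have cmp k : `|\int[P]_w Gk k (l + X w) - \int[P]_w Gk k (l + Y w)| <=
    e * (Gk k 0 - \int[P]_w Gk k (0 + Y w)).
  (* The hypothesis concerns all frequencies, so it is invariant under a common rescaling of [X] and
     [Y]. *)
  have sc V u (s : R) : charE (fun w => (c k)^-1 *: V w) u s = charE V ((c k)^-1 *: u) s.
    by apply: eq_Rintegral => w _; rewrite dotZr dotZl.
  have cn0 : c k != 0 by rewrite gt_eqF.
  have gkl x y : `|gk k (x + y) - gk k x| <= (Lam * c k) * enorm y.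
    rewrite /gk scalerDr; apply: le_trans (g_lip _ _) _.
    by rewrite enormZ gtr0_norm// mulrA.
  have gks x : rho / c k < enorm x -> gk k x = 0.
    by move=> xr; apply: g_supp; rewrite enormZ gtr0_norm// mulrC -ltr_pdivrMr.
  have gke x : gk k (- x) = gk k x by rewrite /gk scalerN g_even.
  have gkp u : 0 <= ghat (gk k) u.
    pose f y := g y * cos (dot ((c k)^-1 *: u) y).
    have fi : lam.-integrable setT (EFin \o f).
      apply: (@bsupp_integrable R d _ Cg rho).
        by apply: measurable_funM => //; exact: measurable_cos_dot.
      move=> y; rewrite normrM ger0_norm// indicE closed_eballE.
      case: (leP (enorm y) rho) => yr; last by rewrite g_supp// mul0r mulr0.
      by rewrite mulr1; apply: le_trans (g_le y); rewrite ler_piMr// cos_max.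
    have := Rintegral_cVZ cn0 fi.
    rewrite (_ : \int[lam]_x f (c k *: x) = ghat (gk k) u).
      by move=> ->; rewrite mulr_ge0 ?g_pos// invr_ge0 exprn_ge0.
    apply: eq_Rintegral => y _; rewrite /f /gk; congr (_ * cos _).
    by rewrite dotZr dotZl mulrA divff// mul1r.
  have := @gper_compare (gk k) (rho / c k) (Lam * c k) Cg (mgk k) (gk_ge0 k) (fun x => g_le _)
    gks gkl gke gkp e (fun w => (c k)^-1 *: X w) (fun w => (c k)^-1 *: Y w) ((c k)^-1 *: l) e0.
  move=> /(_ (measurable_cVZ _ mX) (measurable_cVZ _ mY)) H.
  rewrite /Gk scaler0; under eq_Rintegral do rewrite scalerDr.
  under [X in _ - X]eq_Rintegral do rewrite scalerDr.
  under [X in _ * (_ - X)]eq_Rintegral do rewrite add0r.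
  by apply: H => u s; rewrite !sc.
have L : (fun k => `|\int[P]_w Gk k (l + X w) - \int[P]_w Gk k (l + Y w)|) @ \oo -->
    `|\int[P]_w g (l + X w) - \int[P]_w g (l + Y w)|.
  by apply: cvg_norm; apply: cvgB; exact: lim.
have M : (fun k => e * (Gk k 0 - \int[P]_w Gk k (0 + Y w))) @ \oo --> e * (g 0 - \int[P]_w g (0 + Y w)).
  by apply: cvgMr; apply: cvgB; [exact: Gk_cvg|exact: lim].
have <- : \int[P]_w g (0 + Y w) = \int[P]_w g (Y w) by under eq_Rintegral do rewrite add0r.
exact: (ler_cvg_to L M (nearW _ cmp)).
Qed.

End comparison.

(** * Quadratic forms and matrix norms *)

Section norm_equivalence.
Context {R : realType} {m : nat}.
Variable F : 'rV[R]_m -> R.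
Hypothesis F_eq0 : forall v, F v = 0 -> v = 0.
Hypothesis FZ : forall c v, F (c *: v) = `|c| * F v.
Hypothesis FD : forall v w, F (v + w) <= F v + F w.

Let F0 : F 0 = 0. Proof. by rewrite -(scale0r 0) FZ normr0 mul0r. Qed.

Let FN v : F (- v) = F v. Proof. by rewrite -scaleN1r FZ normrN1 mul1r. Qed.

Let F_ge0 v : 0 <= F v.
Proof. have := FD v (- v); rewrite subrr F0 FN; lra. Qed.

Let Fsum (I : Type) (s : seq I) (f : I -> 'rV[R]_m) : F (\sum_(i <- s) f i) <= \sum_(i <- s) F (f i).
Proof.
elim: s => [|i s IH]; first by rewrite !big_nil F0.
by rewrite !big_cons; apply: le_trans (FD _ _) _; rewrite lerD2l.
Qed.

Let K := \sum_(k < m) F (delta_mx 0 k).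

Let entry_le_norm (v : 'rV[R]_m) k : `|v ord0 k| <= `|v|.
Proof. by rewrite [leRHS]/Num.norm/= mx_normrE; exact: (le_bigmax _ (fun i => `|v i.1 i.2|) (ord0, k)). Qed.

Let FK v : F v <= K * `|v|.
Proof.
rewrite {1}(row_sum_delta v) /K mulr_suml; apply: le_trans (Fsum _ _) _.
by apply: ler_sum => k _; rewrite FZ mulrC ler_wpM2l//; exact: entry_le_norm.
Qed.

(** Equivalence of norms by compactness: [F] is Lipschitz for the maximum norm, hence attains on its
    unit sphere a minimum, which is positive by [F_eq0]. Dimension 0, where this sphere is empty, is
    set aside. *)
Lemma norm_coord_bound : exists C, 0 <= C /\ forall (v : 'rV[R]_m) k, `|v ord0 k| <= C * F v.
Proof.
have [m0|m0] := posnP m.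
  exists 0; split=> // v k; exfalso; have := leq_ltn_trans (leq0n k) (ltn_ord k).
  by rewrite m0.
pose A := [set v : 'rV[R]_m | `|v| = 1].
have K0 : 0 <= K by apply: sumr_ge0.
have cF : continuous F.
  move=> v; have FF : Filter (nbhs v) by exact: nbhs_filter.
  apply/(@cvgrPdist_le _ _ _ (nbhs v) FF) => e e0.
  have K1 : 0 < K + 1 by lra.
  have vw : \forall w \near v, `|v - w| <= e / (K + 1).
    by have := @cvgr_dist_le _ _ _ (nbhs v) FF id v; apply; [exact: cvg_id|rewrite divr_gt0].
  apply: (filterS _ vw) => w /= h.
  apply: (@le_trans _ _ (F (v - w))).
    rewrite ler_norml; have := FD (v - w) w; have := FD (w - v) v.
    by rewrite !subrK -(opprB v w) FN; lra.
  apply: le_trans (FK _) _; apply: (@le_trans _ _ ((K + 1) * `|v - w|)).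
    by rewrite ler_wpM2r// lerDl.
  by rewrite mulrC -ler_pdivlMr.
have cA : compact A.
  apply: bounded_closed_compact.
    by exists 1; split => // x x1 v /= ->; exact: ltW.
  rewrite (_ : A = (fun v : 'rV[R]_m => `|v|) @^-1` [set 1])//.
  apply: (closed_comp (f := fun v : 'rV[R]_m => `|v|)); last exact: closed_eq.
  by move=> v _; exact: norm_continuous.
have A0 : A !=set0.
  have w0 : 0 < `|const_mx 1 : 'rV[R]_m|.
    rewrite normr_gt0; apply/eqP => /matrixP/(_ ord0 (Ordinal m0)).
    by rewrite !mxE => /eqP; rewrite oner_eq0.
  exists (`|const_mx 1 : 'rV[R]_m|^-1 *: const_mx 1).
  by rewrite /A/= normrZ ger0_norm ?invr_ge0// mulVf// gt_eqF.
have [v vA vmin] := EVT_min_rV A0 cA (continuous_subspaceT cF).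
have Fv : 0 < F v.
  rewrite lt_neqAle F_ge0 andbT eq_sym; apply/eqP => /F_eq0 v0.
  by move: vA; rewrite inE /A/= v0 normr0 => /esym/eqP; rewrite oner_eq0.
exists (F v)^-1; split; first by rewrite invr_ge0.
move=> w k; apply: le_trans (entry_le_norm w k) _.
rewrite ler_pdivlMl//.
have [->|w0] := eqVneq w 0; first by rewrite normr0 mulr0.
have nw : 0 < `|w| by rewrite normr_gt0.
rewrite mulrC -ler_pdivlMl//.
have -> : `|w|^-1 * F w = F (`|w|^-1 *: w).
  by rewrite FZ ger0_norm// invr_ge0.
by apply: vmin; rewrite inE /A/= normrZ ger0_norm ?invr_ge0// mulVf// gt_eqF.
Unshelve. all: by end_near.
Qed.

End norm_equivalence.

Section quadratic_forms.
Context {R : realType} {d : nat}.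
Implicit Types (S C : 'M[R]_d) (u v : 'cV[R]_d).

Definition qform S u : R := (u^T *m S *m u) ord0 ord0.

Lemma qformE S u : qform S u = dot u (S *m u).
Proof. by rewrite dotE mulmxA. Qed.

Lemma qform_sum S u : qform S u = \sum_i \sum_j u i ord0 * S i j * u j ord0.
Proof.
rewrite qformE; apply: eq_bigr => i _; rewrite mxE mulr_sumr.
by apply: eq_bigr => j _; rewrite mulrA.
Qed.

Lemma qform_abs_le C u : `|qform C u| <= (\sum_i \sum_j `|C i j|) * enorm u ^+ 2.
Proof.
rewrite qform_sum mulr_suml; apply: le_trans (ler_norm_sum _ _ _) _; apply: ler_sum => i _.
rewrite mulr_suml; apply: le_trans (ler_norm_sum _ _ _) _; apply: ler_sum => j _.
rewrite !normrM mulrAC mulrC ler_wpM2l// expr2.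
by apply: ler_pM => //; exact: entry_le_enorm.
Qed.

Section posdef.
Variable S : 'M[R]_d.
Hypothesis pS : positive_definite S.

Let bil u v := dot u (S *m v).

Let bilC u v : bil u v = bil v u.
Proof.
have [sS _] := pS.
have E x y : bil x y = \sum_i \sum_j x i ord0 * S i j * y j ord0.
  apply: eq_bigr => i _; rewrite mxE mulr_sumr; apply: eq_bigr => j _.
  by rewrite mulrA.
rewrite !E exchange_big/=; apply: eq_bigr => j _; apply: eq_bigr => i _.
by rewrite -[in RHS]sS mxE mulrC mulrA mulrAC.
Qed.

Lemma posdef_ge0 u : 0 <= qform S u.
Proof.
have [_ h] := pS; have [->|u0] := eqVneq u 0; last by rewrite ltW// h.
by rewrite qformE dotC dot0r.
Qed.

Let bil_sq_le u v : bil u v ^+ 2 <= qform S u * qform S v.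
Proof.
have [_ h] := pS; have [->|v0] := eqVneq v 0.
  by rewrite !qformE /bil mulmx0 !dot0r mulr0 expr0n.
have Sv : 0 < qform S v := h v v0.
have := posdef_ge0 (qform S v *: u - bil u v *: v).
rewrite qformE mulmxBr -!scalemxAr dotBr !dotZr !(dotC _ (S *m _)) !dotBr !dotZr.
rewrite !(dotC (S *m _)) -!qformE -!/(bil _ _) (bilC v u) => H.
rewrite -(ler_pM2l Sv) -subr_ge0; apply: le_trans H _.
rewrite le_eqVlt; apply/orP; left; apply/eqP; ring.
Qed.

(* Cauchy-Schwarz for the scalar product defined by S, applied to
   u_k = <u, S^-1 e_k>_S. *)
Lemma posdef_coercive : exists K, 0 <= K /\ forall u, enorm u ^+ 2 <= K * qform S u.
Proof.
have [sS h] := pS.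
have Su : S \in unitmx.
  rewrite -row_free_unit; apply: inj_row_free => v vS.
  apply/trmx_inj; rewrite trmx0; apply/eqP; apply: contraT => v0.
  by have := h _ v0; rewrite trmxK vS mul0mx mxE ltxx.
pose e k : 'cV[R]_d := delta_mx k ord0.
exists (\sum_k qform S (invmx S *m e k)); split.
  by apply: sumr_ge0 => k _; exact: posdef_ge0.
move=> u; rewrite enorm_sq mulr_suml; apply: ler_sum => k _.
have -> : u k ord0 * u k ord0 = bil u (invmx S *m e k) ^+ 2.
  rewrite /bil mulmxA mulmxV// mul1mx expr2.
  suff -> : dot u (e k) = u k ord0 by [].
  rewrite /dot (bigD1 k)//= big1 => [|i ik]; rewrite mxE ?eqxx ?mulr1 ?addr0//.
  by rewrite (negbTE ik) mulr0.
by rewrite [leRHS]mulrC; exact: bil_sq_le.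
Qed.

End posdef.

Lemma matrix_norm_ge0 (N : 'M[R]_d -> R) A : is_matrix_norm N -> 0 <= N A.
Proof.
move=> [_ NZ ND]; have N0 : N 0 = 0 by rewrite -(scale0r 0) NZ normr0 mul0r.
have NN : N (- A) = N A by rewrite -scaleN1r NZ normrN1 mul1r.
have := ND A (- A); rewrite subrr N0 NN; lra.
Qed.

(** Norm equivalence bounds the entries of C by [N C], and coercivity bounds |u|^2 by the form of S.
    This makes the error relative to u^T Sigma u. *)
Lemma qform_relative_bound (N : 'M[R]_d -> R) S : is_matrix_norm N -> positive_definite S ->
  exists K, 0 <= K /\ forall C u, `|qform C u| <= K * N C * qform S u.
Proof.
move=> nN pS; have [N0 NZ ND] := nN.
have [K1 [K10 HK1]] := posdef_coercive pS.
have F0 (v : 'rV[R]_(d * d)) : N (vec_mx v) = 0 -> v = 0.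
  by move=> /N0 /(congr1 mxvec); rewrite vec_mxK linear0.
have FZ c (v : 'rV[R]_(d * d)) : N (vec_mx (c *: v)) = `|c| * N (vec_mx v).
  by rewrite linearZ NZ.
have FD (v w : 'rV[R]_(d * d)) : N (vec_mx (v + w)) <= N (vec_mx v) + N (vec_mx w).
  by rewrite linearD ND.
have [K2 [K20 HK2]] := norm_coord_bound F0 FZ FD.
exists (d%:R * (d%:R * K2) * K1); split; first by rewrite !mulr_ge0.
move=> C u; apply: le_trans (qform_abs_le C u) _.
have NC := matrix_norm_ge0 C nN.
apply: (@le_trans _ _ ((d%:R * (d%:R * K2) * N C) * enorm u ^+ 2)).
  rewrite ler_wpM2r ?sqr_ge0//.
  apply: (@le_trans _ _ (\sum_(i < d) \sum_(j < d) K2 * N C)).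
    apply: ler_sum => i _; apply: ler_sum => j _.
    by have := HK2 (mxvec C) (mxvec_index i j); rewrite mxvecE mxvecK.
  rewrite (eq_bigr (fun=> d%:R * (K2 * N C))); last first.
    by move=> i _; rewrite sumr_const card_ord mulr_natl.
  by rewrite sumr_const card_ord -[leLHS]mulr_natl !mulrA.
apply: le_trans (ler_wpM2l _ (HK1 u)) _; first by rewrite !mulr_ge0.
rewrite le_eqVlt; apply/orP; left; apply/eqP; ring.
Qed.

End quadratic_forms.

(** * Gaussian lattice sums *)

Section lattice_sum.
Context {R : realType} {d : nat}.
Variable a : d.-tuple 'cV[R]_d.
Hypothesis ba : basis_of fullv a.
Local Notation Z := {ffun 'I_d -> int}.
Implicit Types (k : Z) (u : 'cV[R]_d).

Let A : R := \sum_j enorm (tnth a j) + 1.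

Let A0 : 0 < A.
Proof. by rewrite ltr_wpDl// sumr_ge0// => j _; exact: enorm_ge0. Qed.

Lemma dot_freq_basis k m : dot (freq a k) (tnth a m) = 2 * pi * (k m)%:~R.
Proof.
rewrite dot_freq; congr (_ * _).
have E : tnth a m = \sum_i (i == m)%:R *: tnth a i.
  by rewrite (bigD1 m)//= eqxx scale1r big1 ?addr0// => i /negbTE ->; rewrite scale0r.
rewrite (bigD1 m)//= [X in tcoord a m X]E tcoordK// eqxx mulr1 big1 ?addr0// => i im.
by rewrite [X in tcoord a i X]E tcoordK// (negbTE im) mulr0.
Qed.

(** Cauchy-Schwarz with the basis vector [tnth a m], whose product with the frequency is 2 pi [k m];
    the summand 1 in [A] only keeps it positive. *)
Let freq_ge k m : 2 * pi / A * `|(k m)%:~R| <= enorm (freq a k).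
Proof.
have := dot_le_enorm (freq a k) (tnth a m); rewrite dot_freq_basis => h.
have e0 := enorm_ge0 (freq a k).
rewrite mulrAC ler_pdivrMr//; apply: (@le_trans _ _ (enorm (freq a k) * enorm (tnth a m))).
  by move: h; rewrite !normrM (ger0_norm (pi_ge0 R)) ger0_norm.
rewrite ler_wpM2l// /A (bigD1 m)//= -addrA lerDl addr_ge0// sumr_ge0// => j _.
exact: enorm_ge0.
Qed.

Let c1 : R := 2 * pi / A.
Let c10 : 0 < c1. Proof. by rewrite divr_gt0// mulr_gt0// pi_gt0. Qed.

Let freq_ge1 k : k != 0 -> c1 <= enorm (freq a k).
Proof.
move=> k0; have [m km] : exists m, k m != 0.
  apply: contrapT => /forallNP H; move/eqP: k0; apply; apply/ffunP => j.
  by rewrite ffunE; have /negP := H j; rewrite negbK => /eqP.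
apply: le_trans (freq_ge k m); rewrite ler_peMr ?(ltW c10)//.
by rewrite -intr_norm -[1]/(1%:~R) ler_int -gtz0_ge1 normr_gt0.
Qed.

(** Nonzero frequencies have length at least c1, so the squared transform is at most C r^(2d) / (r
    c1)^(d+1), of order r^(d-1). The choice of r0 puts them all in the range of the decay
    estimate. *)
Lemma ghat_covg_freq_le : (0 < d)%N -> exists r0 C : R, 0 < r0 /\ 0 <= C /\
  forall r k, r0 <= r -> k != 0 -> ghat (covg r) (freq a k) <= C * r ^+ d.-1.
Proof.
move=> d0; have [C [C0 HC]] := @ball_fourier_decay R d.
exists (2 * d.+1%:R / c1), (C / c1 ^+ d.+1); split; first by rewrite divr_gt0// mulr_gt0.
split; first by rewrite divr_ge0// exprn_ge0// ltW.
move=> r k rr k0; have fk := freq_ge1 k0.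
have r0 : 0 < r by apply: lt_le_trans rr; rewrite divr_gt0// mulr_gt0.
rewrite ghat_covg; apply: le_trans (HC _ _ r0 _) _.
  rewrite ler_pdivrMr// in rr; apply: le_trans rr _.
  by rewrite ler_wpM2l// ltW.
rewrite ler_pdivrMr ?exprn_gt0// ?mulr_gt0//; last exact: lt_le_trans fk.
rewrite [(r * _) ^+ _]exprMn (_ : (2 * d = d.-1 + d.+1)%N); last by rewrite mul2n -addnn -[in LHS](prednK d0); lia.
rewrite exprD.
rewrite [leRHS](_ : _ = C * (r ^+ d.-1 * r ^+ d.+1) * ((c1 ^+ d.+1)^-1 * enorm (freq a k) ^+ d.+1)); last by ring.
rewrite ler_peMr ?mulr_ge0 ?exprn_ge0 ?(ltW r0)//.
rewrite ler_pdivlMl ?exprn_gt0// mulr1 lerXn2r// nnegrE ?(ltW c10)//; exact: enorm_ge0.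
Qed.

Lemma ghat_covg_freq0 (r : R) : ghat (covg r) (freq a 0) = @vol R d r ^+ 2.
Proof.
rewrite ghat_covg; congr (_ ^+ 2).
under eq_Rintegral do rewrite freq0 cos0.
by rewrite Rintegral_cst ?mul1r//; exact: measurable_closed_eball.
Qed.

Variable S : 'M[R]_d.
Hypothesis pS : positive_definite S.

(** A Gaussian weight is weakened to a product of geometric ones, since a product can be summed over
    a box coordinate by coordinate. It uses |k_m| <= k_m^2 for integers and the sum over m of the
    bounds from [freq_ge]. *)
Let exp_qform_le : exists q : R, 0 < q < 1 /\ forall k,
  expR (- qform S (freq a k)) <= \prod_(m < d) q ^+ `|k m|%N.
Proof.
have [K1 [K10 HK1]] := posdef_coercive pS.
pose b := c1 ^+ 2 / (d.+1%:R * (K1 + 1)).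
have K1p : 0 < K1 + 1 by lra.
have b0 : 0 < b by rewrite divr_gt0 ?exprn_gt0// mulr_gt0.
exists (expR (- b)); split; first by rewrite expR_gt0 -[X in _ < X]expR0 ltr_expR oppr_lt0.
move=> k.
have -> : \prod_(m < d) expR (- b) ^+ `|k m|%N = expR (- (b * \sum_(m < d) `|k m|%N%:R)).
  rewrite mulr_sumr -sumrN (big_morph (@expR R) (@expRD R) (@expR0 R)).
  apply: eq_bigr => m _; rewrite -expRM_natl; congr expR; ring.
rewrite ler_expR lerN2.
have S0 := posdef_ge0 pS (freq a k).
have h1 : enorm (freq a k) ^+ 2 <= (K1 + 1) * qform S (freq a k).
  by apply: le_trans (HK1 _) _; rewrite ler_wpM2r// lerDl.
have h2 m : c1 ^+ 2 * `|k m|%N%:R <= enorm (freq a k) ^+ 2.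
  have fk := freq_ge k m; rewrite -/c1 in fk.
  have kE : `|(k m)%:~R| = `|k m|%N%:R :> R by rewrite natr_absz intr_norm.
  apply: (@le_trans _ _ ((c1 * `|k m|%N%:R) ^+ 2)).
    rewrite [leRHS]exprMn ler_wpM2l ?exprn_ge0 ?(ltW c10)// -natrX ler_nat.
    by rewrite -[X in (X <= _)%N]expn1; case: (`|k m|%N) => // n; rewrite leq_pexp2l.
  rewrite kE in fk; rewrite lerXn2r// nnegrE; last exact: enorm_ge0.
  by apply: mulr_ge0 => //; exact: ltW.
have h3 : c1 ^+ 2 * \sum_(m < d) `|k m|%N%:R <= d.+1%:R * enorm (freq a k) ^+ 2.
  rewrite mulr_sumr; apply: (@le_trans _ _ (\sum_(m < d) enorm (freq a k) ^+ 2)).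
    by apply: ler_sum => m _; exact: h2.
  by rewrite sumr_const card_ord -[leLHS]mulr_natl ler_wpM2r ?sqr_ge0// ler_nat.
rewrite /b mulrAC ler_pdivrMr ?mulr_gt0//; apply: le_trans h3 _.
by rewrite [leRHS]mulrC -[leRHS]mulrA ler_wpM2l.
Qed.

(** Uniform in n. The term - q^j is what lets the induction on j close: the new summand (1 - q)
    q^(j+1) is paid by q^j - q^(j+1), the difference being q^j (1 - q)^2. *)
Let geo (q : R) (j n : nat) : 0 < q < 1 ->
  (1 - q) * \sum_(l < n) q ^+ `|(j%:Z - l%:Z)%R|%N <= 2 - q ^+ j.
Proof.
move=> /andP[q0 q1]; elim: j n => [|j IH] [|n].
- by rewrite big_ord0 mulr0 expr0; lra.
- rewrite expr0 (eq_bigr (fun l : 'I_n.+1 => q ^+ l)); last first.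
    by move=> l _; rewrite sub0r abszN.
  have := subrX1 q n.+1; have := exprn_ge0 n.+1 (ltW q0); nra.
- rewrite big_ord0 mulr0; have := exprn_ile1 j.+1 (ltW q0) (ltW q1); lra.
- rewrite big_ord_recl subr0 absz_nat (eq_bigr (fun l : 'I_n => q ^+ `|(j%:Z - l%:Z)%R|%N)); last first.
    by move=> l _; congr (_ ^+ `|_|%N); rewrite lift0; lia.
  have h := mulr_ge0 (exprn_ge0 j (ltW q0)) (sqr_ge0 (1 - q)).
  by have := IH n; rewrite exprS mulrDr; move: h; set t := _ * \sum_(l < n) _; set p := q ^+ j; lra.
Qed.

Let box_sum (q : R) n (j : {ffun 'I_d -> 'I_n}) : 0 < q < 1 ->
  \sum_(l : {ffun 'I_d -> 'I_n}) \prod_(m < d) q ^+ `|(boxpt j - boxpt l)%R m|%N <= (2 / (1 - q)) ^+ d.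
Proof.
move=> q01; have /andP[q0 q1] := q01.
have -> : \sum_(l : {ffun 'I_d -> 'I_n}) \prod_(m < d) q ^+ `|(boxpt j - boxpt l)%R m|%N =
   \prod_(m < d) \sum_(l < n) q ^+ `|((j m)%:Z - l%:Z)%R|%N.
  rewrite bigA_distr_bigA; apply: eq_bigr => l _; apply: eq_bigr => m _.
  by rewrite !ffunE.
rewrite -[X in _ ^+ X]card_ord -prodr_const; apply: ler_prod => m _.
apply/andP; split; first by apply: sumr_ge0 => l _; rewrite exprn_ge0// ltW.
rewrite ler_pdivlMr ?subr_gt0// mulrC; apply: le_trans (geo _ _ q01) _.
by rewrite gerBl exprn_ge0// ltW.
Qed.

Let boxptB_eq0 n (j l : {ffun 'I_d -> 'I_n}) : (boxpt j - boxpt l == 0) = (j == l).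
Proof.
by rewrite subr_eq0 (inj_eq (@boxpt_inj d n)).
Qed.

Context {dT : measure_display} {T : measurableType dT} (P : probability T R).
Variable Y : T -> 'cV[R]_d.
Hypothesis mY : measurable_fun setT Y.
Hypothesis charY : forall u, charE P Y u 0 = expR (- qform S u).

(** For each j, the term l = j carries the zero frequency and the volume squared, while the Gaussian
    weights bound the remaining sum over l by C Q r^(d-1). The n^d values of j are cancelled by the
    normalization, so nothing depends on n. *)
Lemma gper_expectation_le : (0 < d)%N -> exists r0 K : R, 0 < r0 /\ 0 <= K /\
  forall r, r0 <= r -> \int[P]_w gper a (covg r) (Y w) <= @vol R d r ^+ 2 / covol a + K * r ^+ d.-1.
Proof.
move=> d0; have [r0 [C [r00 [C0 HC]]]] := ghat_covg_freq_le d0.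
have [q [q01 Hq]] := exp_qform_le; have /andP[q0 q1] := q01.
have V0 := covol_gt0 ba.
pose Q := (2 / (1 - q)) ^+ d.
have Q0 : 0 <= Q by rewrite exprn_ge0// divr_ge0// subr_ge0 ltW.
exists r0, (C * Q / covol a); split=> //; split; first by rewrite divr_ge0 ?mulr_ge0// ltW.
move=> r rr; have rp : 0 < r by exact: lt_le_trans rr.
have rn : 0 <= r ^+ d.-1 by rewrite exprn_ge0// ltW.
apply/ler_addgt0Pr => e e0.
have lip (x y : 'cV[R]_d) := covg_lipschitz x y d0 rp.
have [N HN] := fejer_sum_cvg ba (@measurable_covg R d r) (@covg_ge0 R d r) (@covg_le R d r)
  (@covg_supp R d r) lip (@covgN R d r) e0.
pose n := N.+1; have n0 : 0 < n%:R ^+ d :> R by rewrite exprn_gt0.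
have [iS ES] := fejer_sum_expectation P a (covg r) n 0 mY.
have gi := gper_rv_integrable P ba (@measurable_covg R d r) (@covg_ge0 R d r) (@covg_le R d r)
  (@covg_supp R d r) 0 mY.
have := Rintegral_P_dist iS gi (fun w => HN n _ (leqnSn _)).
rewrite ler_norml => /andP[h _].
have -> : \int[P]_w gper a (covg r) (Y w) = \int[P]_w gper a (covg r) (0 + Y w).
  by under [RHS]eq_Rintegral do rewrite add0r.
suff : \int[P]_w fejer_sum a (covg r) n (0 + Y w) <= @vol R d r ^+ 2 / covol a + C * Q / covol a * r ^+ d.-1 by lra.
rewrite ES.
have term (j l : {ffun 'I_d -> 'I_n}) :
    ghat (covg r) (freq a (boxpt j - boxpt l)) * charE P Y (freq a (boxpt j - boxpt l)) (dot (freq a (boxpt j - boxpt l)) 0)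
    <= (j == l)%:R * @vol R d r ^+ 2 + C * r ^+ d.-1 * \prod_(m < d) q ^+ `|(boxpt j - boxpt l)%R m|%N.
  rewrite dot0r charY -boxptB_eq0; set k := boxpt j - boxpt l.
  have [->|k0] := eqVneq k 0.
    rewrite ghat_covg_freq0 mul1r ler_wpDr ?mulr_ge0//; first by apply: prodr_ge0 => m _; rewrite exprn_ge0// ltW.
    by rewrite ler_piMr ?sqr_ge0// -[leRHS]expR0 ler_expR oppr_le0 posdef_ge0.
  rewrite mul0r add0r; apply: ler_pM; [exact: ghat_covg_ge0|exact: expR_ge0|exact: HC|exact: Hq].
set X := \sum_j _.
have XE : X <= n%:R ^+ d * (@vol R d r ^+ 2 + C * r ^+ d.-1 * Q).
  have -> : n%:R ^+ d * (@vol R d r ^+ 2 + C * r ^+ d.-1 * Q) =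
     \sum_(j : {ffun 'I_d -> 'I_n}) (@vol R d r ^+ 2 + C * r ^+ d.-1 * Q).
    by rewrite sumr_const card_ffun !card_ord -[RHS]mulr_natl natrX.
  apply: ler_sum => j _; apply: le_trans (ler_sum _ (fun l _ => term j l)) _.
  rewrite big_split/= -mulr_suml -mulr_sumr lerD//; last by rewrite ler_wpM2l ?mulr_ge0//; exact: box_sum.
  rewrite (bigD1 j)//= eqxx big1 ?addr0 ?mul1r// => l lj.
  by rewrite eq_sym (negbTE lj).
rewrite ler_pdivrMl ?mulr_gt0//; apply: le_trans XE _.
rewrite le_eqVlt; apply/orP; left; apply/eqP; field.
by rewrite gt_eqF.
Qed.

End lattice_sum.

(** * Moments of the perturbed lattice *)

Section perturbed_lattice_moments.
Context {R : realType} {dT : measure_display} {T : measurableType dT}.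
Variable P : probability T R.
Context {d : nat}.
Variables (a : d.-tuple 'cV[R]_d) (p : 'cV[R]_d -> T -> 'cV[R]_d) (U : T -> 'cV[R]_d).
Hypothesis ba : basis_of fullv a.
Hypothesis mp : forall i, lattice a i -> measurable_fun setT (p i).
Hypothesis pstat : strictly_stationary P (lattice a) p.
Hypothesis mU : measurable_fun setT U.
Hypothesis Uunif : uniformly_distributed P (fundamental_domain a) U.
Hypothesis Uind : independent_of_field P (lattice a) p U.
Local Notation lam := (@lebesgue_cV R d).
Local Notation Z := {ffun 'I_d -> int}.
Local Notation D := (fundamental_domain a).
Local Notation B := (@closed_eball R d).
Local Notation lp := (lpoint a).
Local Notation V := (covol a).
Local Notation q := (fun z : Z => p (lp z)).
Implicit Types (z l : Z).

Let mq z : measurable_fun setT (q z).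
Proof. exact/mp/(lattice_lpoint ba). Qed.

Let mD := measurable_fdomain ba.
Let V0 := covol_gt0 ba.

(** Stationarity and independence are stated for events on the field; this makes them available for
    pairs of its values. *)
Lemma cylinder_pair (S : set 'cV[R]_d) i j (C : set ('cV[R]_d * 'cV[R]_d)) :
  S i -> S j -> measurable C ->
  cylinder_sigma_algebra S [set x | C (x i, x j)].
Proof.
move=> Si Sj mC.
pose G : set (set ('cV[R]_d -> 'cV[R]_d)) := \bigcup_(i in S) preimage_set_system setT
        (fun x : 'cV[R]_d -> 'cV[R]_d => x i) measurable.
have me k : S k -> @measurable_fun _ _ (g_sigma_algebraType G) 'cV[R]_d setT (fun x => x k).
  by move=> Sk _ A mA; apply: sub_sigma_algebra; exists k => //; exists A.
have mpair : @measurable_fun _ _ (g_sigma_algebraType G) ('cV[R]_d * 'cV[R]_d)%type setT (fun x => (x i, x j)).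
  by apply: measurable_fun_pair; exact: me.
by have := mpair measurableT C mC; rewrite setTI.
Qed.

Let mpair z w : measurable_fun setT (fun t => (q z t, q w t)).
Proof. exact: measurable_fun_pair. Qed.

Let pair_law z l (C : set ('cV[R]_d * 'cV[R]_d)) : measurable C ->
  P [set t | C (q z t, q (z + l)%R t)] = P [set t | C (q 0%R t, q l t)].
Proof.
move=> mC; pose S : set 'cV[R]_d := [set lp 0] `|` [set lp l].
have SL : S `<=` lattice a by move=> _ [->|->]; exact: (lattice_lpoint ba).
have := pstat SL (lattice_lpoint ba z) (@cylinder_pair S (lp 0) (lp l) C (or_introl erefl) (or_intror erefl) mC).
rewrite /= => ->; congr (P _); apply/seteqP.
by split=> t /=; rewrite lpoint0 add0r lpointD addrC.
Qed.

Let integral_uniform (f : 'cV[R]_d -> \bar R) : measurable_fun setT f ->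
  (forall x, 0 <= f x)%E ->
  (\int[pushforward P U]_x f x = V^-1%:E * \int[lam]_(x in D) f x)%E.
Proof.
move=> mf f0.
pose Um : {mfun T >-> 'cV[R]_d} := HB.pack U (isMeasurableFun.Build _ _ _ _ U mU).
pose m := distribution P Um.
have Dset : [set: 'cV[R]_d] = D `|` ~` D by rewrite setUv.
have Vn : (0 <= V^-1)%R by rewrite invr_ge0 ltW.
have mUE A : measurable A -> m A = (lam (A `&` D) * V^-1%:E)%E.
  move=> mA; have := Uunif mA; rewrite /m /distribution /pushforward => ->.
  by rewrite -[X in (_ / X)%E]/(lam D) (covolE ba) inver gt_eqF.
have mND : m (~` D) = 0%E by rewrite mUE ?setICl ?measure0 ?mul0e//; exact: measurableC.
transitivity (\int[m]_x f x)%E; first by [].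
rewrite Dset ge0_integral_setU//; [|exact: measurableC|by rewrite -Dset|by apply/disj_setPCl].
rewrite [X in (_ + X)%E]null_set_integral ?adde0; [|exact: measurableC|exact: measurable_funTS|]; last first.
  exact: mND.
rewrite -(ge0_integral_mscale lam mD (NngNum Vn))//; last exact: measurable_funTS.
apply: eq_measure_integral => A mA AD; apply: etrans (mUE A mA) _.
by rewrite setIidl// muleC.
Qed.

(** Independence makes the joint law a product, Tonelli integrates [U] out, and stationarity moves
    the pair (z, z + l) to (0, l). Afterwards z can occur only through [h]. *)
Lemma field_pair_integral z l (h : 'cV[R]_d * ('cV[R]_d * 'cV[R]_d) -> \bar R) :
  measurable_fun setT h -> (forall x, 0 <= h x)%E ->
  (\int[P]_t h (U t, (q z t, q (z + l)%R t)) =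
   \int[P]_t (V^-1%:E * \int[lam]_(u in D) h (u, (q 0%R t, q l t))))%E.
Proof.
move=> mh h0.
pose Um : {mfun T >-> 'cV[R]_d} := HB.pack U (isMeasurableFun.Build _ _ _ _ U mU).
pose Wm z w : {mfun T >-> ('cV[R]_d * 'cV[R]_d)%type} :=
  HB.pack (fun t => (q z t, q w t)) (isMeasurableFun.Build _ _ _ _ (fun t => (q z t, q w t)) (mpair z w)).
have mUW : measurable_fun setT (fun t => (U t, (q z t, q (z + l)%R t))) by exact: measurable_fun_pair.
pose UWm : {mfun T >-> ('cV[R]_d * ('cV[R]_d * 'cV[R]_d))%type} :=
  HB.pack (fun t => (U t, (q z t, q (z + l)%R t))) (isMeasurableFun.Build _ _ _ _ _ mUW).
pose m1 := distribution P Um; pose m2 := distribution P (Wm z (z + l)).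
pose m3 := distribution P UWm; pose m4 := distribution P (Wm 0 l).
have indep A C : measurable A -> measurable C -> m3 (A `*` C) = (m1 A * m2 C)%E.
  move=> mA mC.
  by have := Uind mA (@cylinder_pair (lattice a) (lp z) (lp (z + l)%R) C
    (lattice_lpoint ba z) (lattice_lpoint ba (z + l)) mC).
transitivity (\int[m3]_x h x)%E.
  by rewrite /m3 ge0_integral_distribution.
transitivity (\int[m1 \x m2]_x h x)%E.
  apply: eq_measure_integral => A mA _; apply/esym.
  exact: (product_measure_unique indep).
rewrite fubini_tonelli2//.
have mG := measurable_fun_fubini_tonelli_G (m1 := m1) h mh h0.
have G0 y : (0 <= fubini_G m1 h y)%E by apply: integral_ge0.
transitivity (\int[m4]_y fubini_G m1 h y)%E.
  by apply: eq_measure_integral => C mC _; exact: pair_law.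
rewrite /m4 ge0_integral_distribution//; apply: eq_integral => t _ /=.
rewrite /fubini_G; apply: integral_uniform => //.
apply: (measurableT_comp mh); exact: measurable_fun_pair.
Qed.

Lemma perturbed_latticeE t r : perturbed_lattice (lattice a) p U t (B r) =
  (\esum_(z in [set: Z]) (\1_(B r) (lp z + q z t + U t)%R)%:E)%E.
Proof. by rewrite /perturbed_lattice (esum_lattice ba); apply: eq_esum. Qed.

Let ind r z t : R := \1_(B r) (lp z + q z t + U t).

Let ind01 r z t : ind r z t = 0 \/ ind r z t = 1.
Proof. by rewrite /ind indicE; case: (_ \in _); [right|left]. Qed.

Let mind r z : measurable_fun setT (ind r z).
Proof.
apply: measurable_ind_ball; apply: measurable_cVD => //; exact: measurable_cVD.
Qed.

(** After [field_pair_integral], the sum over z of integrals over the fundamental domain is unfolded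
    into an integral over the whole space, which is a covariogram. *)
Lemma lattice_pair_sum r l :
  (\esum_(z in [set: Z]) \int[P]_t (ind r z t * ind r (z + l)%R t)%:E =
   V^-1%:E * \int[P]_t (covg r (lp l + (q l t - q 0%R t)))%:E)%E.
Proof.
pose k z (x : 'cV[R]_d * ('cV[R]_d * 'cV[R]_d)) : \bar R :=
  (\1_(B r) (lp z + x.2.1 + x.1)%R * \1_(B r) (lp (z + l)%R + x.2.2 + x.1)%R : R)%:E.
have m21 : measurable_fun setT (fun x : 'cV[R]_d * ('cV[R]_d * 'cV[R]_d) => x.2.1).
  exact: (measurableT_comp measurable_fst).
have m22 : measurable_fun setT (fun x : 'cV[R]_d * ('cV[R]_d * 'cV[R]_d) => x.2.2).
  exact: (measurableT_comp measurable_snd).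
have mk z : measurable_fun setT (k z).
  apply/measurable_EFinP; apply: measurable_funM; apply: measurable_ind_ball;
    by apply: measurable_cVD => //; apply: measurable_cVD.
have k0 z x : (0 <= k z x)%E by rewrite lee_fin mulr_ge0.
have E z : (\int[P]_t (ind r z t * ind r (z + l)%R t)%:E =
   \int[P]_t (V^-1%:E * \int[lam]_(u in D) k z (u, (q 0%R t, q l t))))%E.
  by rewrite -(@field_pair_integral z l).
(* The integral over the domain is V times an integral against the law of [U], a probability, to
   which the measurability part of Tonelli's theorem applies. *)
have mi z : measurable_fun setT (fun t => \int[lam]_(u in D) k z (u, (q 0%R t, q l t)))%E.
  pose Um : {mfun T >-> 'cV[R]_d} := HB.pack U (isMeasurableFun.Build _ _ _ _ U mU).
  pose m1 := distribution P Um.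
  have -> : (fun t => \int[lam]_(u in D) k z (u, (q 0%R t, q l t)))%E =
     (fun y => V%:E * fubini_G m1 (k z) y)%E \o (fun t => (q 0%R t, q l t)).
    apply/funext => t /=; rewrite /fubini_G; set F := (X in (_ * X)%E).
    have -> : F = (V^-1%:E * \int[lam]_(u in D) k z (u, (q 0%R t, q l t)))%E.
      apply: integral_uniform => //.
      by apply: (measurableT_comp (mk z)); exact: measurable_fun_pair.
    by rewrite muleA -EFinM divff ?gt_eqF// mul1e.
  apply: measurableT_comp => //; apply: measurable_funeM.
  exact: (measurable_fun_fubini_tonelli_G (m1 := m1) (k z) (mk z) (k0 z)).
have i0 z t : (0 <= \int[lam]_(u in D) k z (u, (q 0%R t, q l t)))%E by exact: integral_ge0.
under eq_esum do rewrite E.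
rewrite -integral_esum_count//; first last.
- by move=> z t; rewrite mule_ge0// lee_fin invr_ge0 ltW.
- by move=> z; apply: measurable_funeM.
have mg : measurable_fun setT (fun t => (covg r (lp l + (q l t - q 0%R t)))%:E).
  apply/measurable_EFinP; apply: (measurableT_comp (measurable_covg r)).
  by apply: measurable_cVD => //; exact: measurable_cVB.
rewrite -ge0_integralZl//; [|by move=> t _; rewrite lee_fin covg_ge0|by rewrite lee_fin invr_ge0 ltW].
apply: eq_integral => t _.
have m0 (x : 'cV[R]_d) : measurable_fun setT (fun u : 'cV[R]_d => u + x) by exact: measurable_cVD.
pose f u : R := \1_(B r) (u + q 0%R t) * \1_(B r) (u + (lp l + q l t)).
have mf : measurable_fun setT (EFin \o f).
  by apply/measurable_EFinP; apply: measurable_funM; exact: measurable_ind_ball.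
transitivity (V^-1%:E * \esum_(z in [set: Z]) \int[lam]_(u in D) k z (u, (q 0%R t, q l t)))%E.
  rewrite !esum_countE//; last by move=> z; rewrite mule_ge0// lee_fin invr_ge0 ltW.
  rewrite -nneseriesZl; last by move=> i _; case: pickle_inv.
  by apply: eq_eseriesr => i _; case: pickle_inv => [z|]; rewrite ?mule0.
congr (_ * _)%E.
transitivity (\int[lam]_u (f u)%:E)%E.
  have f0 u : (0 <= (EFin \o f) u)%E by rewrite lee_fin mulr_ge0.
  apply: etrans (esym (integral_unfold ba mf f0)).
  apply: eq_esum => z _; apply: eq_integral => u _.
  have kE x y : k z (u, (x, y)) = (\1_(B r) (lp z + x + u) * \1_(B r) (lp (z + l)%R + y + u))%:E by [].
  rewrite kE lpointD; rewrite -[RHS]/((\1_(B r) (u + lp z + q 0%R t) * \1_(B r) (u + lp z + (lp l + q l t)))%:E).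
  congr ((\1_(B r) _ * \1_(B r) _)%:E).
    by rewrite addrC addrA.
  by rewrite (addrC u) -!addrA; congr (_ + _); rewrite [RHS]addrC -addrA.
rewrite -(integral_cVD (- q 0%R t))// -covgE; apply: eq_integral => u _.
rewrite /f subrK; congr (_ * \1_(B r) _)%:E.
by rewrite -addrA; congr (_ + _); rewrite addrC addrA.
Qed.

(** An indicator is its own square, so this is [lattice_pair_sum] at l = 0, where the increment
    vanishes and the covariogram is the volume. *)
Lemma perturbed_lattice_mean r :
  (\int[P]_t perturbed_lattice (lattice a) p U t (B r) = (@vol R d r / V)%:E)%E.
Proof.
under eq_integral do rewrite perturbed_latticeE.
rewrite integral_esum_count//; first last.
- by move=> z; apply/measurable_EFinP; exact: mind.
transitivity (\esum_(z in [set: Z]) \int[P]_t (ind r z t * ind r (z + 0)%R t)%:E)%E.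
  apply: eq_esum => z _; apply: eq_integral => t _; rewrite addr0 -/(ind r z t).
  by have [->|->] := ind01 r z t; rewrite ?mulr0 ?mulr1.
rewrite lattice_pair_sum.
under eq_integral do rewrite subrr lpoint0 addr0 covg0.
rewrite (integral_cst P measurableT) [X in (_ * (_ * X))%E](_ : _ = 1%E); last exact: probability_setT.
by rewrite mule1 -EFinM mulrC.
Qed.

Let N r t := perturbed_lattice (lattice a) p U t (B r).

Let N_ge0 r t : (0 <= N r t)%E.
Proof. by rewrite /N perturbed_latticeE esum_ge0// => z _; rewrite lee_fin. Qed.

Lemma measurable_perturbed_lattice r :
  measurable_fun setT (fun t => perturbed_lattice (lattice a) p U t (B r)).
Proof.
under eq_fun do rewrite perturbed_latticeE.
apply: measurable_esum_count => // z; apply/measurable_EFinP; exact: mind.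
Qed.

Let esum_exchange (f : Z -> Z -> \bar R) : (forall z l, 0 <= f z l)%E ->
  (\esum_(z in [set: Z]) \esum_(l in [set: Z]) f z l = \esum_(l in [set: Z]) \esum_(z in [set: Z]) f z l)%E.
Proof.
move=> f0; rewrite !esum_esum//.
rewrite (@reindex_esum _ _ _ ([set: Z] `*`` (fun=> [set: Z])) _ (fun x => (x.2, x.1)))//.
split => //; first by move=> [z l] [z' l'] _ _ [-> ->].
by move=> [z l] _; exists (l, z).
Qed.

(** The square of the count is a sum over pairs of lattice points, regrouped by their difference
    l. *)
Lemma perturbed_lattice_second_moment r :
  (\int[P]_t ((fine (perturbed_lattice (lattice a) p U t (B r))) ^+ 2)%:E <=
   V^-1%:E * \esum_(l in [set: Z]) \int[P]_t (covg r (lp l + (q l t - q 0%R t)))%:E)%E.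
Proof.
rewrite -/(N r _).
have pw t : (((fine (N r t)) ^+ 2)%:E <= \esum_(l in [set: Z]) \esum_(z in [set: Z]) (ind r z t * ind r (z + l)%R t)%:E)%E.
  (* fine +oo = 0: only finite values matter. *)
  have [Nfin|Ninf] := boolP (N r t \is a fin_num); last first.
    have -> : fine (N r t) = 0 by move: Ninf; case: (N r t).
    rewrite expr0n/=; apply: esum_ge0 => l _; apply: esum_ge0 => z _.
    by rewrite lee_fin mulr_ge0.
  rewrite -esum_exchange; last by move=> z l; rewrite lee_fin mulr_ge0.
  set n := fine (N r t); have NE : N r t = n%:E by rewrite fineK.
  have NE' : (\esum_(z in [set: Z]) (ind r z t)%:E)%E = n%:E by rewrite -NE /N perturbed_latticeE.
  have n0 : 0 <= n by rewrite fine_ge0.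
  have inner z : (\esum_(l in [set: Z]) (ind r z t * ind r (z + l)%R t)%:E = n%:E * (ind r z t)%:E)%E.
    have [E|E] := ind01 r z t.
      by rewrite E mule0 esum1// => l _; rewrite mul0r.
    rewrite E mule1 -NE' -[RHS](reindex_latticeD z); apply: eq_esum => l _.
    by rewrite mul1r addrC.
  under eq_esum do rewrite inner.
  rewrite esum_countE; last by move=> z; rewrite mule_ge0// lee_fin.
  rewrite (eq_eseriesr (g := fun i => (n%:E * (if pickle_inv i is Some z then (ind r z t)%:E else 0))%E)); last first.
    by move=> i _; case: pickle_inv => [z|]; rewrite ?mule0.
  rewrite nneseriesZl; last by move=> i _; case: pickle_inv => [z|//]; rewrite lee_fin.
  rewrite -[X in (_ * X)%E]/(\big[+%E/0%E]_(0 <= i <oo) _).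
  have := NE'; rewrite esum_countE => [|z]; last by rewrite lee_fin.
  by move=> ->; rewrite -EFinM expr2.
have mN2 : measurable_fun setT (fun t => ((fine (N r t)) ^+ 2)%:E).
  apply/measurable_EFinP; apply: measurable_funX.
  exact: (measurableT_comp (@fine_measurable _ _ measurableT) (measurable_perturbed_lattice r)).
have mind2 l z : measurable_fun setT (fun t => (ind r z t * ind r (z + l)%R t)%:E).
  by apply/measurable_EFinP; apply: measurable_funM; exact: mind.
have mE l : measurable_fun setT (fun t => \esum_(z in [set: Z]) (ind r z t * ind r (z + l)%R t)%:E)%E.
  by apply: measurable_esum_count => // z t; rewrite lee_fin mulr_ge0.
have E0 l t : (0 <= \esum_(z in [set: Z]) (ind r z t * ind r (z + l)%R t)%:E)%E.
  by apply: esum_ge0 => z _; rewrite lee_fin mulr_ge0.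
apply: (@le_trans _ _ (\int[P]_t \esum_(l in [set: Z]) \esum_(z in [set: Z]) (ind r z t * ind r (z + l)%R t)%:E)%E).
  apply: ge0_le_integral => //.
  - by move=> t _; rewrite lee_fin sqr_ge0.
  - by apply: measurable_esum_count.
  - by move=> t _; exact: pw.
rewrite integral_esum_count//.
have V0' : (0 <= V^-1%:E :> \bar R)%E by rewrite lee_fin invr_ge0 ltW.
have g0 l : (0 <= \int[P]_t (covg r (lp l + (q l t - q 0%R t)))%:E)%E.
  by apply: integral_ge0 => t _; rewrite lee_fin covg_ge0.
rewrite [X in (_ <= _ * X)%E]esum_countE// -nneseriesZl; last by move=> i _; case: pickle_inv.
rewrite esum_countE; last by move=> l; exact: integral_ge0.
rewrite le_eqVlt; apply/orP; left; apply/eqP.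
apply: eq_eseriesr => i _; case: pickle_inv => [l|]; last by rewrite mule0.
rewrite integral_esum_count//; last by move=> z t; rewrite lee_fin mulr_ge0.
exact: lattice_pair_sum.
Qed.

End perturbed_lattice_moments.

(** * Increments of the Gaussian field and their characteristic functions *)

Section gaussian_increments.
Context {R : realType} {dT : measure_display} {T : measurableType dT}.
Variable P : probability T R.
Context {d : nat}.
Variables (L : set 'cV[R]_d) (p : 'cV[R]_d -> T -> 'cV[R]_d).
Variables (mu : 'cV[R]_d) (Sigma : 'M[R]_d).
Hypothesis L0 : L 0.
Hypothesis mp : forall i, L i -> measurable_fun setT (p i).
Hypothesis pstat : strictly_stationary P L p.
Hypothesis pgauss : gaussian_field P L p.
Hypothesis pS : positive_definite Sigma.
Hypothesis p0law : multinormal_law P (p 0) mu Sigma.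
Implicit Types (u l : 'cV[R]_d).

Let mdotp u l : L l -> measurable_fun setT (fun w => dot u (p l w)).
Proof. by move=> Ll; apply: measurable_dot; exact: mp. Qed.

(** Stationarity for the one-point set {0} carries the law of [p 0] to every index. *)
Let dot_law u l : L l -> normal_law P (fun w => dot u (p l w)) (dot u mu) (qform Sigma u).
Proof.
move=> Ll A mA; have := p0law u mA; rewrite -dotE -/(qform Sigma u) => <-.
pose C : set ('cV[R]_d * 'cV[R]_d) := [set x | A (dot u x.1)].
have mC : measurable C.
  have mf : measurable_fun setT (fun x : 'cV[R]_d * 'cV[R]_d => dot u x.1).
    by apply: measurable_dot; exact: measurable_fst.
  by have := mf measurableT A mA; rewrite setTI.
have SL : [set (0 : 'cV[R]_d)] `<=` L by move=> _ ->.
have := pstat SL Ll (@cylinder_pair R d [set 0] 0 0 C erefl erefl mC).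
rewrite /= add0r => E; apply: etrans (esym E) _; congr (P _); apply/seteqP.
by split=> w; rewrite /C/= -dotE.
Qed.

Let A u l w := dot u (p l w) - dot u mu.

Let mA u l : L l -> measurable_fun setT (A u l).
Proof. by move=> Ll; apply: measurable_funB => //; exact: mdotp. Qed.

Let A_mean u l : L l -> P.-integrable setT (EFin \o A u l) /\ \int[P]_w A u l w = 0.
Proof. by move=> Ll; exact: (normal_law_mean (mdotp u Ll) (posdef_ge0 pS u) (dot_law u Ll)). Qed.

Let A_sq_i u l : L l -> P.-integrable setT (EFin \o (fun w => A u l w ^+ 2)).
Proof. by move=> Ll; exact: (normal_law_sq_integrable (mdotp u Ll) (posdef_ge0 pS u) (dot_law u Ll)). Qed.

Let A_sq u l : L l -> \int[P]_w A u l w ^+ 2 = qform Sigma u.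
Proof. by move=> Ll; exact: (normal_law_sq (mdotp u Ll) (posdef_ge0 pS u) (dot_law u Ll)). Qed.

Let AA_i u v l m : L l -> L m -> P.-integrable setT (EFin \o (fun w => A u l w * A v m w)).
Proof.
move=> Ll Lm.
have i2 := RintegrableD measurableT (A_sq_i u Ll) (A_sq_i v Lm).
apply: (le_integrable measurableT _ _ i2).
  by apply/measurable_EFinP; apply: measurable_funM; exact: mA.
move=> w _ /=; rewrite lee_fin.
rewrite (ger0_norm (addr_ge0 (sqr_ge0 _) (sqr_ge0 _))) normrM.
rewrite -(real_normK (num_real (A u l w))) -(real_normK (num_real (A v m w))).
have := sqr_ge0 (`|A u l w| - `|A v m w|); have := sqr_ge0 (`|A u l w| + `|A v m w|); nra.
Qed.

Let e k : 'cV[R]_d := delta_mx k ord0.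

Let dot_e k u : dot (e k) u = u k ord0.
Proof.
rewrite /dot (bigD1 k)//= big1 => [|i ik]; rewrite mxE ?eqxx ?mul1r ?addr0//.
by rewrite (negbTE ik) mul0r.
Qed.

Let entry_mean l k : L l -> 'E_P[fun w => p l w k ord0]%E = (mu k ord0)%:E.
Proof.
move=> Ll; have [Ai Am] := A_mean (e k) Ll.
have oi : P.-integrable setT (EFin \o (fun w : T => mu k ord0)).
  by apply: (@bounded_integrable _ _ _ _ _ `|mu k ord0|).
have Xi : P.-integrable setT (EFin \o (fun w => p l w k ord0)).
  have := RintegrableD measurableT Ai oi; under eq_fun do rewrite /A !dot_e subrK; exact.
rewrite unlock -[LHS]fineK; last exact: (integrable_fin_num measurableT Xi).
congr (_%:E); rewrite -/(Rintegral _ _ _); apply/eqP; rewrite -subr_eq0 -Am.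
rewrite -[X in _ - X](Rintegral_P_cst P) -RintegralB//; apply/eqP.
by apply: eq_Rintegral => w _; rewrite /A !dot_e.
Qed.

Let covE l k k' : L l -> covmx P (p 0) (p l) k k' = \int[P]_w (A (e k) 0 w * A (e k') l w).
Proof.
move=> Ll; rewrite mxE unlock !entry_mean//= unlock /Rintegral.
by congr fine; apply: eq_integral => w _; rewrite /A !dot_e.
Qed.

Let A_sum u l w : A u l w = \sum_k u k ord0 * A (e k) l w.
Proof.
rewrite /A -dotBr /dot; apply: eq_bigr => k _.
by rewrite -/(dot _ _) -/(dot _ _) !dot_e !mxE.
Qed.

Let A_cov u l : L l -> \int[P]_w (A u 0 w * A u l w) = qform (covmx P (p 0) (p l)) u.
Proof.
move=> Ll; rewrite qform_sum.
have i1 k k' : P.-integrable setT (EFin \o (fun w => u k ord0 * u k' ord0 * (A (e k) 0 w * A (e k') l w))).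
  by apply: RintegrableZl => //; exact: AA_i.
transitivity (\int[P]_w (\sum_k \sum_k' u k ord0 * u k' ord0 * (A (e k) 0 w * A (e k') l w))).
  apply: eq_Rintegral => w _; rewrite (A_sum u 0) (A_sum u l) mulr_suml.
  apply: eq_bigr => k _; rewrite mulr_sumr; apply: eq_bigr => k' _; ring.
rewrite Rintegral_sum_fin//; last by move=> k; exact: integrable_sum_fin.
apply: eq_bigr => k _; rewrite Rintegral_sum_fin//; apply: eq_bigr => k' _.
by rewrite RintegralZl ?covE//; [ring|exact: AA_i].
Qed.

(** Joint Gaussianity only provides some mean m and variance v; they are identified by the first two
    moments, the cross term being the quadratic form of the covariance matrix. *)
Let increment_law u l : L l ->
  0 <= qform Sigma u - qform (covmx P (p 0) (p l)) u /\
  normal_law P (fun w => dot u (p l w - p 0 w)) 0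
    (2 * (qform Sigma u - qform (covmx P (p 0) (p l)) u)).
Proof.
move=> Ll.
pose i (k : 'I_2) : 'cV[R]_d := if k == ord0 then 0 else l.
have Li k : L (i k) by rewrite /i; case: ifP.
have [m [v [v0 Xlaw]]] := pgauss Li (fun k : 'I_2 => if k == ord0 then - u else u).
have XE : (fun w => \sum_(k < 2) (((if k == ord0 then - u else u))^T *m p (i k) w) ord0 ord0) =
    (fun w => dot u (p l w - p 0 w)).
  apply/funext => w; rewrite !big_ord_recl big_ord0 addr0 /i/= -!dotE (dotC (- u)) dotNr (dotC _ u) dotBr.
  by rewrite addrC.
rewrite XE in Xlaw.
have mX : measurable_fun setT (fun w => dot u (p l w - p 0 w)).
  by apply: measurable_dot; apply: measurable_cVB; exact: mp.
have XA w : dot u (p l w - p 0 w) = A u l w - A u 0 w by rewrite /A dotBr; ring.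
have [Ali Alm] := A_mean u Ll; have [A0i A0m] := A_mean u L0.
have [Xi Xm] := normal_law_mean mX v0 Xlaw.
have m0 : m = 0.
  have oi : P.-integrable setT (EFin \o (fun w : T => m)).
    by apply: (@bounded_integrable _ _ _ _ _ `|m|).
  have := Xm; under eq_Rintegral do rewrite XA.
  rewrite RintegralB//; last exact: RintegrableB.
  by rewrite RintegralB// Alm A0m Rintegral_P_cst; lra.
have vE : v = 2 * (qform Sigma u - qform (covmx P (p 0) (p l)) u).
  rewrite -(normal_law_sq mX v0 Xlaw) m0.
  transitivity (\int[P]_w ((A u l w ^+ 2 + A u 0 w ^+ 2) - 2 * (A u 0 w * A u l w))).
    by apply: eq_Rintegral => w _; rewrite XA; ring.
  rewrite RintegralB//; [|by apply: RintegrableD => //; exact: A_sq_i|by apply: RintegrableZl => //; exact: AA_i].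
  rewrite RintegralD//; [|exact: A_sq_i..].
  by rewrite RintegralZl ?A_sq ?A_cov//; [ring|exact: AA_i].
split; first by move: v0; rewrite vE; lra.
by rewrite -vE -m0.
Qed.

Lemma increment_char u c l : L l ->
  0 <= qform Sigma u - qform (covmx P (p 0) (p l)) u /\
  charE P (fun w => p l w - p 0 w) u c =
    cos c * expR (- (qform Sigma u - qform (covmx P (p 0) (p l)) u)).
Proof.
move=> Ll; have [S0 Xlaw] := increment_law u Ll; split=> //.
have mX : measurable_fun setT (fun w => dot u (p l w - p 0 w)).
  by apply: measurable_dot; apply: measurable_cVB; exact: mp.
have v0 : 0 <= 2 * (qform Sigma u - qform (covmx P (p 0) (p l)) u) by rewrite mulr_ge0.
have := normal_law_cos mX v0 Xlaw c 1.
rewrite /charE; under eq_Rintegral do rewrite subr0 mul1r.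
by move=> ->; congr (_ * expR (- _)); field.
Qed.

(** The factor sqrt 2 gives variance 2 u^T Sigma u along u, that of an increment with vanishing
    covariance. *)
Let Y w := Num.sqrt 2 *: (p 0 w - mu).

Lemma measurable_limit_increment : measurable_fun setT Y.
Proof. by apply: measurable_cVZ; apply: measurable_cVB => //; exact: mp. Qed.

Lemma limit_increment_char u c : charE P Y u c = cos c * expR (- qform Sigma u).
Proof.
have := normal_law_cos (mdotp u L0) (posdef_ge0 pS u) (dot_law u L0) c (Num.sqrt 2).
rewrite sqr_sqrtr// => E; rewrite /charE.
under eq_Rintegral do rewrite /Y dotZr dotBr.
by rewrite E; congr (_ * expR (- _)); field.
Qed.

Lemma limit_increment_enorm_integrable : P.-integrable setT (EFin \o (fun w => enorm (Y w))).
Proof.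
have i1 k : P.-integrable setT (EFin \o (fun w => Num.sqrt 2 * (1 + A (e k) 0 w ^+ 2))).
  apply: RintegrableZl => //; apply: RintegrableD => //; last exact: A_sq_i.
  by apply: (@bounded_integrable _ _ _ _ _ 1) => // w; rewrite normr1.
have i2 := integrable_sum_fin measurableT i1.
apply: (le_integrable measurableT _ _ i2).
  by apply/measurable_EFinP; apply: measurable_enorm; exact: measurable_limit_increment.
move=> w _; rewrite /comp lee_fin (ger0_norm (enorm_ge0 _)); apply: le_trans (ler_norm _).
apply: le_trans (enorm_le_sum _) _; apply: ler_sum => k _.
rewrite mxE normrM (ger0_norm (sqrtr_ge0 _)) ler_wpM2l ?sqrtr_ge0//.
have -> : (p 0 w - mu) k ord0 = A (e k) 0 w by rewrite /A !dot_e !mxE.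
rewrite -(real_normK (num_real (A _ _ _))).
have := normr_ge0 (A (e k) 0 w); nra.
Qed.

(** The exponents are b = u^T Sigma u and a = b - u^T C u with |a - b| <= K N(C) b, so
    [expRN_compare] applies; the phase factor is at most 1. *)
Lemma increment_char_compare (N : 'M[R]_d -> R) : is_matrix_norm N -> exists K, 0 <= K /\
  forall l, L l -> forall u c,
  `|charE P (fun w => p l w - p 0 w) u c - charE P Y u c| <=
    K * N (covmx P (p 0) (p l)) * (1 - charE P Y u 0).
Proof.
move=> nN; have [K [K0 HK]] := qform_relative_bound nN pS.
exists (4 * K); split; first by rewrite mulr_ge0.
move=> l Ll u c; have [D0 ->] := increment_char u c Ll.
rewrite !limit_increment_char cos0 mul1r -mulrBr normrM.
apply: (@le_trans _ _ (1 * (4 * (K * N (covmx P (p 0) (p l))) * (1 - expR (- qform Sigma u))))); last first.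
  by rewrite mul1r !mulrA.
apply: ler_pM => //; first exact: cos_max.
apply: expRN_compare => //; first exact: posdef_ge0.
by rewrite addrAC subrr add0r normrN.
Qed.

End gaussian_increments.

(** * Variance of the number of points in a ball *)

Section number_variance.
Context {R : realType} {dT : measure_display} {T : measurableType dT}.
Variable P : probability T R.
Context {d : nat}.
Variables (a : d.-tuple 'cV[R]_d) (p : 'cV[R]_d -> T -> 'cV[R]_d) (U : T -> 'cV[R]_d).
Variables (mu : 'cV[R]_d) (Sigma : 'M[R]_d) (N : 'M[R]_d -> R).
Hypothesis d0 : (1 <= d)%N.
Hypothesis ba : basis_of fullv a.
Hypothesis mp : forall i, lattice a i -> measurable_fun setT (p i).
Hypothesis pstat : strictly_stationary P (lattice a) p.
Hypothesis pgauss : gaussian_field P (lattice a) p.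
Hypothesis pS : positive_definite Sigma.
Hypothesis p0law : multinormal_law P (p 0) mu Sigma.
Hypothesis nN : is_matrix_norm N.
Hypothesis Csum : (\esum_(i in lattice a) (N (covmx P (p 0) (p i)))%:E < +oo)%E.
Hypothesis mU : measurable_fun setT U.
Hypothesis Uunif : uniformly_distributed P (fundamental_domain a) U.
Hypothesis Uind : independent_of_field P (lattice a) p U.
Local Notation Z := {ffun 'I_d -> int}.
Local Notation B := (@closed_eball R d).
Local Notation lp := (lpoint a).
Local Notation V := (covol a).
Local Notation Xi := (perturbed_lattice (lattice a) p U).

Let V0 := covol_gt0 ba.

(** A finite mean gives almost sure finiteness for each integer radius; these are countably many
    and, by monotonicity, cover all radii on one event. *)
Lemma perturbed_lattice_ae_finite :
  {ae P, forall w, forall r : R, (Xi w (B r) < +oo)%E}.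
Proof.
have Xi0 w r : (0 <= Xi w (B r))%E.
  by rewrite perturbed_latticeE// esum_ge0// => z _; rewrite lee_fin.
have fin (n : nat) : {ae P, forall w, [set: T] w -> Xi w (B n%:R) \is a fin_num}.
  apply: integrable_ae => //; apply/integrableP; split.
    exact: (measurable_perturbed_lattice ba mp mU).
  under eq_integral do rewrite gee0_abs//.
  by rewrite (perturbed_lattice_mean ba mp pstat mU Uunif Uind) ltry.
apply: filterS (ae_foralln fin) => w Hw r.
pose n := (Num.truncn r).+1.
have rn : r <= n%:R by apply/ltW/truncnS_gt.
apply: (@le_lt_trans _ _ (Xi w (B n%:R))); last first.
  by have := Hw n I; rewrite ge0_fin_numE.
rewrite !perturbed_latticeE//; apply: le_esum => z _; rewrite lee_fin !indicE ler_nat.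
rewrite !closed_eballE; case: (boolP (enorm _ <= r)) => // h.
by rewrite (le_trans h rn).
Qed.

Let X l w := p (lp l) w - p 0 w.
Let Y w := Num.sqrt 2 *: (p 0 w - mu).

Let L0 : lattice a 0. Proof. by rewrite -(lpoint0 a); exact: lattice_lpoint. Qed.

Let mX l : measurable_fun setT (X l).
Proof. by apply: measurable_cVB; apply: mp => //; exact: lattice_lpoint. Qed.

Let mY : measurable_fun setT Y.
Proof. exact: (measurable_limit_increment mu L0 mp). Qed.

(** The gain of one order: for the covariogram [Lam] is O(r^(d-1)), while [g 0] is of order r^d. *)
Let defect_le (g : 'cV[R]_d -> R) (Cg Lam : R) : measurable_fun setT g ->
  (forall x, `|g x| <= Cg) -> (forall x y, `|g (x + y) - g x| <= Lam * enorm y) ->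
  g 0 - \int[P]_w g (Y w) <= Lam * \int[P]_w enorm (Y w).
Proof.
move=> mg gC glip.
have Yi := limit_increment_enorm_integrable L0 mp pstat pS p0law.
have gi : P.-integrable setT (EFin \o (fun w => g (Y w))).
  by apply: (@bounded_integrable _ _ _ _ _ Cg) => //; exact: (measurableT_comp mg).
have ci : P.-integrable setT (EFin \o (fun w : T => g 0)).
  by apply: (@bounded_integrable _ _ _ _ _ `|g 0|).
rewrite -[X in X - _](Rintegral_P_cst P) -RintegralB// -RintegralZl//.
apply: le_Rintegral => //.
- exact: RintegrableB.
- exact: RintegrableZl.
move=> w _; have := glip 0 (Y w); rewrite add0r.
by rewrite ler_norml => /andP[h _]; lra.
Qed.

Let Nsum : R := fine (\esum_(l in [set: Z]) (N (covmx P (p 0) (p (lp l))))%:E)%E.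

Let NsumE : (\esum_(l in [set: Z]) (N (covmx P (p 0) (p (lp l))))%:E = Nsum%:E)%E.
Proof.
rewrite /Nsum fineK// ge0_fin_numE.
  by have := Csum; rewrite (esum_lattice ba).
by apply: esum_ge0 => l _; rewrite lee_fin; exact: matrix_norm_ge0.
Qed.

Let Nsum_ge0 : 0 <= Nsum.
Proof.
by rewrite fine_ge0// esum_ge0// => l _; rewrite lee_fin; exact: matrix_norm_ge0.
Qed.

(** K is chosen before [g], hence does not depend on the radius. Summed over l, the expectations at
    [Y] form the periodization, and the errors are weighted by the finite total [Nsum]. *)
Let lattice_sum_compare : exists K : R, 0 <= K /\
  forall (g : 'cV[R]_d -> R) (rho Cg Lam : R), measurable_fun setT g ->
  (forall x, 0 <= g x) -> (forall x, g x <= Cg) ->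
  (forall x, rho < enorm x -> g x = 0) ->
  (forall x y, `|g (x + y) - g x| <= Lam * enorm y) ->
  (forall x, g (- x) = g x) -> (forall u, 0 <= ghat g u) ->
  (\esum_(l in [set: Z]) \int[P]_w (g (lp l + X l w)%R)%:E <=
    (\int[P]_w gper a g (Y w) + K * (Lam * \int[P]_w enorm (Y w)))%:E)%E.
Proof.
have [K [K0 HK]] := increment_char_compare L0 mp pstat pgauss pS p0law nN.
exists (K * Nsum); split; first by rewrite mulr_ge0.
move=> g rho Cg Lam mg g0 gC gsupp glip geven gpos.
have gCn x : `|g x| <= Cg by rewrite ger0_norm.
set G := g 0 - \int[P]_w g (Y w).
have gi (f : T -> 'cV[R]_d) : measurable_fun setT f -> P.-integrable setT (EFin \o (fun w => g (f w))).
  by move=> mf; apply: (@bounded_integrable _ _ _ _ _ Cg) => //; exact: (measurableT_comp mg).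
have mlp (f : T -> 'cV[R]_d) l : measurable_fun setT f -> measurable_fun setT (fun w => lp l + f w).
  by move=> mf; exact: measurable_cVD.
have RE (f : T -> 'cV[R]_d) : measurable_fun setT f ->
    (\int[P]_w (g (f w))%:E)%E = (\int[P]_w g (f w))%:E.
  by move=> mf; rewrite /Rintegral fineK//; exact: (integrable_fin_num measurableT (gi _ mf)).
have Nc l : 0 <= N (covmx P (p 0) (p (lp l))) by exact: matrix_norm_ge0.
have cmp l := covariogram_compare ba mg g0 gC gsupp glip geven gpos (lp l)
    (mulr_ge0 K0 (Nc l)) (mX l) mY (HK _ (lattice_lpoint ba l)).
pose M := Lam * \int[P]_w enorm (Y w).
have Yi := limit_increment_enorm_integrable L0 mp pstat pS p0law.
have M0 : 0 <= M.
  rewrite /M -RintegralZl//; apply: Rintegral_ge0 => w _.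
  exact: le_trans (normr_ge0 _) (glip 0 _).
have GM : G <= M by exact: defect_le gCn glip.
have step l : (\int[P]_w (g (lp l + X l w)%R)%:E <=
    \int[P]_w (g (lp l + Y w)%R)%:E + ((K * M) * N (covmx P (p 0%R) (p (lp l))))%:E)%E.
  rewrite !RE; [|exact: mlp..]; rewrite -EFinD lee_fin.
  have := cmp l; rewrite ler_norml -/G => /andP[_ h].
  have := ler_wpM2l (mulr_ge0 K0 (Nc l)) GM.
  have -> : K * M * N (covmx P (p 0) (p (lp l))) = K * N (covmx P (p 0) (p (lp l))) * M by ring.
  lra.
rewrite -/M mulrAC.
apply: le_trans (le_esum (fun l _ => step l)) _.
rewrite esumD; first last.
- by move=> l _; rewrite lee_fin; apply: mulr_ge0; [exact: mulr_ge0|].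
- by move=> l _; apply: integral_ge0 => w _; rewrite lee_fin.
rewrite EFinD; apply: leeD.
  rewrite -integral_esum_count//; first last.
    by move=> l w; rewrite lee_fin.
    by move=> l; apply/measurable_EFinP; apply: (measurableT_comp mg); exact: mlp.
  have gpi := gper_rv_integrable P ba mg g0 gC gsupp 0 mY.
  have -> : \int[P]_w gper a g (Y w) = \int[P]_w gper a g (0 + Y w).
    by apply: eq_Rintegral => w _; rewrite add0r.
  rewrite /Rintegral fineK; last exact: (integrable_fin_num measurableT gpi).
  rewrite le_eqVlt; apply/orP; left; apply/eqP; apply: eq_integral => w _.
  rewrite add0r -(gperE ba g0 gC gsupp).
  by apply: eq_esum => l _; rewrite addrC.
have KMN l : (0 <= (K * M * N (covmx P (p 0%R) (p (lp l))))%:E)%E.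
  by rewrite lee_fin; apply: mulr_ge0; [exact: mulr_ge0|].
have NE l : (0 <= (N (covmx P (p 0%R) (p (lp l))))%:E)%E by rewrite lee_fin.
rewrite EFinM -NsumE (esum_countE KMN) (esum_countE NE).
rewrite -nneseriesZl; last by move=> i _; case: pickle_inv => [l|//]; rewrite lee_fin.
rewrite le_eqVlt; apply/orP; left; apply/eqP; apply: eq_eseriesr => i _.
by case: pickle_inv => [l|]; rewrite ?mule0 ?EFinM.
Qed.

Lemma second_moment_bound : exists r0 K : R, 0 < r0 /\ forall r, r0 <= r ->
  (\int[P]_w ((fine (Xi w (B r))) ^+ 2)%:E <= ((@vol R d r / V) ^+ 2 + K * r ^+ d.-1)%:E)%E.
Proof.
have charY u : charE P Y u 0 = expR (- qform Sigma u).
  by rewrite (limit_increment_char L0 mp pstat pS p0law) cos0 mul1r.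
have [r0 [K1 [r00 [K10 HK1]]]] := gper_expectation_le ba pS mY charY d0.
have [K [K0 HK]] := lattice_sum_compare.
pose M := \int[P]_w enorm (Y w).
exists r0, (V^-1 * (K1 + K * (@covg_lip R d * M))); split=> // r rr.
have rp : 0 < r by exact: lt_le_trans rr.
have V0' : 0 <= V^-1 by rewrite invr_ge0 ltW.
have S2 := perturbed_lattice_second_moment ba mp pstat mU Uunif Uind r.
apply: le_trans S2 _.
have lip (x y : 'cV[R]_d) := covg_lipschitz x y d0 rp.
have S1 := HK _ _ _ _ (measurable_covg r) (@covg_ge0 R d r) (@covg_le R d r)
    (@covg_supp R d r) lip (@covgN R d r) (@ghat_covg_ge0 R d r).
have pE (l : Z) w : p (lp l) w - p (lp 0) w = X l w by rewrite /X lpoint0.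
under eq_esum do under eq_integral do rewrite pE.
apply: le_trans (lee_wpmul2l _ S1) _; first by rewrite lee_fin.
rewrite -EFinM lee_fin.
have H1 := HK1 r rr.
apply: (@le_trans _ _ (V^-1 * ((@vol R d r ^+ 2 / V + K1 * r ^+ d.-1) + K * (@covg_lip R d * r ^+ d.-1 * M)))).
  by rewrite ler_wpM2l// lerD.
rewrite le_eqVlt; apply/orP; left; apply/eqP; field.
by rewrite gt_eqF.
Qed.

Lemma variance_bound : exists r0 K : R, 0 < r0 /\ forall r, r0 <= r ->
  (variance P (fun w => fine (Xi w (B r))) <= (K * r ^+ d.-1)%:E)%E.
Proof.
have [r0 [K [r00 HK]]] := second_moment_bound.
exists r0, K; split=> // r rr; pose f w := fine (Xi w (B r)); pose m := @vol R d r / V.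
have mXi := measurable_perturbed_lattice ba mp mU r.
have mf : measurable_fun setT f by exact: (measurableT_comp (@fine_measurable _ _ measurableT) mXi).
have f2i : P.-integrable setT (EFin \o (fun w => f w ^+ 2)).
  apply/integrableP; split; first by apply/measurable_EFinP; exact: measurable_funX.
  under eq_integral do rewrite /= ger0_norm ?sqr_ge0//.
  by apply: le_lt_trans (HK r rr) _; exact: ltry.
have oi (c : R) : P.-integrable setT (EFin \o (fun w : T => c)).
  by apply: (@bounded_integrable _ _ _ _ _ `|c|).
have fi : P.-integrable setT (EFin \o f).
  apply: (le_integrable measurableT _ _ (RintegrableD measurableT (oi 1) f2i)).
    exact/measurable_EFinP.
  move=> w _ /=; rewrite lee_fin (ger0_norm (addr_ge0 ler01 (sqr_ge0 _))).
  rewrite -(real_normK (num_real (f w))); have := normr_ge0 (f w); nra.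
(* [fine] alters the count only on the null event where it is infinite, so the mean is exactly m,
   and m^2 cancels the leading term of the second moment. *)
have fE : (\int[P]_w (f w)%:E)%E = m%:E.
  rewrite -(perturbed_lattice_mean ba mp pstat mU Uunif Uind r).
  apply: ae_eq_integral => //; first exact/measurable_EFinP.
  apply: filterS perturbed_lattice_ae_finite => w h _; rewrite /f fineK//.
  rewrite ge0_fin_numE ?h// perturbed_latticeE//.
  by apply: esum_ge0 => z _; rewrite lee_fin.
rewrite -/f /variance unlock unlock fE /=.
have E w : ((f \- cst m) * (f \- cst m))%R w = f w ^+ 2 - 2 * m * f w + m ^+ 2.
  by rewrite -[LHS]/((f w - m) * (f w - m)); ring.
have i1 := RintegrableB measurableT f2i (RintegrableZl measurableT (2 * m) fi).
have i2 := RintegrableD measurableT i1 (oi (m ^+ 2)).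
under eq_integral do rewrite E.
rewrite -[leLHS]fineK; last exact: (integrable_fin_num measurableT i2).
rewrite -/(Rintegral _ _ _) lee_fin RintegralD// RintegralB//; last exact: RintegrableZl.
rewrite RintegralZl// Rintegral_P_cst.
have -> : \int[P]_w f w = m by rewrite /Rintegral fE.
have : \int[P]_w f w ^+ 2 <= m ^+ 2 + K * r ^+ d.-1.
  rewrite -lee_fin /Rintegral fineK; first exact: HK.
  exact: (integrable_fin_num measurableT f2i).
lra.
Qed.

End number_variance.

Theorem theorem2 (R : realType) (dT : measure_display) (T : measurableType dT)
    (P : probability T R) (d : nat) (a : d.-tuple 'cV[R]_d)
    (p : 'cV[R]_d -> T -> 'cV[R]_d) (U : T -> 'cV[R]_d)
    (mu : 'cV[R]_d) (Sigma : 'M[R]_d) (N : 'M[R]_d -> R) :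
  (1 <= d)%N ->
  basis_of fullv a ->
  (forall i, lattice a i -> measurable_fun setT (p i)) ->
  strictly_stationary P (lattice a) p ->
  gaussian_field P (lattice a) p ->
  positive_definite Sigma ->
  multinormal_law P (p 0) mu Sigma ->
  is_matrix_norm N ->
  (\esum_(i in lattice a) (N (covmx P (p 0) (p i)))%:E < +oo)%E ->
  measurable_fun setT U ->
  uniformly_distributed P (fundamental_domain a) U ->
  independent_of_field P (lattice a) p U ->
  class_I_hyperuniform P (perturbed_lattice (lattice a) p U).
Proof.
move=> d0 ba mp pstat pgauss pS p0law nN Csum mU Uunif Uind; split.
  exact: perturbed_lattice_ae_finite.
have [r0 [K [r00 HK]]] := variance_bound d0 ba mp pstat pgauss pS p0law nN Csum mU Uunif Uind.
have v1 : 0 < @vol R d 1 by exact: vol1_gt0.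
(* As the volume is r^d times that of the unit ball, K r^(d-1) divided by it is this constant over
   r. *)
exists (K / @vol R d 1); near=> r.
have rr : r0 <= r by near: r; apply: nbhs_pinfty_ge; exact: num_real.
have vr : @vol R d r = r ^+ d * @vol R d 1 by exact: volZ.
have vr0 : 0 < @vol R d r by exact: vol_gt0.
rewrite [X in (_ / X)%E](_ : _ = (@vol R d r)%:E); last exact: volE.
rewrite inver gt_eqF// lee_pdivrMr//.
apply: le_trans (HK r rr) _; rewrite -EFinM lee_fin vr.
rewrite le_eqVlt; apply/orP; left; apply/eqP.
have -> : r ^+ d = r * r ^+ d.-1 by rewrite -exprS prednK.
field.
by rewrite !gt_eqF.
Unshelve. all: by end_near.
Qed.
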